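(* Let $2 \leq p \leq \infty$ and $k \in \mathbb{N}$. Then \[ \mathrm{ac}_k(B_p^m,B_p^m) \lesssim \sqrt{ \frac{\min\{ p, \log (\frac{2m}{k}) \}}{k}}. \] Moreover, given $X\subseteq B_p^m$ and $\boldsymbol{z}\in\mathrm{conv}(X)$, where $\boldsymbol{z}$ is given as a convex combination of at most $m+1$ vectors in $X$, vectors $\boldsymbol{v}_1,\ldots,\boldsymbol{v}_k\in X$ (repetition allowed) for which $\|\boldsymbol{z}-\frac1k\sum_{i=1}^k\boldsymbol{v}_i\|_p \lesssim \sqrt{ \frac{\min\{ p, \log (\frac{2m}{k}) \}}{k}}$ can be found in time $O(\log^2 m) \cdot T(m,m+1) \leq O(m^{1+\omega}\log^2(m))$.
   Context: $m$ is a positive integer; $B_p^m := \{ \boldsymbol{x} \in \mathbb{R}^m \mid \|\boldsymbol{x}\|_p \leq 1\}$. $A\lesssim B$ means $A\le C\cdot B$ for a universal constant $C>0$. For symmetric convex bodies $P,Q\subseteq\mathbb{R}^m$, with $\|\boldsymbol{x}\|_Q=\min\{s\ge 0\mid \boldsymbol{x}\in sQ\}$, \[ \mathrm{ac}_k(P,Q) := \sup_{X \subseteq P,\ \boldsymbol{z} \in \mathrm{conv}(X)}\ \inf_{\boldsymbol{v}_1,\ldots,\boldsymbol{v}_k \in X} \Big\|\boldsymbol{z}-\frac{1}{k}\sum_{i=1}^k \boldsymbol{v}_i\Big\|_Q , \] where the $\boldsymbol{v}_i$ may be taken with repetition. $T(m,n)$: for $\boldsymbol{A}\in\mathbb{R}^{m\times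 n}$ with rows $\boldsymbol{A}_1,\dots,\boldsymbol{A}_m$ and $\boldsymbol{x}_0\in[-1,1]^n$, $\mathcal{D}(\boldsymbol{A},\boldsymbol{x}_0)$ denotes the (Lovett–Meka) distribution on $[-1,1]^n$ with the following properties, where $C_1,C_2>0$ are fixed, small enough universal constants. (A) For all $\boldsymbol{x}\sim\mathcal{D}(\boldsymbol{A},\boldsymbol{x}_0)$, $|\{j\in[n]: x_j\in\{\pm1\}\}|\ge n/2$. (B) For all $\boldsymbol{x}\sim\mathcal{D}(\boldsymbol{A},\boldsymbol{x}_0)$, $\|\boldsymbol{A}(\boldsymbol{x}-\boldsymbol{x}_0)\|_\infty\le\Delta$, where $\Delta\ge0$ is any parameter satisfying $\sum_{i=1}^m\exp(-C_1\Delta^2/\|\boldsymbol{A}_i\|_2^2)\le C_2 n$. (C) $\mathbb{E}[\boldsymbol{x}]=\boldsymbol{x}_0$. (D) $\boldsymbol{x}-\boldsymbol{x}_0$ is $O(1)$-subgaussian; in particular $\|\langle\boldsymbol{A}_i,\boldsymbol{x}-\boldsymbol{x}_0\rangle\|_{\psi_2}\lesssim\|\boldsymbol{A}_i\|_2$ for all $i$, where $\|Y\|_{\psi_2}=\inf\{s>0:\mathbb{E}[\exp(Y^2/s^2)]\le2\}$. $T(m,n)$ is the best running time to generate a sample from this distribution; it is assumed to be non-decreasing in $m$ and $n$ with $T(m,n)\ge mn$, and it is known that $T(m,n)\le O(n^{1+\omega}+n^2m)$, where $\omega$ is the exponent of matrix multiplication.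
   Formalization: For k > m, where log(2m/k) tends to 0 and then turns negative and the bound fails (m=1, k=2, X={-1,1}, z=1/2), the logarithm is replaced by log 2; and log m is replaced by log 2 when m = 1, where log^2 m = 0 would allow no running time. *)

(* Defs.v *)
From HB Require Import structures.
From mathcomp Require Export all_boot all_order all_algebra.
From mathcomp Require Export all_classical all_reals all_analysis.
Set Implicit Arguments.
Unset Strict Implicit.
Unset Printing Implicit Defensive.
Import Order.TTheory GRing.Theory Num.Theory.
Export numFieldNormedType.Exports.
Local Open Scope classical_set_scope.
Local Open Scope ring_scope.

Section Caratheodory.
Variable R : realType.

(* The value at -oo is a dummy: only 2 <= p <= +oo is used. *)
Definition lpnorm (m : nat) (p : \bar R) (x : 'rV[R]_m) : R :=
  match p with
  | r%:E => (\sum_(i < m) `|x 0 i| `^ r) `^ r^-1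
  | +oo%E => \big[Num.max/0]_(i < m) `|x 0 i|
  | -oo%E => 0
  end.

Definition lpball (m : nat) (p : \bar R) : set 'rV[R]_m :=
  [set x | lpnorm p x <= 1].

Definition conv (m : nat) (X : set 'rV[R]_m) : set 'rV[R]_m :=
  [set z | exists (n : nat) (lam : 'I_n -> R) (V : 'I_n -> 'rV[R]_m),
     [/\ forall i, 0 <= lam i, \sum_i lam i = 1, forall i, X (V i) &
         z = \sum_i lam i *: V i]].

Definition gauge (m : nat) (Q : set 'rV[R]_m) (x : 'rV[R]_m) : \bar R :=
  ereal_inf [set s%:E | s in [set s : R |
    0 <= s /\ exists2 y, Q y & x = s *: y]].

Definition ac (m k : nat) (P Q : set 'rV[R]_m) : \bar R :=
  ereal_sup [set a | exists (X : set 'rV[R]_m) (z : 'rV[R]_m),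
    [/\ X `<=` P, conv X z &
        a = ereal_inf [set gauge Q (z - k%:R^-1 *: \sum_(i < k) v i) |
              v in [set v : 'I_k -> 'rV[R]_m | forall i, X (v i)]]]].

(* log (2m/k) for k <= m; for k > m, where that expression tends to 0 and then
   becomes negative, it is frozen at its value log 2 for k = m. *)
Definition log2mk (m k : nat) : R := ln (2 * m%:R / (minn k m)%:R).

Definition rate (m k : nat) (p : \bar R) : R :=
  Num.sqrt (fine (Order.min p (log2mk m k)%:E) / k%:R).

(* log m for m >= 2, and log 2 instead of 0 for m = 1. *)
Definition logm (m : nat) : R := ln (maxn m 2)%:R.

End Caratheodory.
Arguments lpball {R} m p.

(* The exponent of matrix multiplication: total arithmetic complexity over R,
   in straight-line programs over +, -, * and real constants. Each instruction
   appends one value to the list of values computed so far, which initially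
   holds the inputs. *)
Section Omega.
Variable R : realType.

Inductive slp_instr :=
| SConst of R
| SAdd of nat & nat
| SSub of nat & nat
| SMul of nat & nat.

Definition slp_value (v : seq R) (i : slp_instr) : R :=
  match i with
  | SConst c => c
  | SAdd a b => v`_a + v`_b
  | SSub a b => v`_a - v`_b
  | SMul a b => v`_a * v`_b
  end.

Definition slp_run (inp : seq R) (P : seq slp_instr) : seq R :=
  foldl (fun v i => rcons v (slp_value v i)) inp P.

Definition entries (n : nat) (A : 'M[R]_n) : seq R :=
  [seq A i j | i <- enum 'I_n, j <- enum 'I_n].

Definition slp_mulmx (n : nat) (P : seq slp_instr) : Prop :=
  exists out : 'I_n -> 'I_n -> nat, forall (A B : 'M[R]_n) i j,
    (slp_run (entries A ++ entries B) P)`_(out i j) = (A *m B) i j.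

Definition omega : R :=
  inf [set tau : R | exists c : R, forall n : nat, (0 < n)%N ->
    exists2 P, slp_mulmx n P & (size P)%:R <= c * n%:R `^ tau].

End Omega.

Section LovettMeka.
Variable R : realType.

Definition norm2 (n : nat) (x : 'rV[R]_n) : R :=
  Num.sqrt (\sum_j x 0 j ^+ 2).

Definition psi2 d (S : measurableType d) (P : probability S R) (Y : S -> R) :
    \bar R :=
  ereal_inf [set s%:E | s in [set s : R |
    0 < s /\ ('E_P[fun w => expR (Y w ^+ 2 / s ^+ 2)] <= 2%:E)%E]].

Definition row_of (n : nat) (x : n.-tuple R) : 'rV[R]_n := \row_j tnth x j.

Definition in_cube (n : nat) (x : 'rV[R]_n) : Prop := forall j, `|x 0 j| <= 1.

Definition sampler :=
  forall m n : nat, 'M[R]_(m, n) -> 'rV[R]_n -> probability (n.-tuple R) R.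

(* A zero row contributes exp(-oo) = 0 to the sum, hence the side condition. *)
Definition admissible (C1 C2 : R) (m n : nat) (A : 'M[R]_(m, n)) (Delta : R) :=
  0 <= Delta /\
  \sum_(i < m | row i A != 0)
     expR (- C1 * Delta ^+ 2 / norm2 (row i A) ^+ 2) <= C2 * n%:R.

Record lovett_meka (C1 C2 C3 : R) (D : sampler) : Prop := LovettMeka {
  lm_cube : forall m n (A : 'M[R]_(m, n)) x0, in_cube x0 ->
    {ae D m n A x0, forall x, in_cube (row_of x)};
  lm_frozen : forall m n (A : 'M[R]_(m, n)) x0, in_cube x0 ->
    {ae D m n A x0, forall x,
      (n <= 2 * #|[pred j : 'I_n | `|tnth x j|%R == 1%R]|)%N};
  lm_disc : forall m n (A : 'M[R]_(m, n)) x0 Delta, in_cube x0 ->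
    admissible C1 C2 A Delta ->
    {ae D m n A x0, forall x,
      forall i, `|(A *m (row_of x - x0)^T) i 0| <= Delta};
  lm_mean : forall m n (A : 'M[R]_(m, n)) x0, in_cube x0 ->
    forall j, ('E_(D m n A x0)[fun x => tnth x j])%E = (x0 0 j)%:E;
  lm_subgaussian : forall m n (A : 'M[R]_(m, n)) x0, in_cube x0 ->
    forall theta : 'rV[R]_n,
      (psi2 (D m n A x0) (fun x => (theta *m (row_of x - x0)^T) 0 0)%R
        <= (C3 * norm2 theta)%:E)%E
}.

Record sampling_time (CT : R) (T : nat -> nat -> nat) : Prop := SamplingTime {
  st_homo : forall m m' n n', (m <= m')%N -> (n <= n')%N -> (T m n <= T m' n')%N;
  st_ge : forall m n, (m * n <= T m n)%N;
  st_le : forall m n, (0 < m)%N -> (0 < n)%N ->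
    (T m n)%:R <= CT * (n%:R `^ (1 + omega R) + n%:R ^+ 2 * m%:R)
}.

End LovettMeka.

(* A uniform real RAM with a sampling oracle: an unbounded memory of natural
   numbers and one of reals, both indirectly addressed, unit-cost operations,
   and an instruction drawing from D(A, x0) that is charged T m n for a matrix
   A with m rows and n columns. Values and input data are only accessible
   through the instructions below; programs contain no real constants. All
   loops are bounded, so that every program terminates. *)
Inductive nexp :=
| NConst of nat
| NGet of nexp
| NAdd of nexp & nexp
| NSub of nexp & nexp
| NMul of nexp & nexp.

Inductive rexp :=
| RNat of nexp
| RGet of nexp
| RAdd of rexp & rexp
| RSub of rexp & rexp
| RMul of rexp & rexp
| RDiv of rexp & rexp
| RSqrt of rexp.

(* CSample er ec ea ex eo reads an (er x ec)-matrix, stored row by row from the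
   real address ea on, and a point x0 of dimension ec from the address ex on,
   and writes the sample from the address eo on. *)
Inductive cmd :=
| CSkip
| CNSet of nexp & nexp
| CRSet of nexp & rexp
| CFloor of nexp & rexp
| CSeq of cmd & cmd
| CNIfLe of nexp & nexp & cmd & cmd
| CRIfLe of rexp & rexp & cmd & cmd
| CRepeat of nexp & cmd
| CSample of nexp & nexp & nexp & nexp & nexp.

Fixpoint ncost (e : nexp) : nat :=
  match e with
  | NConst _ => 1
  | NGet a => (ncost a).+1
  | NAdd a b | NSub a b | NMul a b => (ncost a + ncost b).+1
  end.

Fixpoint rcost (e : rexp) : nat :=
  match e with
  | RNat a | RGet a => (ncost a).+1
  | RAdd a b | RSub a b | RMul a b | RDiv a b => (rcost a + rcost b).+1
  | RSqrt a => (rcost a).+1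
  end.

Section Semantics.
Variable R : realType.

Record state := State { nmem : nat -> nat; rmem : nat -> R; clock : nat }.

Definition upd (V : Type) (f : nat -> V) (a : nat) (v : V) : nat -> V :=
  fun b => if b == a then v else f b.

Definition nset (s : state) a v := State (upd (nmem s) a v) (rmem s) (clock s).
Definition rset (s : state) a v := State (nmem s) (upd (rmem s) a v) (clock s).
Definition tick (t : nat) (s : state) :=
  State (nmem s) (rmem s) (clock s + t).

Fixpoint neval (s : state) (e : nexp) : nat :=
  match e with
  | NConst c => c
  | NGet a => nmem s (neval s a)
  | NAdd a b => neval s a + neval s b
  | NSub a b => neval s a - neval s b
  | NMul a b => neval s a * neval s b
  end%N.

Fixpoint reval (s : state) (e : rexp) : R :=
  match e with
  | RNat a => (neval s a)%:R
  | RGet a => rmem s (neval s a)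
  | RAdd a b => reval s a + reval s b
  | RSub a b => reval s a - reval s b
  | RMul a b => reval s a * reval s b
  | RDiv a b => reval s a / reval s b
  | RSqrt a => Num.sqrt (reval s a)
  end.

Definition read_mx (s : state) (m n a : nat) : 'M[R]_(m, n) :=
  \matrix_(i, j) rmem s (a + i * n + j)%N.

Definition read_row (s : state) (n a : nat) : 'rV[R]_n :=
  \row_j rmem s (a + j)%N.

Definition write_tuple (s : state) (n a : nat) (x : n.-tuple R) : state :=
  foldl (fun s' (j : 'I_n) => rset s' (a + j)%N (tnth x j)) s (enum 'I_n).

(* An execution, as a tree branching on the answers of the oracle. *)
Inductive run :=
| Halt of state
| Draw (m n : nat) of 'M[R]_(m, n) & 'rV[R]_n & (n.-tuple R -> run).

Fixpoint bind (r : run) (f : state -> run) : run :=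
  match r with
  | Halt s => f s
  | Draw m n A x0 K => Draw A x0 (fun x => bind (K x) f)
  end.

Variable T : nat -> nat -> nat.

Fixpoint exec (c : cmd) (s : state) : run :=
  match c with
  | CSkip => Halt (tick 1 s)
  | CNSet a e =>
      Halt (tick (ncost a + ncost e).+1 (nset s (neval s a) (neval s e)))
  | CRSet a e =>
      Halt (tick (ncost a + rcost e).+1 (rset s (neval s a) (reval s e)))
  | CFloor a e =>
      Halt (tick (ncost a + rcost e).+1
              (nset s (neval s a) (Num.truncn (reval s e))))
  | CSeq c1 c2 => bind (exec c1 s) (exec c2)
  | CNIfLe a b c1 c2 =>
      exec (if (neval s a <= neval s b)%N then c1 else c2)
           (tick (ncost a + ncost b).+1 s)
  | CRIfLe a b c1 c2 =>
      exec (if reval s a <= reval s b then c1 else c2)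
           (tick (rcost a + rcost b).+1 s)
  | CRepeat e c1 =>
      iter (neval s e) (fun r => bind r (fun s' => exec c1 (tick 1 s')))
           (Halt (tick (ncost e).+1 s))
  | CSample er ec ea ex eo =>
      let m := neval s er in
      let n := neval s ec in
      Draw (read_mx s m n (neval s ea)) (read_row s n (neval s ex))
        (fun x => Halt
           (tick (ncost er + ncost ec + ncost ea + ncost ex + ncost eo + T m n).+1
              (write_tuple s (neval s eo) x)))
  end.

(* Whatever the answers of the oracle in the cube. *)
Fixpoint always (E : state -> Prop) (r : run) : Prop :=
  match r with
  | Halt s => E s
  | Draw m n A x0 K => forall x, in_cube (row_of x) -> always E (K x)
  end.

(* The successive draws are independent given the queries. No measurability of
   D in (A, x0) is assumed: the integral of a nonnegative function that is not
   measurable is the supremum over the simple functions below it, so prob is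
   then a lower probability. *)
Fixpoint prob (D : sampler R) (E : state -> Prop) (r : run) : \bar R :=
  match r with
  | Halt s => ((`[< E s >])%:R)%:E
  | Draw m n A x0 K => (\int[D m n A x0]_x prob D E (K x))%E
  end.

(* Natural memory: m, n, k and a flag for p = +oo. Real memory: the coordinates
   of V_0, ..., V_{n-1}, then the coefficients lam_0, ..., lam_{n-1}, then p
   (if finite). *)
Definition input (m n k : nat) (p : \bar R)
    (V : 'I_n -> 'rV[R]_m) (lam : 'I_n -> R) : state :=
  State
    (fun a => nth 0%N [:: m; n; k; nat_of_bool (p == +oo%E)] a)
    (fun a => nth 0 ([seq V i 0 j | i <- enum 'I_n, j <- enum 'I_m]
                     ++ [seq lam i | i <- enum 'I_n] ++ [:: fine p]) a)
    0.

(* The list v_1, ..., v_k is output through its multiplicities, since k is not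
   bounded in terms of m: the cell 0 holds the address from which the
   multiplicities of V_0, ..., V_{n-1} are stored. *)
Definition output (n : nat) (s : state) : seq 'I_n :=
  flatten [seq nseq (nmem s (nmem s 0 + i)%N) i | i : 'I_n].

End Semantics.

(* Main.v *)
(* By a weighted pigeonhole argument over random signs, any a vectors of norm at most 2 have
   a partial colouring, with at least a / 10 nonzero entries, of discrepancy
   O(sqrt (a log (2m / a))) when a <= m; iterating it, or taking random signs when p is the
   smaller bound, colours k u vectors with discrepancy O(sqrt (k min(p, log (2m / k)))) times
   sqrt (u + sqrt u). Truncate the numbers k lam_i to l bits and remove the bits one by one,
   the last bit first: pair the indices whose bit is 1, and let a colouring of the differences
   V_I - V_J decide which member of a pair is rounded up. The sum of the coefficients is
   preserved up to one unpaired index per bit, whence k +- O(1) vectors at the end, and the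
   errors form a geometric series. The algorithm does the same with the Lovett-Meka sampler,
   applied repeatedly to the matrix of differences with normalised rows until every pair is
   coloured; its error bounds are relaxed so that the failure probabilities sum to at most
   1/2. With l = O(log m) bits and at most l draws per bit, the time is O(log^2 m) T(m, m+1).
   The last inequality needs omega >= 2: the entries of a product of matrices are n^2
   distinct values that a straight-line program has to compute one at a time. *)
Require Import Defs.
From mathcomp Require Import measurable_realfun.
From mathcomp Require Import zify ring lra.
Set Implicit Arguments.
Unset Strict Implicit.
Unset Printing Implicit Defensive.
Import Order.TTheory GRing.Theory Num.Theory.
Local Open Scope classical_set_scope.
Local Open Scope ring_scope.

(** * The norms on l_p^m *)

(** The bound on [ac] must not presuppose a sampler, so it rests on counting, and the algorithm gets
    its own analysis of a draw; the rounding scheme and [gain] are common to both. The minimum is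
    never estimated as such: it equals one of its two terms, and each term has its own colouring
    argument. One and the same run of the program serves every p; which term is smaller enters only
    the analysis. The order of the bits matters: level j has at most k 2^j pairs, and its outcome is
    scaled by 2^-(j+1). The discrepancy grows like the square root of the number of pairs while the
    weight falls like its inverse, hence the geometric decay. The obstacle for the algorithm is the
    term p: there the sampler controls the norm only through subgaussian moments, and for p near 2
    Markov's inequality leaves a failure probability of order t^-2. A constant threshold t would not
    survive a union bound over about log^2 m draws, so t grows geometrically, slowly enough for the
    errors still to decrease. *)

Section Lpnorm.
Variable R : realType.
Implicit Types (r c : R) (p : \bar R).

(* Young's inequality for the product of y and 1. *)
Lemma powR_bernoulli (y q : R) : 0 <= y -> 1 <= q -> 1 + q * (y - 1) <= y `^ q.
Proof.
move=> y0; rewrite le_eqVlt => /predU1P[<-|q1].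
  by rewrite mul1r powRr1// addrC subrK.
have q0 : 0 < q by rewrite (lt_trans _ q1).
have q'0 : 0 < q / (q - 1) by rewrite divr_gt0// subr_gt0.
have := @conjugate_powR R y 1 q (q / (q - 1)) y0 ler01 q0 q'0.
rewrite powR1 mulr1 => /(_ _)/wrap[].
  rewrite invf_div; field; rewrite ?gt_eqF//.
have -> : 1 / (q / (q - 1)) = (q - 1) / q.
  by field; rewrite gt_eqF//= subr_eq0 gt_eqF.
by rewrite -mulrDl ler_pdivlMr//; lra.
Qed.

(* Jensen's inequality through the tangent at the mean [mu]. *)
Lemma power_mean (I : finType) (y : I -> R) (q : R) : (forall i, 0 <= y i) ->
  1 <= q -> (\sum_i y i) `^ q <= #|I|%:R `^ (q - 1) * \sum_i y i `^ q.
Proof.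
move=> y0 q1; have q0 : 0 < q by rewrite (lt_le_trans _ q1).
have [s0|s0] := eqVneq (\sum_i y i) 0.
  rewrite s0 powR0 ?gt_eqF// mulr_ge0 ?powR_ge0// sumr_ge0// => i _.
  exact: powR_ge0.
have sp : 0 < \sum_i y i by rewrite lt_neqAle eq_sym s0 sumr_ge0.
have cardp : 0 < #|I|%:R :> R.
  rewrite ltr0n; apply/card_gt0P; apply: contrapT => nI; case/eqP: s0.
  by apply: big1 => i _; case: nI; exists i.
set mu := (\sum_i y i) / #|I|%:R.
have mup : 0 < mu by rewrite divr_gt0.
have H i : mu `^ q * (1 + q * (y i / mu - 1)) <= y i `^ q.
  have {2}-> : y i = mu * (y i / mu) by rewrite mulrC divfK ?gt_eqF.
  have ym0 : 0 <= y i / mu by rewrite divr_ge0// ltW.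
  by rewrite (powRM _ (ltW mup) ym0) ler_wpM2l ?powR_ge0// powR_bernoulli.
have : mu `^ q * #|I|%:R <= \sum_i y i `^ q.
  apply: (le_trans _ (ler_sum _ (fun i _ => H i))).
  rewrite -big_distrr /= big_split /= -big_distrr /= sumrB -mulr_suml.
  rewrite !sumr_const.
  have -> : (\sum_i y i) / mu = #|I|%:R.
    by rewrite /mu; field; rewrite s0 gt_eqF.
  by rewrite subrr mulr0 addr0.
move=> H2; have -> : \sum_i y i = #|I|%:R * mu by rewrite /mu mulrC divfK ?gt_eqF.
rewrite powRM ?(ltW cardp) ?(ltW mup)// -(mulr_powRB1 (ltW cardp) q0).
by rewrite [#|I|%:R * _]mulrC -mulrA ler_wpM2l ?powR_ge0// mulrC.
Qed.

Lemma lpnorm_ge0 m p (x : 'rV[R]_m) : 0 <= lpnorm p x.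
Proof.
case: p => [r||]//=; first exact: powR_ge0.
by elim/big_ind: _ => // u v u0 _; rewrite le_max u0.
Qed.

(** Removes the outer root: a bound on the norm becomes one on a sum of powers, or on each
    coordinate when p = +oo, and both forms can be treated in parallel. *)
Lemma lpnorm_leE m p (x : 'rV[R]_m) c : (2%:E <= p)%E -> 0 <= c ->
  lpnorm p x <= c <->
  match p with
  | r%:E => \sum_i `|x 0 i| `^ r <= c `^ r
  | _ => forall i, `|x 0 i| <= c
  end.
Proof.
case: p => [r|_ c0|]//=.
  rewrite lee_fin => r2 c0; have r0 : 0 < r by rewrite (lt_le_trans _ r2).
  have s0 : 0 <= \sum_i `|x 0 i| `^ r by apply: sumr_ge0 => i _; exact: powR_ge0.
  split => h.
    have /(ge0_ler_powR (ltW r0)) := h; rewrite !nnegrE powR_ge0 c0 => /(_ isT isT).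
    by rewrite -powRrM mulVf ?gt_eqF// powRr1.
  have /(@ge0_ler_powR _ r^-1) := h; rewrite !nnegrE invr_ge0 (ltW r0) s0 powR_ge0.
  by move=> /(_ isT isT isT); rewrite -powRrM mulfV ?gt_eqF// powRr1.
split=> [h i|h].
  by apply: le_trans h; rewrite (le_bigmax _ (fun i => `|x 0 i|)).
by apply/bigmax_leP; split.
Qed.

Lemma ler_lpnorm m p (x y : 'rV[R]_m) : (2%:E <= p)%E ->
  (forall i, `|x 0 i| <= `|y 0 i|) -> lpnorm p x <= lpnorm p y.
Proof.
move=> p2 h; apply/(lpnorm_leE _ p2 (lpnorm_ge0 _ _)).
have := proj1 (lpnorm_leE y p2 (lpnorm_ge0 p y)) (lexx _).
case: p p2 => [r||]//= r2 hy.
  rewrite lee_fin in r2; apply: le_trans hy; apply: ler_sum => i _.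
  by rewrite ge0_ler_powR ?nnegrE ?normr_ge0// (le_trans _ r2).
by move=> i; exact: le_trans (hy i).
Qed.

Lemma lpnormZ m p c (x : 'rV[R]_m) : (2%:E <= p)%E ->
  lpnorm p (c *: x) = `|c| * lpnorm p x.
Proof.
case: p => [r||]//=.
  rewrite lee_fin => r2; have r0 : 0 < r by rewrite (lt_le_trans _ r2).
  rewrite (eq_bigr (fun i => `|c| `^ r * `|x 0 i| `^ r)); last first.
    by move=> i _; rewrite mxE normrM powRM.
  rewrite -big_distrr /= powRM ?powR_ge0 ?sumr_ge0//.
  by rewrite -powRrM mulfV ?gt_eqF// powRr1.
move=> _; rewrite (eq_bigr (fun i => `|c| * `|x 0 i|)); last first.
  by move=> i _; rewrite mxE normrM.
by elim/big_ind2: _ => [|a b a' b' -> ->|//]; rewrite ?mulr0// maxr_pMr.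
Qed.

Lemma lpnorm0 m p : (2%:E <= p)%E -> lpnorm p (0 : 'rV[R]_m) = 0.
Proof. by move=> p2; rewrite -(scale0r 0) lpnormZ// normr0 mul0r. Qed.

Lemma lpnormN m p (x : 'rV[R]_m) : (2%:E <= p)%E -> lpnorm p (- x) = lpnorm p x.
Proof. by move=> p2; rewrite -scaleN1r lpnormZ// normrN1 mul1r. Qed.

(** The tangent at the mean [w] lies below the power function at [u] and at [v]; the linear terms
    cancel in the weighted sum. *)
Lemma powR_convex r (t u v : R) : 1 <= r -> 0 <= t <= 1 -> 0 <= u -> 0 <= v ->
  ((1 - t) * u + t * v) `^ r <= (1 - t) * u `^ r + t * v `^ r.
Proof.
move=> r1 /andP[t0 t1] u0 v0.
set w := (1 - t) * u + t * v.
have w0 : 0 <= w by rewrite addr_ge0// mulr_ge0// subr_ge0.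
have r0 : 0 < r by rewrite (lt_le_trans _ r1).
have [wE|wn] := eqVneq w 0.
  rewrite wE powR0 ?gt_eqF// addr_ge0// mulr_ge0 ?powR_ge0// subr_ge0//.
have wp : 0 < w by rewrite lt_neqAle eq_sym wn.
have H y : 0 <= y -> w `^ r * (1 + r * (y / w - 1)) <= y `^ r.
  move=> y0; have {2}-> : y = w * (y / w) by rewrite mulrC divfK.
  rewrite powRM ?divr_ge0//.
  by rewrite ler_wpM2l ?powR_ge0// powR_bernoulli// divr_ge0.
apply: (@le_trans _ _ ((1 - t) * (w `^ r * (1 + r * (u / w - 1))) +
                       t * (w `^ r * (1 + r * (v / w - 1))))).
  rewrite le_eqVlt; apply/orP; left; apply/eqP.
  have {1}-> : w `^ r = w `^ r * (1 + r * (w / w - 1)).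
    by rewrite divff// subrr mulr0 addr0 mulr1.
  by rewrite {2}/w; field.
by rewrite lerD// ler_wpM2l ?H// subr_ge0.
Qed.

(** Minkowski's inequality: (x + y) / (A + B) is a convex combination of x / A and y / B. Positive
    bounds [A], [B] in place of the norms keep the divisions meaningful. *)
Lemma lpnormD_le m p (x y : 'rV[R]_m) A B : (2%:E <= p)%E -> 0 < A -> 0 < B ->
  lpnorm p x <= A -> lpnorm p y <= B -> lpnorm p (x + y) <= A + B.
Proof.
move=> p2 Ap Bp; have ABp : 0 < A + B by rewrite addr_gt0.
have [A0 B0 AB0] := And3 (ltW Ap) (ltW Bp) (ltW ABp).
move=> /(lpnorm_leE _ p2 A0) hx /(lpnorm_leE _ p2 B0) hy.
apply/(lpnorm_leE _ p2 AB0).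
case: p p2 hx hy => [r||]//; last first.
  move=> _ hx hy i; rewrite mxE.
  by rewrite (le_trans (ler_normD _ _))// lerD.
rewrite lee_fin => r2 hx hy.
have r0 : 0 < r by rewrite (lt_le_trans _ r2).
have r1 : 1 <= r by rewrite (le_trans _ r2)// ler1n.
pose t := B / (A + B).
have t0 : 0 <= t by rewrite divr_ge0.
have tE : 1 - t = A / (A + B) by rewrite /t; field; rewrite gt_eqF.
have t1 : 0 <= 1 - t by rewrite tE divr_ge0.
have t01 : 0 <= t <= 1 by rewrite t0 -subr_ge0.
have Hi i : `|(x + y) 0 i| `^ r <= (A + B) `^ r *
    ((1 - t) * (`|x 0 i| `^ r / A `^ r) + t * (`|y 0 i| `^ r / B `^ r)).
  have E (z D : R) : 0 <= z -> 0 < D -> z `^ r / D `^ r = (z / D) `^ r.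
    move=> z0 D0; rewrite powRM ?invr_ge0 ?(ltW D0)//; congr (_ * _).
    by rewrite -powR_inv1 ?powR_ge0// -powRrM mulrN1 powRN -[in RHS]powR_inv1 ?(ltW D0)// -powRrM mulN1r powRN.
  have xA : 0 <= `|x 0 i| / A by rewrite divr_ge0.
  have yB : 0 <= `|y 0 i| / B by rewrite divr_ge0.
  rewrite !E//; apply: (le_trans _ (ler_wpM2l (powR_ge0 _ _) (powR_convex r1 t01 xA yB))).
  have s0 : 0 <= (1 - t) * (`|x 0 i| / A) + t * (`|y 0 i| / B).
    by rewrite addr_ge0// mulr_ge0.
  rewrite -(powRM _ AB0 s0) ge0_ler_powR ?nnegrE ?normr_ge0 ?(ltW r0) ?mulr_ge0//.
  rewrite mxE (le_trans (ler_normD _ _))// tE /t.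
  rewrite le_eqVlt; apply/orP; left; apply/eqP.
  by field; rewrite !gt_eqF.
apply: (le_trans (ler_sum _ (fun i _ => Hi i))).
rewrite -big_distrr /= ler_piMr ?powR_ge0//.
rewrite big_split/= -!big_distrr/= -!mulr_suml.
have t1t : (1 - t) + t = 1 by rewrite subrK.
by rewrite -[leRHS]t1t; apply: lerD; rewrite ler_piMr ?ler_pdivrMr ?powR_gt0// ?mul1r.
Qed.

Lemma ler_lpnormD m p (x y : 'rV[R]_m) : (2%:E <= p)%E ->
  lpnorm p (x + y) <= lpnorm p x + lpnorm p y.
Proof.
move=> p2; apply/ler_addgt0Pr => e e0.
have e2 : 0 < e / 2 by rewrite divr_gt0.
have -> : lpnorm p x + lpnorm p y + e = (lpnorm p x + e / 2) + (lpnorm p y + e / 2).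
  by rewrite [e in LHS]splitr; ring.
by apply: lpnormD_le => //; rewrite ?ltr_wpDl ?lpnorm_ge0// lerDl ltW.
Qed.

Lemma ler_lpnormB m p (x y : 'rV[R]_m) : (2%:E <= p)%E ->
  lpnorm p (x - y) <= lpnorm p x + lpnorm p y.
Proof. by move=> p2; rewrite -(lpnormN y)//; apply: ler_lpnormD. Qed.

Lemma ler_lpnorm_sum m p (I : Type) (s : seq I) (P : pred I) (F : I -> 'rV[R]_m) :
  (2%:E <= p)%E ->
  lpnorm p (\sum_(i <- s | P i) F i) <= \sum_(i <- s | P i) lpnorm p (F i).
Proof.
move=> p2; elim/big_ind2: _ => [|u a v b ha hb|//]; first by rewrite lpnorm0.
exact: le_trans (ler_lpnormD _ _ p2) (lerD ha hb).
Qed.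

Lemma norm2_ge0 n (x : 'rV[R]_n) : 0 <= norm2 x.
Proof. exact: sqrtr_ge0. Qed.

Lemma norm2_sqr n (x : 'rV[R]_n) : norm2 x ^+ 2 = \sum_j x 0 j ^+ 2.
Proof. by rewrite sqr_sqrtr// sumr_ge0// => i _; rewrite sqr_ge0. Qed.

Lemma norm2_eq0 n (x : 'rV[R]_n) : norm2 x = 0 -> x = 0.
Proof.
move=> h; have := norm2_sqr x; rewrite h expr0n/= => /esym/eqP.
rewrite psumr_eq0 => [/allP H|i _]; last exact: sqr_ge0.
apply/rowP => j; rewrite mxE; apply/eqP; rewrite -sqrf_eq0.
exact: H (mem_index_enum _).
Qed.

Lemma norm2Z n c (x : 'rV[R]_n) : norm2 (c *: x) = `|c| * norm2 x.
Proof.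
rewrite /norm2 (eq_bigr (fun j => c ^+ 2 * x 0 j ^+ 2)); last first.
  by move=> j _; rewrite mxE exprMn.
by rewrite -big_distrr/= sqrtrM ?sqr_ge0// sqrtr_sqr.
Qed.

(** This is where p >= 2 is essential: the exponent p / 2 is at least 1, so the power mean
    inequality applies to the squares in a row. It turns the bounds on the vectors (columns) into
    control of the Euclidean row norms, which govern the deviations of the coordinates. *)
Lemma lpnorm_row_norms m a p (W : 'M[R]_(m, a)) c : (2%:E <= p)%E -> 0 <= c ->
  (forall t, lpnorm p (col t W)^T <= c) ->
  lpnorm p (\row_i norm2 (row i W)) <= c * Num.sqrt a%:R.
Proof.
move=> p2 c0 hW; have b0 : 0 <= c * Num.sqrt a%:R by rewrite mulr_ge0 ?sqrtr_ge0.
apply/(lpnorm_leE _ p2 b0).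
have {}hW t := proj1 (lpnorm_leE (col t W)^T p2 c0) (hW t).
case: p p2 hW => [r||]//; last first.
  move=> _ hW i; rewrite mxE ger0_norm ?norm2_ge0//.
  rewrite -(ler_pXn2r (_ : 0 < 2)%N)// ?nnegrE ?norm2_ge0//.
  rewrite norm2_sqr exprMn sqr_sqrtr ?ler0n//.
  rewrite mulr_natr.
  rewrite -[X in _ *+ X](card_ord a) -sumr_const; apply: ler_sum => t _.
  rewrite -real_normK ?num_real// ler_pXn2r ?nnegrE// mxE.
  by have := hW t i; rewrite !mxE.
rewrite lee_fin => r2 hW; have r0 : 0 < r by rewrite (lt_le_trans _ r2).
have q1 : 1 <= r / 2 by rewrite ler_pdivlMr// mul1r.
have sqE (x : R) : (x ^+ 2) `^ (r / 2) = `|x| `^ r.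
  rewrite -real_normK ?num_real// -powR_mulrn// -powRrM.
  by congr (_ `^ _); field.
have Hi i : `|(\row_i norm2 (row i W)) 0 i| `^ r <=
    a%:R `^ (r / 2 - 1) * \sum_t `|W i t| `^ r.
  rewrite mxE -sqE norm2_sqr.
  rewrite -[X in X%:R `^ _](card_ord a).
  apply: le_trans (power_mean _ q1) _ => [t|]; first exact: sqr_ge0.
  rewrite ler_wpM2l ?powR_ge0//; apply: ler_sum => t _.
  by rewrite sqE mxE.
apply: (le_trans (ler_sum _ (fun i _ => Hi i))).
rewrite -big_distrr/= exchange_big/=.
apply: (@le_trans _ _ (a%:R `^ (r / 2 - 1) * (a%:R * c `^ r))).
  rewrite ler_wpM2l ?powR_ge0//.
  rewrite mulr_natl -[X in _ *+ X](card_ord a) -sumr_const; apply: ler_sum => t _.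
  by apply: le_trans (hW t); apply: ler_sum => i _; rewrite !mxE.
rewrite powRM ?sqrtr_ge0// -powR12_sqrt ?ler0n// -powRrM.
rewrite mulrA mulrC ler_wpM2l ?powR_ge0//.
have [->|a0] := eqVneq a 0%N; first by rewrite mulr0 powR_ge0.
rewrite -{2}(@powRr1 _ a%:R) ?ler0n// -powRD ?subrK; last first.
  by rewrite pnatr_eq0 a0 implybT.
by rewrite mulrC.
Qed.

End Lpnorm.

(** * Partial colouring *)

Section RandomSigns.
Variable R : realType.

Definition signs (a : nat) := {ffun 'I_a -> bool}.
Definition sgn (a : nat) (e : signs a) (t : 'I_a) : R := (-1) ^+ (e t).

Lemma expR_le_inv (x : R) : x < 1 -> expR x <= (1 - x)^-1.
Proof.
move=> x1; have := expR_ge1Dx (- x); rewrite expRN => h.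
by rewrite -[leLHS]invrK lef_pV2 ?posrE ?invr_gt0 ?expR_gt0 ?subr_gt0.
Qed.

(* [cosh (2 y) <= cosh y ^ 4] propagates the bound from small arguments. *)
Lemma expRDexpRN_le (x : R) : expR x + expR (- x) <= 2 * expR (2 * x ^+ 2).
Proof.
have [n] : exists n : nat, `|x| <= n%:R.
  by exists (Num.truncn `|x|).+1; rewrite ltW// truncnS_gt.
move=> xn; have {xn n} : exists n, `|x| <= 2 ^+ n * 2^-1.
  exists n.+1; apply: le_trans xn _; rewrite exprS mulrAC divff ?mul1r//.
  by rewrite -natrX ler_nat ltnW// ltn_expl.
case=> n; elim: n x => [|n IH] x.
  rewrite mul1r => x2.
  have /andP[xl xr] : - 2^-1 <= x <= 2^-1 by rewrite -ler_norml.
  have h1 := @expR_le_inv x _; have h2 := @expR_le_inv (- x) _.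
  have {}h1 := h1 (ltac:(lra)); have {}h2 := h2 (ltac:(lra)).
  have h3 := expR_ge1Dx (2 * x ^+ 2).
  have x2' : x ^+ 2 <= 4^-1 by nra.
  apply: le_trans (lerD h1 h2) _.
  have -> : (1 - x)^-1 + (1 - - x)^-1 = 2 / (1 - x ^+ 2).
    by field; rewrite !gt_eqF; nra.
  rewrite ler_wpM2l//; apply: le_trans h3.
  by rewrite -div1r ler_pdivrMr; nra.
move=> xn; pose y := x / 2.
have yn : `|y| <= 2 ^+ n * 2^-1.
  by rewrite normrM [`|2^-1|]ger0_norm// ler_pM2r//; move: xn; rewrite exprS mulrAC divff ?mul1r.
have {IH yn} := IH y yn.
have -> : x = y + y by rewrite /y -splitr.
have -> : - (y + y) = - y + - y by ring.
rewrite !expRD.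
have -> : 2 * (y + y) ^+ 2 = 2 * y ^+ 2 + 2 * y ^+ 2 + (2 * y ^+ 2 + 2 * y ^+ 2) by ring.
rewrite !expRD; set u := expR y; set v := expR (- y); set w := expR _ => h.
have uv : u * v = 1 by rewrite -expRD subrr expR0.
have u0 : 0 < u := expR_gt0 _; have v0 : 0 < v := expR_gt0 _.
have w0 : 0 < w := expR_gt0 _.
have h2 : (u + v) ^+ 2 <= 4 * w ^+ 2 by nra.
have h4 : (u + v) ^+ 4 <= 16 * w ^+ 4.
  by have := ler_pM (sqr_ge0 _) (sqr_ge0 _) h2 h2; nra.
have uv2 : u * u + v * v = (u + v) ^+ 2 - 2 by nra.
rewrite uv2; have -> : 2 * (w * w * (w * w)) = 16 * w ^+ 4 / 8 by field.
have h0 : 0 <= ((u + v) ^+ 2 - 4) ^+ 2 by exact: sqr_ge0.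
have E4 : ((u + v) ^+ 2 - 4) ^+ 2 = (u + v) ^+ 4 - 8 * (u + v) ^+ 2 + 16 by ring.
by rewrite E4 in h0; move: h0 h4; set s4 := _ ^+ 4; set s2 := (u + v) ^+ 2; lra.
Qed.

Lemma sum_signs_prod (a : nat) (F : 'I_a -> bool -> R) :
  \sum_(e : signs a) \prod_t F t (e t) = \prod_t (F t true + F t false).
Proof.
rewrite (eq_bigr (fun t => \sum_(b : bool) F t b)); last first.
  by move=> t _; rewrite big_bool.
by rewrite bigA_distr_bigA.
Qed.

Lemma card_signs (a : nat) : #|{: signs a}| = (2 ^ a)%N.
Proof. by rewrite card_ffun card_bool card_ord. Qed.

Lemma signs_mgf (a : nat) (w : 'I_a -> R) (lam : R) :
  \sum_(e : signs a) expR (lam * \sum_t w t * sgn e t)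
    <= 2 ^+ a * expR (2 * lam ^+ 2 * \sum_t w t ^+ 2).
Proof.
rewrite (eq_bigr (fun e : signs a => \prod_t expR (lam * (w t * (-1) ^+ (e t))))); last first.
  by move=> e _; rewrite big_distrr /= expR_sum.
rewrite (sum_signs_prod (fun t (b : bool) => expR (lam * (w t * (-1) ^+ b)))).
rewrite big_distrr/= expR_sum.
have -> : 2 ^+ a = \prod_(t < a) (2 : R) by rewrite prodr_const card_ord.
rewrite -big_split/=; apply: ler_prod => t _; rewrite addr_ge0 ?expR_ge0//=.
rewrite expr0 expr1 mulr1 mulrN1 mulrN addrC.
apply: le_trans (expRDexpRN_le _) _.
by rewrite ler_pM2l// ler_expR exprMn mulrA.
Qed.

Lemma signs_mgf_abs (a : nat) (w : 'I_a -> R) (lam : R) : 0 <= lam ->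
  \sum_(e : signs a) expR (lam * `|\sum_t w t * sgn e t|)
    <= 2 * 2 ^+ a * expR (2 * lam ^+ 2 * \sum_t w t ^+ 2).
Proof.
move=> l0.
apply: (@le_trans _ _ (\sum_(e : signs a) (expR (lam * \sum_t w t * sgn e t) +
   expR ((- lam) * \sum_t w t * sgn e t)))).
  apply: ler_sum => e _; set y := \sum_t _.
  have [y0|/ltW y0] := leP 0 y; first by rewrite ger0_norm// lerDl expR_ge0.
  by rewrite ler0_norm// mulNr mulrN lerDr expR_ge0.
rewrite big_split/= -mulrA mulr_natl mulr2n; apply: lerD; first exact: signs_mgf.
by have := signs_mgf w (- lam); rewrite sqrrN.
Qed.

(** Again through the tangent at the mean [mu]. *)
Lemma jensen_expR (I : finType) (f : I -> R) : (0 < #|I|)%N ->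
  #|I|%:R * expR ((\sum_i f i) / #|I|%:R) <= \sum_i expR (f i).
Proof.
move=> I0; have I1 : 0 < #|I|%:R :> R by rewrite ltr0n.
set mu := (\sum_i f i) / _.
have h i : expR mu * (1 + (f i - mu)) <= expR (f i).
  rewrite -{2}(subrKC mu (f i)) expRD ler_pM2l ?expR_gt0//.
  exact: expR_ge1Dx.
apply: (le_trans _ (ler_sum _ (fun i _ => h i))).
rewrite -big_distrr/= mulrC ler_pM2l ?expR_gt0//.
rewrite big_split/= sumrB !sumr_const.
have -> : mu *+ #|I| = \sum_i f i by rewrite -[LHS]mulr_natr divfK ?gt_eqF.
by rewrite subrr addr0.
Qed.

Definition hdist (a : nat) (e e' : signs a) : nat := #|[pred t | e t != e' t]|.

(** Exponential moment bound: exp(a / 10 - dist) is at least 1 on the ball, and its sum over the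
    cube factorises into (1 + exp(-1))^a exp(a / 10). *)
Lemma card_hamming_ball (a : nat) (e0 : signs a) :
  #|[pred e | (10 * hdist e e0 < a)%N]|%:R <= (3 / 2 * expR 10^-1) ^+ a :> R.
Proof.
have E : \sum_(e : signs a) expR (- (hdist e e0)%:R) = (1 + expR (-1)) ^+ a :> R.
  rewrite (eq_bigr (fun e : signs a => \prod_t expR (- (e t != e0 t)%:R))); last first.
    move=> e _; rewrite -expR_sum sumrN; congr (expR (- _)).
    by rewrite -natr_sum /hdist -sum1_card big_mkcond.
  rewrite (sum_signs_prod (fun t (b : bool) => expR (- (b != e0 t)%:R))).
  rewrite -[X in _ ^+ X](card_ord a) -prodr_const; apply: eq_bigr => t _.
  by case: (e0 t); rewrite /= ?oppr0 ?expR0 // addrC.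
have e1 : expR (-1) <= 2^-1 :> R.
  by have := @expR_le_inv 1; rewrite expRN lef_pV2 ?posrE ?expR_gt0// => _; have := expR_ge1Dx (1 : R); lra.
apply: (@le_trans _ _ (\sum_(e : signs a) expR (a%:R / 10 - (hdist e e0)%:R))).
  rewrite -sum1_card natr_sum [leRHS](bigID [pred e | (10 * hdist e e0 < a)%N])/=.
  rewrite -[leLHS]addr0; apply: lerD; last by apply: sumr_ge0 => *; exact: expR_ge0.
  apply: ler_sum => e; rewrite inE => h.
  apply: le_trans (expR_ge1Dx _); rewrite lerDl subr_ge0 ler_pdivlMr//.
  by have : (10 * hdist e e0)%:R <= a%:R :> R; [rewrite ler_nat ltnW | rewrite natrM; lra].
under eq_bigr do rewrite expRD.
rewrite -big_distrr/= E mulrC exprMn -[in leRHS]expRM_natl.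
apply: ler_pM; rewrite ?expR_ge0 ?exprn_ge0 ?addr_ge0 ?expR_ge0//.
by apply: lerXn2r; rewrite ?nnegrE ?addr_ge0 ?expR_ge0//; lra.
Qed.

End RandomSigns.

Section PartialColouring.
Variable R : realType.

Section Buckets.
Variables (m a : nat) (W : 'M[R]_(m, a)) (T : R).
Hypotheses (a0 : (0 < a)%N) (T1 : 1 <= T).
Hypothesis rowW : forall i, \sum_t W i t ^+ 2 <= 1.
Hypothesis mT : 32 * (m%:R * expR (- (T / 2))) <= a%:R.

Let D : R := Num.sqrt (8 * T).
Let Y (e : signs a) i : R := \sum_t W i t * sgn R e t.
Let mag (e : signs a) i : nat := Num.truncn (`|Y e i| / (2 * D) + 2^-1).
Let N : nat := \max_(x : signs a * 'I_m) mag x.1 x.2.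

(* [Y e i] rounded to the nearest multiple of [2 * D], as sign and modulus; [N] only
   bounds the moduli, to make the set of buckets finite. *)
Let bucket (e : signs a) : {ffun 'I_m -> bool * 'I_N.+1} :=
  [ffun i => ((Y e i < 0) && (0 < mag e i)%N, inord (mag e i))].

Let D2 : D ^+ 2 = 8 * T.
Proof. by rewrite sqr_sqrtr// mulr_ge0// (le_trans _ T1). Qed.

Let D0 : 0 < D.
Proof. by rewrite sqrtr_gt0 mulr_gt0// (lt_le_trans _ T1). Qed.

Let magN e i : (mag e i < N.+1)%N.
Proof. by rewrite ltnS; exact: (leq_bigmax (e, i)). Qed.

Let mag_bounds e i : (mag e i)%:R <= `|Y e i| / (2 * D) + 2^-1 < (mag e i).+1%:R.
Proof. by rewrite truncn_itv// addr_ge0// divr_ge0// mulr_ge0// ltW. Qed.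

(** [mag] vanishes unless |Y| >= D, and for u = |Y| / D >= 1 it is at most u <= exp(u - 1) <= exp(2
    T (u - 1)). The choice D^2 = 8 T makes the moment generating function at D / 4 contribute only
    exp(T), which leaves the average exp(-T) of [sum_mag_le]. *)
Let mag_le e i : (mag e i)%:R <= expR (D / 4 * `|Y e i| - 2 * T).
Proof.
have /andP[h _] := mag_bounds e i.
have [->|n0] := posnP (mag e i); first exact: expR_ge0.
have n1 : 1 <= (mag e i)%:R :> R by rewrite ler1n.
have e1 : 2 * T = D / 4 * D by have := D2; nra.
set u := `|Y e i| / D.
have yE : `|Y e i| = u * D by rewrite /u divfK ?gt_eqF.
have hu : `|Y e i| / (2 * D) = u / 2 by rewrite /u; field; rewrite gt_eqF.
have u1 : 1 <= u by lra.
have -> : D / 4 * `|Y e i| - 2 * T = 2 * T * (u - 1) by rewrite e1 yE; ring.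
apply: (@le_trans _ _ u); first by lra.
apply: (@le_trans _ _ (expR (u - 1))).
  by apply: le_trans (expR_ge1Dx _); rewrite addrC subrK.
by rewrite ler_expR ler_peMl ?subr_ge0//; have := T1; lra.
Qed.

Let sum_mag_le i : \sum_(e : signs a) (mag e i)%:R <= 2 ^+ a * (2 * expR (- T)) :> R.
Proof.
apply: (le_trans (ler_sum _ (fun e _ => mag_le e i))).
under eq_bigr do rewrite expRD.
rewrite -mulr_suml; apply: (@le_trans _ _ ((2 * 2 ^+ a * expR (2 * (D / 4) ^+ 2 * \sum_t W i t ^+ 2)) * expR (- (2 * T)))).
  rewrite ler_wpM2r ?expR_ge0//.
  by have := @signs_mgf_abs R a (W i) (D / 4) (ltW (divr_gt0 D0 (ltr0n _ 4))).
rewrite -!mulrA [leRHS]mulrCA ler_pM2l//  ler_pM2l ?exprn_gt0//.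
rewrite -expRD ler_expR; have := rowW i; set s := \sum_t _ => s1.
have -> : 2 * (D * (4^-1 * (D * (4^-1 * s)))) = D ^+ 2 * s / 8 by field.
by rewrite D2; have := T1; nra.
Qed.

(* Weighted pigeonhole: the weights of all buckets multiply to at most
   [expR (4 * expR (- T)) ^ m], while by Jensen's inequality the average weight of the
   bucket of a random sign vector is not much smaller than 1. Hence some bucket holds more
   sign vectors than a Hamming ball of radius a / 10, that is, two distant ones. The code
   (true, 0) is never used and gets weight 0. *)
Let weight (x : bool * 'I_N.+1) : R :=
  if x.1 && (x.2 == 0 :> nat) then 0 else expR (- T) ^+ x.2.

Let weight_ge0 x : 0 <= weight x.
Proof. by rewrite /weight; case: ifP => // _; rewrite exprn_ge0// expR_ge0. Qed.

Let expT_half : expR (- T) <= 2^-1.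
Proof.
rewrite expRN lef_pV2 ?posrE ?expR_gt0//.
by have := expR_ge1Dx T; have := T1; lra.
Qed.

Let geo_half (x : R) n : 0 <= x <= 2^-1 -> \sum_(i < n) x ^+ i <= 2.
Proof.
move=> /andP[x0 x2].
have : (1 - x) * \sum_(i < n) x ^+ i <= 1.
  by rewrite -[1 - x]opprB mulNr -subrX1 opprB lerBlDr lerDl exprn_ge0.
have : 0 <= \sum_(i < n) x ^+ i by apply: sumr_ge0 => i _; exact: exprn_ge0.
nra.
Qed.

Let sum_weight_le : \sum_x weight x <= expR (4 * expR (- T)).
Proof.
apply: le_trans (expR_ge1Dx _).
rewrite (eq_bigr (fun x => weight (x.1, x.2))); last by case.
rewrite -(pair_bigA _ (fun b n => weight (b, n)))/= big_bool/=.
rewrite !big_ord_recl /weight/= expr0 add0r.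
set S2 := \sum_(i < N) _.
have : S2 <= expR (- T) * 2.
  rewrite /S2 (eq_bigr (fun i : 'I_N => expR (- T) * expR (- T) ^+ i)); last first.
    by move=> i _; rewrite /bump/= add1n exprS.
  by rewrite -big_distrr/= ler_wpM2l ?expR_ge0// geo_half// expR_ge0.
lra.
Qed.

Let weight_bucket e : \prod_i weight (bucket e i) = expR (- T * \sum_i (mag e i)%:R).
Proof.
rewrite big_distrr/= expR_sum; apply: eq_bigr => i _.
rewrite /bucket ffunE /weight/= inordK ?magN//.
case: ifP => [/andP[/andP[_ h] /eqP]|_]; last by rewrite mulrC expRM_natl.
by move=> h0; rewrite h0 in h.
Qed.

Let avg_le : 2 ^+ a * expR (- (2 * T * (m%:R * expR (- T)))) <=
  \sum_(e : signs a) \prod_i weight (bucket e i).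
Proof.
under eq_bigr do rewrite weight_bucket.
have c0 : (0 < #|{: signs a}|)%N by rewrite card_signs expn_gt0.
apply: le_trans (jensen_expR _ c0).
rewrite card_signs natrX ler_pM2l ?exprn_gt0// ler_expR ler_pdivlMr ?exprn_gt0//.
rewrite -big_distrr/= exchange_big/= !mulNr lerN2.
apply: (@le_trans _ _ (T * \sum_(i < m) 2 ^+ a * (2 * expR (- T)))).
  rewrite ler_wpM2l ?(le_trans _ T1)//; apply: ler_sum => i _; exact: sum_mag_le.
rewrite sumr_const card_ord -mulr_natr le_eqVlt; apply/orP; left; apply/eqP.
ring.
Qed.

Let bucket_dist e e' i : bucket e = bucket e' -> `|Y e i - Y e' i| <= 2 * D.
Proof.
move=> /ffunP/(_ i); rewrite !ffunE => -[sE /(congr1 val)].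
rewrite /= !inordK ?magN// => nE.
have /andP[h1 h2] := mag_bounds e i; have /andP[h1' h2'] := mag_bounds e' i.
move: h1' h2' sE; rewrite -nE.
set k := mag e i in h1 h2 *.
set u := `|Y e i| / (2 * D) in h1 h2 *; set u' := `|Y e' i| / (2 * D).
have uE : `|Y e i| = u * (2 * D) by rewrite /u divfK// gt_eqF// mulr_gt0.
have uE' : `|Y e' i| = u' * (2 * D) by rewrite /u' divfK// gt_eqF// mulr_gt0.
move=> h1' h2'; rewrite -[k.+1%:R]natr1 in h2 h2'.
have DD := D0.
(* Modulus 0 carries no sign: the two values may lie on opposite sides of 0, but each is at most [D]
   in absolute value. *)
have [k0|k0] := posnP k; first rewrite k0 in h1 h2 h1' h2'.
  move=> _; apply: le_trans (ler_normB _ _) _; rewrite uE uE'.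
  have q1 : u * D <= 2^-1 * D by rewrite ler_pM2r//; lra.
  have q2 : u' * D <= 2^-1 * D by rewrite ler_pM2r//; lra.
  lra.
rewrite !andbT => sE.
have [y0|y0] := ltP (Y e i) 0; have := sE.
  rewrite y0 => /esym y0'; move: uE uE'; rewrite (ltr0_norm y0) (ltr0_norm y0') => uE uE'.
  rewrite ler_norml; apply/andP; split; nra.
rewrite {1}ltNge y0/= => /esym/negbT; rewrite -leNgt => y0'.
move: uE uE'; rewrite (ger0_norm y0) (ger0_norm y0') => uE uE'.
rewrite ler_norml; apply/andP; split; nra.
Qed.

Lemma bucket_pair : exists e e' : signs a,
  (a <= 10 * hdist e e')%N /\ forall i, `|\sum_t W i t * (sgn R e t - sgn R e' t)| <= 2 * D.
Proof.
apply: contrapT => no.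
have small b : #|[pred e | bucket e == b]|%:R <= (3 / 2 * expR 10^-1) ^+ a :> R.
  have [e0 be0|none] := pickP [pred e | bucket e == b]; last first.
    by rewrite (eq_card0 none) exprn_ge0// mulr_ge0// expR_ge0.
  apply: le_trans (card_hamming_ball R e0); rewrite ler_nat.
  apply/subset_leq_card/fintype.subsetP => e; rewrite !inE => /eqP be.
  rewrite ltnNge; apply/negP => far; apply: no; exists e, e0; split=> // i.
  have := @bucket_dist e e0 i; rewrite be (eqP be0) => /(_ erefl).
  rewrite /Y -sumrB; congr (`|_| <= _); apply: eq_bigr => t _.
  by rewrite mulrBr.
have := avg_le; apply/negP; rewrite -ltNge.
rewrite (partition_big bucket predT)//=.
apply: (@le_lt_trans _ _ (\sum_(b : {ffun 'I_m -> bool * 'I_N.+1})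
   (3 / 2 * expR 10^-1) ^+ a * \prod_i weight (b i) : R)).
  apply: ler_sum => b _.
  have -> : \sum_(e | bucket e == b) \prod_i weight (bucket e i) =
      \sum_(e | bucket e == b) \prod_i weight (b i).
    by apply: eq_bigr => e /eqP <-.
  have w0 : 0 <= \prod_i weight (b i) by apply: prodr_ge0.
  by apply: (le_trans _ (ler_wpM2r w0 (small b))); rewrite mulr_natl -sumr_const.
rewrite -big_distrr/= -(bigA_distr_bigA (fun _ : 'I_m => weight))/= prodr_const card_ord.
apply: (@le_lt_trans _ _ ((3 / 2 * expR 10^-1) ^+ a * expR (4 * expR (- T)) ^+ m)).
  rewrite ler_wpM2l ?exprn_ge0 ?mulr_ge0 ?expR_ge0//.
  by apply: lerXn2r; rewrite ?nnegrE ?expR_ge0// sumr_ge0.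
rewrite -expRM_natl -ltr_pdivlMr ?expR_gt0// -[ltRHS]mulrA -(expRN (m%:R * _)) -expRD.
(* One of the two factors exp(-T / 2) absorbs 2 T + 4 = 4 (1 + T / 2); by [mT] the other one leaves
   4 a / 32. *)
have expo : a%:R * - 8^-1 <= - (2 * T * (m%:R * expR (- T))) + - (m%:R * (4 * expR (- T))).
  have -> : - T = - (T / 2) + - (T / 2) by rewrite -opprD -splitr.
  rewrite expRD; have h := expR_ge1Dx (T / 2).
  have h2 := expR_gt0 (- (T / 2)).
  have h3 : expR (T / 2) * expR (- (T / 2)) = 1 by rewrite -expRD subrr expR0.
  have := mT; set x := expR (- (T / 2)) in h2 h3 * => mT'.
  have h4 : (1 + T / 2) * x <= 1 by rewrite -[leRHS]h3 ler_pM2r.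
  have mm : 0 <= m%:R :> R by [].
  have : m%:R * x * ((1 + T / 2) * x) <= m%:R * x by rewrite ler_piMr// mulr_ge0// ltW.
  nra.
apply: (@lt_le_trans _ _ (2 ^+ a * expR (a%:R * - 8^-1))); last first.
  by rewrite ler_pM2l ?exprn_gt0// ler_expR.
have an0 : a != 0 by rewrite -lt0n.
rewrite expRM_natl -exprMn ltrXn2r ?mulr_ge0 ?expR_ge0//.
(* The numerical core: 3/2 exp(1/10) < 2 exp(-1/8), that is exp(9/40) < 4/3. It ties the radius a /
   10 to the constant 32 in [mT]. *)
have h : expR 10^-1 * expR 8^-1 <= 4 / 3 - 100^-1 :> R.
  rewrite -expRD; apply: le_trans (expR_le_inv _) _; first by lra.
  by rewrite -div1r ler_pdivrMr; lra.
have h2 := expR_gt0 (8^-1 : R).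
have h3 : expR 8^-1 * expR (- 8^-1) = 1 :> R by rewrite -expRD subrr expR0.
rewrite -(ltr_pM2r h2) -!mulrA [_ * expR 8^-1 in ltRHS]mulrC h3; lra.
Qed.

End Buckets.

End PartialColouring.

(** * Full colouring *)

Section Colouring.
Variable R : realType.

Lemma ln2_ge : 2^-1 <= ln 2 :> R.
Proof.
have h := @expR_le_inv R 2^-1 (ltac:(lra)).
rewrite -ler_expR lnK ?posrE//; apply: le_trans h _.
by rewrite -div1r ler_pdivrMr; lra.
Qed.

Section Rate.
Variables (m k : nat).
Hypotheses (m0 : (0 < m)%N) (k0 : (0 < k)%N).

Lemma log2mk_ge : 2^-1 <= log2mk R m k.
Proof.
have mk0 : (0 < minn k m)%N by rewrite leq_min k0.
apply: le_trans ln2_ge _; rewrite /log2mk ler_ln ?posrE ?divr_gt0 ?mulr_gt0 ?ltr0n//.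
by rewrite ler_pdivlMr ?ltr0n// ler_pM2l// ler_nat geq_minr.
Qed.

(* Up to constants, a vectors of norm at most 2 can be coloured with squared discrepancy
   k * min(p, log(2m/k)) * gain (a / k): the square root pays for log(2m/a) exceeding
   log(2m/k) when a < k. *)
Definition gain (u : R) : R := u + Num.sqrt u.

Lemma gain_ge0 u : 0 <= u -> 0 <= gain u.
Proof. by move=> u0; rewrite addr_ge0// sqrtr_ge0. Qed.

Lemma ln_le_sqrt (y : R) : 0 < y -> ln y <= 2 * Num.sqrt y.
Proof.
move=> y0; have s0 : 0 < Num.sqrt y by rewrite sqrtr_gt0.
rewrite -{1}(sqr_sqrtr (ltW y0)) lnXn// -[_ *+ 2]mulr_natl ler_pM2l//.
by rewrite ltW// ln_sublinear.
Qed.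

(** There is a loss only if a < min(k, m); it is at most log(k / a), which is bounded by a square
    root. The maximum on the left covers more vectors than coordinates. *)
Lemma log_ratio_le (a : nat) : (0 < a)%N ->
  ln (2 * (maxn m a)%:R / a%:R) <= log2mk R m k + 2 * Num.sqrt (k%:R / a%:R).
Proof.
move=> a0; have mk0 : (0 < minn k m)%N by rewrite leq_min k0.
have [A0 K0 M0] : [/\ 0 < a%:R :> R, 0 < k%:R :> R & 0 < m%:R :> R].
  by rewrite !ltr0n.
have MK0 : 0 < (minn k m)%:R :> R by rewrite ltr0n.
have P0 : 0 < 2 * (maxn m a)%:R / a%:R :> R.
  by rewrite divr_gt0 ?mulr_gt0// ltr0n leq_max m0.
have S0 : 0 <= 2 * Num.sqrt (k%:R / a%:R) :> R by rewrite mulr_ge0 ?sqrtr_ge0.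
have [h|h] := leqP (minn k m) a.
  apply: (@le_trans _ _ (log2mk R m k)); last by rewrite lerDl.
  rewrite /log2mk ler_ln ?posrE ?divr_gt0 ?mulr_gt0 ?ltr0n// ?leq_max ?m0//.
  rewrite -!mulrA ler_pM2l//.
  have [am|am] := leqP a m.
    by rewrite ler_pM2l// lef_pV2 ?posrE// ler_nat.
  rewrite divff ?gt_eqF// ler_pdivlMr// mul1r ler_nat.
  exact: geq_minr.
have am : (a < m)%N by rewrite (leq_trans h)// geq_minr.
have ak : (a < k)%N by rewrite (leq_trans h)// geq_minl.
apply: (@le_trans _ _ (ln ((2 * m%:R / (minn k m)%:R) * (k%:R / a%:R)))).
  rewrite ler_ln ?posrE ?divr_gt0 ?mulr_gt0 ?invr_gt0 ?ltr0n// ?leq_max ?m0//.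
  rewrite (maxn_idPl (ltnW am)) -!mulrA ler_pM2l// ler_pM2l// mulrA.
  rewrite ler_pMl ?invr_gt0// mulrC ler_pdivlMr// mul1r ler_nat; exact: geq_minl.
rewrite lnM ?posrE ?divr_gt0 ?mulr_gt0// lerD2l.
by apply: ln_le_sqrt; rewrite divr_gt0.
Qed.

Lemma mul_log_ratio_le (a : nat) : (0 < a)%N ->
  a%:R * ln (2 * (maxn m a)%:R / a%:R) <=
    4 * (k%:R * log2mk R m k * gain (a%:R / k%:R)).
Proof.
move=> a0; have [A0 K0] : 0 < a%:R :> R /\ 0 < k%:R :> R by rewrite !ltr0n.
have := ler_wpM2l (ltW A0) (log_ratio_le a0); move/le_trans; apply.
have L2 := log2mk_ge; set L := log2mk R m k in L2 *.
set u := a%:R / k%:R; have u0 : 0 < u by rewrite divr_gt0.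
have aE : a%:R = k%:R * u by rewrite /u mulrC divfK ?gt_eqF.
have kaE : k%:R / a%:R = u^-1 by rewrite /u invf_div.
clearbody u; rewrite kaE aE -!mulrA [leRHS]mulrCA ler_pM2l// /gain.
have us : u * Num.sqrt u^-1 = Num.sqrt u.
  rewrite sqrtrV ?(ltW u0)// -{1}(sqr_sqrtr (ltW u0)) expr2 mulfK//.
  by rewrite gt_eqF// sqrtr_gt0.
have -> : u * (L + 2 * Num.sqrt u^-1) = u * L + 2 * (u * Num.sqrt u^-1) by ring.
rewrite us; have s0 : 0 <= Num.sqrt u by exact: sqrtr_ge0.
nra.
Qed.

Definition minpl (p : \bar R) : R := fine (Order.min p (log2mk R m k)%:E).

(** Reduces every bound with the minimum to a bound with one of its terms; p = +oo always falls
    under the logarithm. *)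
Lemma minpl_cases (p : \bar R) : (2%:E <= p)%E ->
  (exists r, p = r%:E /\ minpl p = r) \/ minpl p = log2mk R m k.
Proof.
move=> p2; rewrite /minpl; have [h|h] := leP p (log2mk R m k)%:E; last by right.
by case: p p2 h => // r _ _; left; exists r.
Qed.

Lemma minpl_ge (p : \bar R) : (2%:E <= p)%E -> 2^-1 <= minpl p.
Proof.
move=> p2; have [[r [pE ->]]|->] := minpl_cases p2; last exact: log2mk_ge.
by move: p2; rewrite pE lee_fin; lra.
Qed.

End Rate.

Lemma partial_colouring (m a : nat) (W : 'M[R]_(m, a)) p :
  (0 < a)%N -> (2%:E <= p)%E -> (forall t, lpnorm p (col t W)^T <= 2) ->
  exists chi : 'I_a -> R,
    [/\ forall t, [\/ chi t = 0, chi t = 1 | chi t = -1],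
        (a <= 10 * #|[pred t | chi t != 0%R]|)%N &
        lpnorm p (\row_i \sum_t W i t * chi t) <=
          Num.sqrt (320 * (a%:R * ln (2 * (maxn m a)%:R / a%:R)))].
Proof.
move=> a0 p2 colW; have A0 : 0 < a%:R :> R by rewrite ltr0n.
(* [T] is chosen so that exp(-T / 2) = a / (32 max(m, a)), which is what [mT] asks for; the maximum
   guarantees T >= 1. *)
pose M' := maxn m a; pose T : R := 2 * ln (32 * M'%:R / a%:R).
have aM : a%:R <= M'%:R :> R by rewrite ler_nat leq_maxr.
have mM : m%:R <= M'%:R :> R by rewrite ler_nat leq_maxl.
have M0 : 0 < M'%:R :> R := lt_le_trans A0 aM.
have l2 := ln2_ge; have l20 : 0 <= ln 2 :> R by lra.
have r0 : 0 < 2 * M'%:R / a%:R :> R by rewrite divr_gt0 ?mulr_gt0.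
have lr : ln 2 <= ln (2 * M'%:R / a%:R) :> R.
  by rewrite ler_ln ?posrE// ler_pdivlMr// ler_pM2l.
have lE : ln (32 * M'%:R / a%:R) = 4 * ln 2 + ln (2 * M'%:R / a%:R) :> R.
  rewrite [4 * ln 2]mulr_natl -lnXn// -lnM ?posrE ?exprn_gt0//.
  by congr ln; field; rewrite gt_eqF.
have T0 : 0 <= ln (32 * M'%:R / a%:R) :> R by rewrite lE; lra.
have T1 : 1 <= T by rewrite /T lE; lra.
pose N i := norm2 (row i W).
(* Normalising the rows gives them a common bucket width. A zero row stays zero, since division by 0
   yields 0. *)
pose W' : 'M[R]_(m, a) := \matrix_(i, t) (W i t / N i).
have rowW' i : \sum_t W' i t ^+ 2 <= 1.
  rewrite (eq_bigr (fun t => W i t ^+ 2 / N i ^+ 2)) => [|t _]; last first.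
    by rewrite mxE expr_div_n.
  have -> : N i ^+ 2 = \sum_t W i t ^+ 2.
    by rewrite norm2_sqr; apply: eq_bigr => t _; rewrite mxE.
  rewrite -mulr_suml.
  set s := \sum_t _; have [->|s0] := eqVneq s 0; first by rewrite mul0r.
  by rewrite divff.
have mT : 32 * (m%:R * expR (- (T / 2))) <= a%:R.
  have -> : T / 2 = ln (32 * M'%:R / a%:R) by rewrite /T mulrAC divff ?mul1r.
  rewrite expRN lnK ?posrE ?divr_gt0 ?mulr_gt0//.
  have -> : 32 * (m%:R * (32 * M'%:R / a%:R)^-1) = m%:R * (a%:R / M'%:R) :> R.
    by field; rewrite !gt_eqF.
  rewrite mulrA ler_pdivrMr// mulrC ler_pM2l//.
have [e [e' [dist disc]]] := bucket_pair a0 T1 rowW' mT.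
exists (fun t => (sgn R e t - sgn R e' t) / 2); split.
- move=> t; rewrite /sgn; case: (e t); case: (e' t); rewrite ?expr0 ?expr1.
  + by constructor 1; rewrite subrr mul0r.
  + by constructor 3; field.
  + by constructor 2; field.
  + by constructor 1; rewrite subrr mul0r.
- apply: leq_trans dist _; rewrite leq_mul2l/=; apply: subset_leq_card.
  apply/fintype.subsetP => t; rewrite !inE /sgn.
  by case: (e t); case: (e' t) => //= _; rewrite ?expr0 ?expr1; apply/eqP; lra.
set D : R := Num.sqrt (8 * T) in disc.
have D0 : 0 <= D by exact: sqrtr_ge0.
apply: (@le_trans _ _ (D * (2 * Num.sqrt a%:R))).
  apply: (le_trans _ (ler_wpM2l D0 (lpnorm_row_norms p2 (ler0n _ 2) colW))).
  rewrite -(ger0_norm D0) -lpnormZ//; apply: ler_lpnorm => // i.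
  rewrite !mxE -/(N i).
  have N0 : 0 <= N i by exact: norm2_ge0.
  rewrite [leRHS]ger0_norm ?mulr_ge0//.
  have -> : \sum_t W i t * ((sgn R e t - sgn R e' t) / 2) =
      N i * (\sum_t W' i t * (sgn R e t - sgn R e' t)) / 2.
    rewrite big_distrr/= mulr_suml; apply: eq_bigr => t _; rewrite mxE.
    have [N00|Nn] := eqVneq (N i) 0; last by field.
    have : W i t = row i W 0 t by rewrite mxE.
    by rewrite (norm2_eq0 N00) mxE => ->; rewrite !mul0r mulr0 mul0r.
  rewrite !normrM [`|N i|]ger0_norm// [`|2^-1|]ger0_norm//.
  have := disc i; set z := `|_| => hz.
  rewrite ler_pdivrMr//; nra.
rewrite -(ler_pXn2r (_ : 0 < 2)%N)// ?nnegrE ?sqrtr_ge0 ?mulr_ge0 ?sqrtr_ge0//.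
rewrite !exprMn !sqr_sqrtr ?mulr_ge0 ?(ltW A0) ?(le_trans _ lr)// ?(le_trans _ T1)//.
(* D^2 times 4 a is 64 a (4 ln 2 + x), and ln 2 <= x gives 320 a x. *)
rewrite /T lE -/M'.
set x := ln (2 * _ / _) in lr *; nra.
Qed.

Section FullColouring.
Variables (m k : nat) (p : \bar R).
Hypotheses (m0 : (0 < m)%N) (k0 : (0 < k)%N) (p2 : (2%:E <= p)%E).
Variables (I : finType) (w : I -> 'rV[R]_m).
Hypothesis w2 : forall t, lpnorm p (w t) <= 2.

Lemma ler_gain_scale (u v q : R) : 0 <= u -> u <= q ^+ 2 * v -> 0 <= q <= 1 -> 0 <= v ->
  gain u <= q * gain v.
Proof.
move=> u0 uv /andP[q0 q1] v0; rewrite /gain mulrDr lerD//.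
  by apply: le_trans uv _; rewrite ler_wpM2r// expr2 ler_piMr.
rewrite -(ger0_norm q0) -sqrtr_sqr -sqrtrM ?sqr_ge0//.
by apply: ler_wsqrtr.
Qed.

(* Each partial colouring leaves at most 9/10 of the vectors, so the errors decrease
   geometrically. *)
Lemma colouring_log (S : {set I}) : exists x : I -> R,
  (forall t, x t = 1 \/ x t = -1) /\
  lpnorm p (\sum_(t in S) x t *: w t) <=
    100 * Num.sqrt (1280 * (k%:R * log2mk R m k * gain (#|S|%:R / k%:R))).
Proof.
have L0 : 0 <= log2mk R m k by apply: le_trans (log2mk_ge m0 k0).
have K0 : 0 < k%:R :> R by rewrite ltr0n.
have [n] := ubnP #|S|; elim: n S => // n IH S; rewrite ltnS => Sn.
have [S0|a0] := posnP #|S|.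
  exists (fun=> 1); split; first by left.
  rewrite (cards0_eq S0) big_set0 (lpnorm0 _ p2).
  by apply: mulr_ge0; [exact: ler0n | exact: sqrtr_ge0].
pose a := #|S|; pose W : 'M[R]_(m, a) := \matrix_(i, t) w (enum_val t) 0 i.
have colW t : lpnorm p (col t W)^T <= 2.
  rewrite (_ : (col t W)^T = w (enum_val t))//.
  by apply/rowP => i; rewrite !mxE.
have [chi [chi3 chin chiW]] := @partial_colouring m a W p a0 p2 colW.
pose Z := [set t in S | chi (enum_rank_in (enum_valP (Ordinal a0)) t) == 0].
set rk := enum_rank_in _ in Z.
have rkK t : t \in S -> enum_val (rk t) = t by move=> tS; exact: enum_rankK_in.
have Krk (t : 'I_a) : rk (enum_val t) = t by exact: enum_valK_in.
have ZS : Z \subset S by apply/fintype.subsetP => t; rewrite inE => /andP[].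
have cardZ : (10 * #|Z| <= 9 * a)%N.
  have -> : #|Z| = #|[pred t | chi t == 0]|.
    rewrite -(card_imset _ (@enum_val_inj _ (mem S))) /=.
    apply: eq_card => t; rewrite inE; apply/idP/imsetP => [/andP[tS ct]|[s]].
      by exists (rk t); rewrite ?rkK// inE.
    by rewrite inE => cs ->; rewrite enum_valP Krk.
  have := cardC [pred t | chi t == 0]; rewrite card_ord => h.
  have e2 : #|[predC [pred t | chi t == 0]]| = #|[pred t | chi t != 0]| by apply: eq_card.
  rewrite e2 in h; move: chin h.
  set y := #|[pred t | chi t != 0]|; set z := #|[pred t | chi t == 0]|.
  by move: (y) (z) (a) => y' z' a'; lia.
have [|x' [x'1 hx']] := IH Z; first by have : (a > 0)%N by []; rewrite -/a in Sn; lia.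
pose x t := if t \in Z then x' t else if t \in S then chi (rk t) else 1.
exists x; split=> [t|].
  rewrite /x; case: ifPn => [_|tZ]; first exact: x'1.
  case: ifPn => [tS|_]; last by left.
  by case: (chi3 (rk t)) => h; [rewrite inE tS h eqxx in tZ|left|right].
have split_sum : \sum_(t in S) x t *: w t =
    \sum_(t in Z) x' t *: w t + \row_i \sum_t W i t * chi t.
  rewrite (big_setID Z)/= (finset.setIidPr ZS); congr (_ + _).
    by apply: eq_bigr => t tZ; rewrite /x tZ.
  have -> : \row_i (\sum_t W i t * chi t) = \sum_(t in S) chi (rk t) *: w t.
    apply/rowP => i; rewrite mxE summxE (big_enum_val (fun t => (chi (rk t) *: w t) 0 i))/=.
    by apply: eq_bigr => t _; rewrite !mxE Krk mulrC.
  rewrite [RHS](big_setID Z)/= [X in _ = X + _]big1 ?add0r; last first.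
    by move=> t; rewrite !inE => /andP[tS /andP[_ /eqP ->]]; rewrite scale0r.
  apply: eq_bigr => t; rewrite finset.in_setD => /andP[tZ tS].
  by rewrite /x (negbTE tZ) tS.
rewrite split_sum; apply: le_trans (ler_lpnormD _ _ p2) _.
set H := fun b : nat => Num.sqrt (1280 * (k%:R * log2mk R m k * gain (b%:R / k%:R))) in hx' *.
have H0 b : 0 <= H b by exact: sqrtr_ge0.
have step : lpnorm p (\row_i (\sum_t W i t * chi t)) <= H a.
  apply: le_trans chiW _; apply: ler_wsqrtr.
  have := mul_log_ratio_le m0 k0 a0; rewrite -/a; lra.
(* 9/10 <= (99/100)^4: one square root comes from [H], the other from [gain]. The ratio 99/100
   explains the factor 100 in the claim, as 99 + 1 = 100. *)
have shrink : H #|Z| <= 99 / 100 * H a.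
  have q01 : 0 <= 99 / 100 :> R by lra.
  rewrite -[X in X * _](ger0_norm q01) -sqrtr_sqr -sqrtrM ?sqr_ge0//; apply: ler_wsqrtr.
  rewrite [leRHS]mulrCA; apply: ler_wpM2l; first exact: ler0n.
  rewrite [leRHS]mulrCA; apply: ler_wpM2l; first by rewrite mulr_ge0.
  apply: ler_gain_scale; rewrite ?divr_ge0//; last by lra.
  rewrite mulrA ler_pM2r ?invr_gt0//.
  have : (10 * #|Z|)%:R <= (9 * a)%:R :> R by rewrite ler_nat.
  have : 0 <= a%:R :> R by [].
  by rewrite !natrM; lra.
rewrite -/(H _) in hx'; rewrite -/(H a).
have := H0 a; lra.
Qed.

End FullColouring.
End Colouring.

(** * Moments of random signs, for the term p of the minimum *)

Section Moments.
Variable R : realType.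

Lemma powR_le_expR (z q : R) : 0 <= z -> 0 < q -> z `^ q <= q `^ q * expR z.
Proof.
move=> z0 q0; have {1}-> : z = q * (z / q) by rewrite mulrC divfK ?gt_eqF.
have zq0 : 0 <= z / q by rewrite divr_ge0 ?(ltW q0).
rewrite (powRM _ (ltW q0) zq0) ler_wpM2l ?powR_ge0//.
have -> : expR z = expR (z / q) `^ q by rewrite -expRM divfK ?gt_eqF.
rewrite ge0_ler_powR ?nnegrE ?expR_ge0 ?(ltW q0)//.
by apply: le_trans (expR_ge1Dx _); rewrite lerDr.
Qed.

Lemma exists_le_avg (I : finType) (f : I -> R) (c : R) : (0 < #|I|)%N ->
  \sum_i f i <= #|I|%:R * c -> exists i, f i <= c.
Proof.
move=> I0 h; apply: contrapT => no.
have fc i : c < f i by rewrite ltNge; apply/negP => hi; apply: no; exists i.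
move: h; apply/negP; rewrite -ltNge mulr_natl -sumr_const.
have /card_gt0P[i0 _] := I0.
rewrite (bigD1 i0)//= [ltRHS](bigD1 i0)//= ltr_leD//.
by apply: ler_sum => i _; exact: ltW.
Qed.

(** Khintchine's inequality. The choice [lam] = sqrt q / N makes the exponent of the moment
    generating function 2 q, so that it contributes a factor to the power q. *)
Lemma signs_moment (a : nat) (w : 'I_a -> R) (q : R) : 0 < q ->
  \sum_(e : signs a) `|\sum_t w t * sgn R e t| `^ q <=
    2 * 2 ^+ a * (expR 2 * Num.sqrt q * Num.sqrt (\sum_t w t ^+ 2)) `^ q.
Proof.
move=> q0; set N := Num.sqrt (\sum_t w t ^+ 2).
have s0 : 0 <= \sum_t w t ^+ 2 by apply: sumr_ge0 => t _; exact: sqr_ge0.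
have N2 : N ^+ 2 = \sum_t w t ^+ 2 by rewrite sqr_sqrtr.
have [N0|Nn] := eqVneq N 0.
  rewrite big1 ?mulr_ge0 ?powR_ge0 ?exprn_ge0// => e _.
  rewrite big1 ?normr0 ?powR0 ?gt_eqF// => t _.
  move: N2; rewrite N0 expr0n/= => /esym/eqP; rewrite psumr_eq0 => [|i _]; last exact: sqr_ge0.
  by move=> /allP/(_ t (mem_index_enum _)); rewrite sqrf_eq0 => /eqP->; rewrite mul0r.
have Np : 0 < N by rewrite lt_neqAle eq_sym Nn sqrtr_ge0.
have Q0 : 0 < Num.sqrt q by rewrite sqrtr_gt0.
pose lam := Num.sqrt q / N; have l0 : 0 < lam by rewrite divr_gt0.
have H (e : signs a) : `|\sum_t w t * sgn R e t| `^ q <=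
    (Num.sqrt q * N) `^ q * expR (lam * `|\sum_t w t * sgn R e t|).
  set y := `|_|; have y0 : 0 <= y by exact: normr_ge0.
  have {1}-> : y = (lam * y) * (N / Num.sqrt q) by rewrite /lam; field; rewrite Nn gt_eqF.
  have ly0 : 0 <= lam * y by rewrite mulr_ge0// ltW.
  have nq0 : 0 <= N / Num.sqrt q by rewrite divr_ge0// ltW.
  rewrite (powRM _ ly0 nq0).
  have -> : (Num.sqrt q * N) `^ q = q `^ q * (N / Num.sqrt q) `^ q.
    rewrite -(powRM _ (ltW q0) nq0); congr (_ `^ _).
    by rewrite -{2}(sqr_sqrtr (ltW q0)); field; rewrite gt_eqF.
  rewrite [leRHS]mulrAC ler_wpM2r ?powR_ge0// powR_le_expR//.
apply: (le_trans (ler_sum _ (fun e _ => H e))).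
rewrite -big_distrr/=; apply: le_trans (ler_wpM2l (powR_ge0 _ _) (signs_mgf_abs _ (ltW l0))) _.
have -> : 2 * lam ^+ 2 * \sum_t w t ^+ 2 = 2 * q.
  rewrite -N2 /lam expr_div_n (sqr_sqrtr (ltW q0)); field; exact: Nn.
rewrite expRM -[expR 2 * _ * N]mulrA [in leRHS]powRM ?expR_ge0 ?mulr_ge0 ?sqrtr_ge0//.
by rewrite le_eqVlt; apply/orP; left; apply/eqP; ring.
Qed.

End Moments.

Section FullColouring.
Variable R : realType.

(** Some sign vector does not exceed the average of the r-th power of the norm. The factor 2 from
    the two-sided moment bound is absorbed by doubling the base. *)
Lemma colouring_lp (m a : nat) (W : 'M[R]_(m, a)) (r : R) : 2 <= r ->
  (forall t, lpnorm r%:E (col t W)^T <= 2) ->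
  exists x : 'I_a -> R, (forall t, x t = 1 \/ x t = -1) /\
    lpnorm r%:E (\row_i \sum_t W i t * x t) <= 4 * expR 2 * Num.sqrt (r * a%:R).
Proof.
move=> r2 colW; have r0 : 0 < r by rewrite (lt_le_trans _ r2).
have p2 : (2%:E <= r%:E)%E by rewrite lee_fin.
set B := expR 2 * Num.sqrt r * (2 * Num.sqrt a%:R).
have B0 : 0 <= B by rewrite !mulr_ge0 ?expR_ge0 ?sqrtr_ge0.
have c0 : (0 < #|{: signs a}|)%N by rewrite card_signs expn_gt0.
have [|e he] := @exists_le_avg R _ (fun e : signs a =>
    \sum_i `|\sum_t W i t * sgn R e t| `^ r) (2 * B `^ r) c0.
  rewrite exchange_big/= card_signs natrX.
  apply: (le_trans (ler_sum _ (fun i _ => signs_moment (W i) r0))).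
  rewrite -big_distrr/= mulrCA mulrA ler_wpM2l ?mulr_ge0 ?exprn_ge0//.
  rewrite (eq_bigr (fun i => (expR 2 * Num.sqrt r) `^ r * norm2 (row i W) `^ r)); last first.
    move=> i _; rewrite powRM ?mulr_ge0 ?expR_ge0 ?sqrtr_ge0//.
    by congr (_ * (Num.sqrt _) `^ _); apply: eq_bigr => t _; rewrite mxE.
  have c2 : 0 <= 2 * Num.sqrt a%:R :> R by rewrite mulr_ge0 ?sqrtr_ge0.
  have c3 : 0 <= expR 2 * Num.sqrt r by rewrite mulr_ge0 ?expR_ge0 ?sqrtr_ge0.
  rewrite -big_distrr/= (powRM _ c3 c2) ler_wpM2l ?powR_ge0//.
  have /(lpnorm_leE _ p2 c2) := lpnorm_row_norms p2 (ler0n _ 2) colW.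
  apply: le_trans; apply: ler_sum => i _.
  by rewrite mxE ger0_norm ?norm2_ge0.
exists (sgn R e); split.
  by move=> t; rewrite /sgn; case: (e t); [right; rewrite expr1|left; rewrite expr0].
have -> : 4 * expR 2 * Num.sqrt (r * a%:R) = 2 * B.
  by rewrite /B sqrtrM ?(ltW r0)//; ring.
have B20 : 0 <= 2 * B by rewrite mulr_ge0.
apply/(lpnorm_leE _ p2 B20).
rewrite powRM//; apply: (@le_trans _ _ (2 * B `^ r)).
  by apply: le_trans he; apply: ler_sum => i _; rewrite mxE.
by rewrite ler_wpM2r ?powR_ge0// le1r_powR ?ler1n// (le_trans _ r2)// ler1n.
Qed.

Definition colour_cst : R := 100 * Num.sqrt 1280 + 4 * expR 2.

Lemma colour_cst_ge0 : 0 <= colour_cst.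
Proof.
apply: addr_ge0; apply: mulr_ge0;
  [exact: ler0n | exact: sqrtr_ge0 | exact: ler0n | exact: expR_ge0].
Qed.

Lemma full_colouring (m k : nat) (p : \bar R) (a : nat) (w : 'I_a -> 'rV[R]_m) :
  (0 < m)%N -> (0 < k)%N -> (2%:E <= p)%E -> (forall t, lpnorm p (w t) <= 2) ->
  exists x : 'I_a -> R, (forall t, x t = 1 \/ x t = -1) /\
    lpnorm p (\sum_t x t *: w t) <=
      colour_cst * Num.sqrt (k%:R * minpl m k p * gain (a%:R / k%:R)).
Proof.
move=> m0 k0 p2 w2; have K0 : 0 < k%:R :> R by rewrite ltr0n.
have u0 : 0 <= a%:R / k%:R :> R by rewrite divr_ge0.
have kMg M : 0 <= M -> 0 <= k%:R * M * gain (a%:R / k%:R) by move=> M0; rewrite !mulr_ge0 ?gain_ge0.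
have [[r [pE ->]]|->] := minpl_cases m k p2.
  rewrite pE lee_fin in p2 w2 *; have r0 : 0 <= r by rewrite (le_trans _ p2).
  pose W : 'M[R]_(m, a) := \matrix_(i, t) w t 0 i.
  have [|x [x1 hx]] := @colouring_lp m a W r p2.
    move=> t; rewrite (_ : (col t W)^T = w t)//.
    by apply/rowP => i; rewrite !mxE.
  exists x; split=> //.
  have -> : \sum_t x t *: w t = \row_i \sum_t W i t * x t.
    apply/rowP => i; rewrite mxE summxE; apply: eq_bigr => t _.
    by rewrite !mxE mulrC.
  apply: le_trans hx _; apply: ler_pM; rewrite ?sqrtr_ge0 ?mulr_ge0 ?expR_ge0//.
    by rewrite /colour_cst lerDr mulr_ge0 ?sqrtr_ge0 ?ler0n.
  apply: ler_wsqrtr; rewrite [k%:R * r]mulrC -mulrA ler_wpM2l// /gain mulrDr.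
  by rewrite [k%:R * (_ / _)]mulrC divfK ?gt_eqF// lerDl mulr_ge0 ?sqrtr_ge0.
have L0 : 0 <= log2mk R m k by apply: le_trans (log2mk_ge R m0 k0).
have [x [x1 hx]] := colouring_log m0 k0 p2 w2 [set: 'I_a].
exists x; split=> //; move: hx; rewrite cardsT card_ord.
rewrite (eq_bigl predT) => [hx|t]; last by rewrite inE.
apply: le_trans hx _; rewrite sqrtrM; last exact: ler0n.
rewrite mulrA.
apply: ler_wpM2r; first exact: sqrtr_ge0.
by rewrite lerDl; apply: mulr_ge0; [exact: ler0n | exact: expR_ge0].
Qed.

(* When denominators are reduced from 2 ^ j.+1 to 2 ^ j, at most k * 2 ^ j pairs are
   coloured, k * 2 ^ j / 2 ^ r after r rounds, and the outcome enters with the factor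
   2 ^ - j.+1; hence [gain_decay] makes the errors summable over j and r. *)
Definition decay : R := 9 / 10.

Lemma decay_bounds : 0 <= decay /\ decay < 1.
Proof. by rewrite /decay; split; lra. Qed.

Lemma gain_decay (u : R) (j r : nat) : 0 <= u -> u <= 2 ^+ j / 2 ^+ r ->
  Num.sqrt (gain u) <= 2 * 2 ^+ j * decay ^+ (j + r).
Proof.
move=> u0 hu; have [d0 _] := decay_bounds.
have hG : 2^-1 <= decay ^+ 2 by rewrite /decay; lra.
(* The square root in [gain] halves the exponent of the decay in r, so even the fourth power of
   [decay] has to be at least 1/2. *)
have hG2 : 2^-1 <= (decay ^+ 2) ^+ 2 by rewrite /decay; lra.
move: d0 hG hG2; set d := decay; clearbody d => d0.
set G := d ^+ 2 => hG hG2; have G0 : 0 <= G by rewrite sqr_ge0.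
have pw x n : 2^-1 <= x -> 2^-1 ^+ n <= x ^+ n :> R.
  by move=> h; apply: lerXn2r; rewrite ?nnegrE// (le_trans _ h).
have P j' : 0 <= 2 ^+ j' :> R by rewrite exprn_ge0.
have inv2 n : (2 ^+ n)^-1 = 2^-1 ^+ n :> R by rewrite exprVn.
rewrite -(ler_pXn2r (_ : 0 < 2)%N)// ?nnegrE ?sqrtr_ge0 ?mulr_ge0 ?exprn_ge0//.
rewrite (sqr_sqrtr (gain_ge0 u0)) !exprMn -[d ^+ _ ^+ 2]exprAC -/G exprD.
have one n : 2 ^+ n * 2^-1 ^+ n = 1 :> R by rewrite -exprMn divff// expr1n.
have h1 : u <= (2 ^+ j) ^+ 2 * (G ^+ j * G ^+ r).
  apply: le_trans hu _; rewrite inv2.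
  have -> : 2 ^+ j * 2^-1 ^+ r = (2 ^+ j) ^+ 2 * (2^-1 ^+ j * 2^-1 ^+ r) :> R.
    by rewrite expr2 -mulrA [2 ^+ j * (2^-1 ^+ j * _)]mulrA one mul1r.
  by rewrite ler_wpM2l ?sqr_ge0// ler_pM ?exprn_ge0 ?pw.
have h2 : Num.sqrt u <= (2 ^+ j) ^+ 2 * (G ^+ j * G ^+ r).
  apply: (@le_trans _ _ (2 ^+ j * G ^+ r)).
    rewrite -(ler_pXn2r (_ : 0 < 2)%N)// ?nnegrE ?sqrtr_ge0 ?mulr_ge0 ?exprn_ge0//.
    rewrite (sqr_sqrtr u0); apply: le_trans hu _; rewrite inv2 exprMn ler_pM ?exprn_ge0//.
      by rewrite expr2 ler_peMl ?P// exprn_ege1// ler1n.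
    by rewrite exprAC pw.
  rewrite expr2 -mulrA ler_wpM2l// mulrA ler_peMl ?exprn_ge0//.
  by rewrite -[leLHS](one j) ler_wpM2l ?pw.
rewrite /gain; move: h1 h2; set X := _ * (_ * _); set Y := Num.sqrt u.
have -> : 2 ^+ 2 * (2 ^+ j) ^+ 2 * (G ^+ j * G ^+ r) = 4 * X by rewrite /X; ring.
have X0 : 0 <= X by rewrite mulr_ge0 ?sqr_ge0// mulr_ge0 ?exprn_ge0.
lra.
Qed.

Lemma geo_sum_le (x : R) n : 0 <= x -> x < 1 -> \sum_(i < n) x ^+ i <= (1 - x)^-1.
Proof.
move=> x0 x1; have h : 0 < 1 - x by rewrite subr_gt0.
rewrite -div1r ler_pdivlMr// mulrC.
by rewrite -[1 - x]opprB mulNr -subrX1 opprB lerBlDr lerDl exprn_ge0.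
Qed.

End FullColouring.

(** * Rounding the coefficients bit by bit *)

Lemma pairing (T : Type) (s : seq T) : exists (P : seq (T * T)) (u : seq T),
  (size u <= 1)%N /\ s = flatten [seq [:: x.1; x.2] | x <- P] ++ u.
Proof.
have [n] := ubnP (size s); elim: n s => // n IH [|x [|y s]] sn.
- by exists [::], [::].
- by exists [::], [:: x].
have [|P [u [u1 sE]]] := IH s; first by move: sn => /=; lia.
by exists ((x, y) :: P), u; rewrite /= -sE.
Qed.

Section Levels.
Variable R : realType.

(** Absolute errors O(1) before the division by k are harmless: [minpl] >= 1/2 and k >= 1 give 1 / k
    <= 2 * [rate]. This relies on the logarithm being frozen at log 2 for k > m. *)
Lemma minpl_rate (m k : nat) (p : \bar R) A B : (0 < m)%N -> (0 < k)%N ->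
  (2%:E <= p)%E -> 0 <= A ->
  k%:R^-1 * (A + B * Num.sqrt (k%:R * minpl m k p)) <= (2 * A + B) * rate m k p.
Proof.
move=> m0 k0 p2 A0; have K0 : 0 < k%:R :> R by rewrite ltr0n.
have M2 := minpl_ge m0 k0 p2; rewrite /rate -/(minpl m k p); set M := minpl m k p in M2 *.
have M0 : 0 <= M by lra.
have -> : k%:R^-1 * (A + B * Num.sqrt (k%:R * M)) =
    A / k%:R + B * (Num.sqrt (k%:R * M) / k%:R) by ring.
have -> : Num.sqrt (k%:R * M) / k%:R = Num.sqrt (M / k%:R).
  rewrite -{2}(ger0_norm (ltW K0)) -sqrtr_sqr -sqrtrV ?sqr_ge0//.
  rewrite -sqrtrM ?mulr_ge0 ?(ltW K0)//; congr Num.sqrt.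
  by field; rewrite gt_eqF.
rewrite [(2 * A + B) * _]mulrDl lerD2r [2 * A]mulrC -mulrA ler_wpM2l//.
have k1 : 1 <= k%:R :> R by rewrite ler1n.
rewrite -(ler_pXn2r (_ : 0 < 2)%N)// ?nnegrE ?mulr_ge0 ?sqrtr_ge0 ?invr_ge0 ?(ltW K0)//.
rewrite exprMn sqr_sqrtr ?divr_ge0 ?(ltW K0)// expr2 mulrA ler_wpM2r ?invr_ge0 ?(ltW K0)//.
have : k%:R^-1 <= 1 :> R by rewrite invf_le1.
lra.
Qed.

Section Bodies.
Variables (m k n : nat) (p : \bar R) (V : 'I_n -> 'rV[R]_m).
Hypotheses (m0 : (0 < m)%N) (k0 : (0 < k)%N) (p2 : (2%:E <= p)%E).
Hypothesis V1 : forall i, lpnorm p (V i) <= 1.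

Definition combo (c : 'I_n -> nat) : 'rV[R]_m := \sum_i (c i)%:R *: V i.

Lemma ler_lpnorm_combo (a : 'I_n -> R) b : (forall i, `|a i| <= b) ->
  lpnorm p (\sum_i a i *: V i) <= n%:R * b.
Proof.
move=> ab; apply: le_trans (ler_lpnorm_sum _ _ _ p2) _.
rewrite mulr_natl -[X in _ *+ X](card_ord n) -sumr_const; apply: ler_sum => i _.
rewrite lpnormZ// -[leRHS]mulr1; apply: ler_pM => //; exact: lpnorm_ge0.
Qed.

Lemma finish (c : 'I_n -> nat) (i0 : 'I_n) (z : 'rV[R]_m) E :
  (\sum_i c i <= k)%N -> (k <= (\sum_i c i).+1)%N ->
  lpnorm p (k%:R *: z - combo c) <= E ->
  let c' i := (c i + (i == i0) * (k - \sum_i c i))%N in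
  (\sum_i c' i)%N = k /\ lpnorm p (z - k%:R^-1 *: combo c') <= k%:R^-1 * (E + 1).
Proof.
clear m0.
move=> ck kc hE c'; split.
  rewrite big_split/= [X in (_ + X)%N](bigD1 i0)//= eqxx mul1n.
  by rewrite [X in (_ + (_ + X))%N]big1 => [|i /negbTE ->//]; rewrite addn0 subnKC.
have K0 : 0 < k%:R :> R by rewrite ltr0n.
have -> : z - k%:R^-1 *: combo c' = k%:R^-1 *: ((k%:R *: z - combo c) -
    (k - \sum_i c i)%:R *: V i0).
  rewrite !scalerBr scalerA mulVf ?gt_eqF// scale1r -!addrA -opprD; congr (_ - _).
  rewrite -scalerDr; congr (_ *: _).
  rewrite /combo.
  have -> : \sum_i (c' i)%:R *: V i = \sum_i ((c i)%:R *: V i +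
      ((i == i0) * (k - \sum_i c i))%:R *: V i).
    by apply: eq_bigr => i _; rewrite /c' natrD scalerDl.
  rewrite big_split/=; congr (_ + _); rewrite (bigD1 i0)//= eqxx mul1n.
  rewrite [X in _ + X = _]big1 ?addr0//.
  by move=> i /negbTE ->; rewrite mul0n scale0r.
rewrite lpnormZ// ger0_norm ?invr_ge0 ?(ltW K0)// ler_wpM2l ?invr_ge0 ?(ltW K0)//.
apply: le_trans (ler_lpnormB _ _ p2) _; apply: lerD => //.
rewrite lpnormZ// normr_nat -[leRHS]mulr1; apply: ler_pM => //; first exact: lpnorm_ge0.
by rewrite lern1; lia.
Qed.

Let B := colour_cst R * Num.sqrt (k%:R * minpl m k p).

Let M0 : 0 <= minpl m k p.
Proof. by apply: le_trans (minpl_ge m0 k0 p2); lra. Qed.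

(* The odd coefficients are grouped in pairs, and the colour of a pair decides which of its
   two members is rounded up, so that rounding preserves the sum up to one leftover. *)
Lemma level_step (c : 'I_n -> nat) (j : nat) : (\sum_i c i <= k * 2 ^ j.+1)%N ->
  exists c' : 'I_n -> nat, [/\ (2 * \sum_i c' i <= \sum_i c i)%N,
    (\sum_i c i <= 2 * \sum_i c' i + 1)%N &
    lpnorm p (combo c - 2 *: combo c') <= 1 + B * (2 * 2 ^+ j * decay R ^+ j)].
Proof.
move=> ck; pose s := [seq i <- index_enum 'I_n | odd (c i)].
have [P [u [u1 sE]]] := pairing s.
pose a := size P; pose IJ (t : 'I_a) := tnth (in_tuple P) t.
have odd_sum (U : nmodType) (f : 'I_n -> U) : \sum_(i | odd (c i)) f i =
    \sum_(t < a) (f (IJ t).1 + f (IJ t).2) + \sum_(i <- u) f i.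
  rewrite -big_filter -/s sE big_cat/=; congr (_ + _).
  rewrite big_flatten/= big_map.
  rewrite -[in LHS](in_tupleE P) big_tuple; apply: eq_bigr => t _.
  by rewrite !big_cons big_nil addr0.
have sum_odd : (\sum_i c i = 2 * \sum_i (c i)./2 + (2 * a + size u))%N.
  have h : (\sum_(i | odd (c i)) 1 = 2 * a + size u)%N.
    rewrite -big_filter -/s sum1_size sE size_cat size_flatten /shape -map_comp.
    by rewrite sumnE big_map/= big_const_seq count_predT iter_addn_0.
  rewrite -h [X in (_ + X)%N]big_mkcond/= big_distrr/= -big_split/=; apply: eq_bigr => i _.
  by rewrite -{1}(odd_double_half (c i)) -muln2; case: (odd _) => /=; lia.
have ak : (a <= k * 2 ^ j)%N by move: ck; rewrite sum_odd expnS; lia.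
have [|x [x1 hx]] := @full_colouring R m k p a (fun t => V (IJ t).1 - V (IJ t).2) m0 k0 p2.
  by move=> t; apply: le_trans (ler_lpnormB _ _ p2) _; rewrite -[leRHS]/(1 + 1) lerD.
pose ch t := if x t == 1 then (IJ t).1 else (IJ t).2.
exists (fun i => ((c i)./2 + \sum_(t < a) (i == ch t))%N).
have sumc' : (\sum_i ((c i)./2 + \sum_(t < a) (i == ch t)) = \sum_i (c i)./2 + a)%N.
  rewrite big_split/= exchange_big/=; congr (_ + _)%N.
  rewrite -[RHS](card_ord a) -sum1_card; apply: eq_bigr => t _.
  by rewrite (bigD1 (ch t))//= eqxx big1// => i /negbTE ->.
split; rewrite ?sumc' ?sum_odd; try lia.
have -> : combo c - 2 *: combo (fun i => ((c i)./2 + \sum_(t < a) (i == ch t))%N) =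
    \sum_(i <- u) V i - \sum_t x t *: (V (IJ t).1 - V (IJ t).2).
  have -> : combo c = 2 *: combo (fun i => (c i)./2) + \sum_(i | odd (c i)) V i.
    rewrite /combo scaler_sumr [X in _ = _ + X]big_mkcond -big_split/=; apply: eq_bigr => i _.
    rewrite -{1}(odd_double_half (c i)) -muln2 mulnC natrD natrM scalerA.
    by case: (odd _); rewrite /= ?scalerDl ?scale1r ?scale0r 1?addrC ?addr0.
  have -> : combo (fun i => ((c i)./2 + \sum_(t < a) (i == ch t))%N) =
      combo (fun i => (c i)./2) + \sum_t V (ch t).
    rewrite /combo.
    rewrite (eq_bigr (fun i => ((c i)./2)%:R *: V i +
        \sum_(t < a) (i == ch t)%:R *: V i)); last first.
      by move=> i _; rewrite natrD scalerDl natr_sum scaler_suml.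
    rewrite big_split/=; congr (_ + _).
    rewrite exchange_big/=; apply: eq_bigr => t _.
    rewrite (bigD1 (ch t))//= eqxx scale1r big1 ?addr0// => i /negbTE ->.
    by rewrite scale0r.
  rewrite odd_sum scalerDr opprD addrACA subrr add0r addrAC addrC; congr (_ + _).
  rewrite scaler_sumr -sumrN -big_split/= -sumrN; apply: eq_bigr => t _; rewrite /ch.
  case: (x1 t) => ->; first by rewrite eqxx scale1r scaler_nat mulr2n; apply/rowP=> i; rewrite !mxE; ring.
  rewrite ifF; last by apply/eqP; lra.
  by rewrite scaler_nat mulr2n; apply/rowP=> i; rewrite !mxE; ring.
apply: le_trans (ler_lpnormB _ _ p2) _; apply: lerD.
  case: u u1 {sE odd_sum sum_odd} => [|i [|]]//= _; first by rewrite big_nil lpnorm0.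
  by rewrite big_seq1.
apply: le_trans hx _; rewrite /B -[leRHS]mulrA ler_wpM2l ?colour_cst_ge0//.
rewrite sqrtrM ?mulr_ge0// ler_wpM2l ?sqrtr_ge0//.
rewrite -[X in decay R ^+ X]addn0; apply: gain_decay; first by rewrite divr_ge0.
rewrite expr0 divr1 ler_pdivrMr ?ltr0n// -natrX -natrM ler_nat mulnC.
exact: ak.
Qed.

(** Each step floors half of the total, so the final total is the floor of the initial one divided
    by 2^l. After a truncation losing less than 2^l units in total, it is therefore k or k - 1, as
    [finish] demands. *)
Lemma levels (l : nat) (c : 'I_n -> nat) : (\sum_i c i <= k * 2 ^ l)%N ->
  exists c' : 'I_n -> nat, [/\ (\sum_i c' i <= k)%N,
    (\sum_i c i < 2 ^ l * (\sum_i c' i).+1)%N &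
    lpnorm p ((2 ^+ l)^-1 *: combo c - combo c') <=
      \sum_(j < l) (2^-1 ^+ j / 2 + B * decay R ^+ j)].
Proof.
elim: l c => [|l IH] c ck.
  exists c; split; rewrite ?expn0 ?mul1n//; first by rewrite expn0 muln1 in ck.
  by rewrite big_ord0 expr0 invr1 scale1r subrr lpnorm0.
have [c1 [h1 h2 h3]] := level_step ck.
have [|c2 [g1 g2 g3]] := IH c1; first by move: ck h1; rewrite expnS; lia.
exists c2; split=> //; first by rewrite expnS; nia.
rewrite big_ord_recr/=.
have P0 : 0 < 2 ^+ l :> R by rewrite exprn_gt0.
have -> : (2 ^+ l.+1)^-1 *: combo c - combo c2 =
    ((2 ^+ l)^-1 *: combo c1 - combo c2) + (2 ^+ l.+1)^-1 *: (combo c - 2 *: combo c1).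
  rewrite scalerBr scalerA.
  have -> : (2 ^+ l.+1)^-1 * 2 = (2 ^+ l)^-1 :> R by rewrite exprS; field; rewrite gt_eqF.
  by apply/rowP => i; rewrite !mxE; ring.
apply: le_trans (ler_lpnormD _ _ p2) _; apply: lerD => //.
have Pl0 : 0 <= (2 ^+ l.+1)^-1 :> R by rewrite invr_ge0 exprn_ge0.
rewrite lpnormZ// ger0_norm//; apply: le_trans (ler_wpM2l Pl0 h3) _.
rewrite le_eqVlt; apply/orP; left; apply/eqP.
by rewrite exprS exprVn; field; rewrite gt_eqF.
Qed.

Lemma level_sum_le (l : nat) :
  \sum_(j < l) (2^-1 ^+ j / 2 + B * decay R ^+ j) <= 1 + 10 * B.
Proof.
have B0 : 0 <= B by rewrite mulr_ge0 ?colour_cst_ge0 ?sqrtr_ge0.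
rewrite big_split/= -mulr_suml -big_distrr/=; apply: lerD.
  by have := @geo_sum_le R 2^-1 l (ltac:(lra)) (ltac:(lra));
    rewrite (_ : (1 - 2^-1)^-1 = 2); [lra|field].
have [d0 d1] := decay_bounds R.
have := geo_sum_le l d0 d1; have -> : (1 - decay R)^-1 = 10 by rewrite /decay; field.
by rewrite mulrC; apply: ler_wpM2r.
Qed.

(** Each coefficient loses less than 2^-l; the condition n <= 2^l is what keeps the n losses below 1
    altogether. *)
Lemma truncation (lam : 'I_n -> R) (l : nat) : (forall i, 0 <= lam i) ->
  \sum_i lam i = 1 -> (n <= 2 ^ l)%N ->
  let c i := Num.truncn (k%:R * lam i * 2 ^+ l) in
  [/\ (\sum_i c i <= k * 2 ^ l)%N, (k * 2 ^ l < \sum_i c i + n)%N &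
      lpnorm p (k%:R *: \sum_i lam i *: V i - (2 ^+ l)^-1 *: combo c) <= 1].
Proof.
move=> lam0 lam1 nl c.
have P0 : 0 < 2 ^+ l :> R by rewrite exprn_gt0.
have n0 : (0 < n)%N.
  rewrite lt0n; apply/eqP => nE; move: lam1; rewrite big1 => [/esym/eqP|i _].
    by rewrite oner_eq0.
  by exfalso; have := leq_ltn_trans (leq0n i) (ltn_ord i); rewrite nE.
have cb i : (c i)%:R <= k%:R * lam i * 2 ^+ l < (c i).+1%:R.
  by rewrite truncn_itv// !mulr_ge0// ltW.
have sE : \sum_i k%:R * lam i * 2 ^+ l = (k * 2 ^ l)%:R.
  by rewrite -mulr_suml -big_distrr/= lam1 mulr1 natrM natrX.
split.
- rewrite -(ler_nat R) -sE natr_sum; apply: ler_sum => i _.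
  by have /andP[] := cb i.
- have nE : n%:R = \sum_(i < n) (1 : R) by rewrite sumr_const card_ord.
  rewrite -(ltr_nat R) -sE natrD natr_sum nE -big_split/=.
  have hlt i : k%:R * lam i * 2 ^+ l < (c i)%:R + 1 by have /andP[_ h] := cb i; rewrite natr1.
  rewrite (bigD1 (Ordinal n0))//= [ltRHS](bigD1 (Ordinal n0))//= ltr_leD//.
  by apply: ler_sum => i _; exact: ltW.
rewrite scaler_sumr /combo scaler_sumr -sumrB.
rewrite (eq_bigr (fun i => (k%:R * lam i - (c i)%:R / 2 ^+ l) *: V i)); last first.
  by move=> i _; rewrite scalerBl !scalerA [_ / _]mulrC.
apply: le_trans (@ler_lpnorm_combo _ (2 ^+ l)^-1 _) _ => [i|].
  have /andP[h1 h2] := cb i; rewrite -[(c i).+1%:R]natr1 in h2.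
  rewrite ger0_norm ?subr_ge0 ?ler_pdivrMr//.
  rewrite lerBlDr.
  have -> : (2 ^+ l)^-1 + (c i)%:R / 2 ^+ l = ((c i)%:R + 1) / 2 ^+ l :> R.
    by rewrite mulrDl mul1r addrC.
  by rewrite ler_pdivlMr// ltW.
by rewrite ler_pdivrMr// mul1r -natrX ler_nat.
Qed.

End Bodies.

Definition occurrences n (c : 'I_n -> nat) : seq 'I_n :=
  flatten [seq nseq (c i) i | i : 'I_n].

Lemma size_occurrences n (c : 'I_n -> nat) : size (occurrences c) = (\sum_i c i)%N.
Proof.
rewrite /occurrences size_flatten /shape -map_comp sumnE big_map big_enum/=.
by apply: eq_bigr => i _; rewrite size_nseq.
Qed.

Lemma sum_occurrences n (c : 'I_n -> nat) (U : lmodType R) (f : 'I_n -> U) :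
  \sum_(i <- occurrences c) f i = \sum_i (c i)%:R *: f i.
Proof.
rewrite /occurrences big_flatten/= big_map big_enum/=; apply: eq_bigr => i _.
by rewrite big_nseq iter_addr_0 scaler_nat.
Qed.

Definition ac_cst : R := 6 + 10 * colour_cst R.

Lemma caratheodory_rate (m k n : nat) (p : \bar R) (V : 'I_n -> 'rV[R]_m) (lam : 'I_n -> R) :
  (0 < m)%N -> (0 < k)%N -> (2%:E <= p)%E -> (forall i, lpnorm p (V i) <= 1) ->
  (forall i, 0 <= lam i) -> \sum_i lam i = 1 ->
  exists v : 'I_k -> 'I_n,
    lpnorm p (\sum_i lam i *: V i - k%:R^-1 *: \sum_j V (v j)) <= ac_cst * rate m k p.
Proof.
move=> m0 k0 p2 V1 lam0 lam1.
have [i0 _] : exists i0 : 'I_n, True.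
  apply: contrapT => no; move: lam1; rewrite big1 => [/esym/eqP|i _].
    by rewrite oner_eq0.
  by exfalso; apply: no; exists i.
(* For mere existence the number of bits is free, and n bits are enough. *)
have nl : (n <= 2 ^ n)%N by rewrite ltnW// ltn_expl.
have [t1 t2 t3] := truncation k p2 V1 lam0 lam1 nl.
set c := (fun i => Num.truncn _) in t1 t2 t3.
have [c' [g1 g2 g3]] := levels m0 k0 p2 V1 t1.
have P0 : (0 < 2 ^ n)%N by rewrite expn_gt0.
have kc : (k <= (\sum_i c' i).+1)%N.
  rewrite -ltnS -(ltn_pmul2l P0) mulnC; apply: leq_trans t2 _.
  move: nl g2; set s := (\sum_i c i)%N; set s' := (\sum_i c' i)%N; nia.
have hE := le_trans g3 (level_sum_le m k p n).
have := ler_lpnormD (k%:R *: (\sum_i lam i *: V i) - (2 ^+ n)^-1 *: combo V c)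
  ((2 ^+ n)^-1 *: combo V c - combo V c') p2.
rewrite addrA subrK => /le_trans/(_ (lerD t3 hE)) hE2.
have [sk hk] := finish k0 p2 V1 i0 g1 kc hE2.
set c'' := (fun i : 'I_n => (_ + _)%N) in sk hk.
have so : size (occurrences c'') == k by rewrite size_occurrences sk.
exists (tnth (Tuple so)).
have -> : \sum_j V (tnth (Tuple so) j) = combo V c''.
  by rewrite -(big_tuple _ _ (Tuple so) xpredT V)/= sum_occurrences.
apply: le_trans hk _.
(* The three units are the truncation, the unpaired indices of all levels (weights 1/2, 1/4, ...)
   and the padding by one vector. *)
have -> : 1 + (1 + 10 * (colour_cst R * Num.sqrt (k%:R * minpl m k p))) + 1 =
  3 + (10 * colour_cst R) * Num.sqrt (k%:R * minpl m k p) by ring.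
apply: le_trans (minpl_rate _ m0 k0 p2 _) _ => //.
by rewrite /ac_cst; have -> : 2 * 3 = 6 :> R by ring.
Qed.

Lemma ac_le (m k : nat) (p : \bar R) : (0 < m)%N -> (0 < k)%N -> (2%:E <= p)%E ->
  (ac k (lpball m p) (lpball m p) <= ((ac_cst * rate m k p)%:E : \bar R))%E.
Proof.
move=> m0 k0 p2; apply: ge_ereal_sup => _ [X [z [XP [n [lam [V [lam0 lam1 VX ->]]]] ->]]].
have V1 i : lpnorm p (V i) <= 1 by exact: XP (VX i).
have [v hv] := caratheodory_rate m0 k0 p2 V1 lam0 lam1.
set y := _ - _ in hv.
apply: (@le_trans _ _ (gauge (lpball m p) y)).
  by apply: ereal_inf_lbound; exists (fun j => V (v j)) => // j; exact: VX.
have r0 : 0 < rate m k p.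
  have M2 := minpl_ge m0 k0 p2.
  rewrite /rate -/(minpl m k p) sqrtr_gt0 divr_gt0 ?ltr0n//; lra.
have s0 : 0 < ac_cst * rate m k p.
  rewrite mulr_gt0// /ac_cst; have := colour_cst_ge0 R; lra.
set s := ac_cst * _ in s0 hv *.
apply: ereal_inf_lbound; exists s => //; split; first exact: ltW.
exists (s^-1 *: y); last by rewrite scalerA divff ?gt_eqF// scale1r.
rewrite /lpball/= lpnormZ// ger0_norm ?invr_ge0 ?(ltW s0)//.
by rewrite mulrC ler_pdivrMr// mul1r.
Qed.

End Levels.

Lemma nth_allpairs (S T U : Type) (f : S -> T -> U) (s : seq S) (t : seq T) x0 x1 x2 i j :
  (i < size s)%N -> (j < size t)%N ->
  nth x0 [seq f x y | x <- s, y <- t] (i * size t + j) = f (nth x1 s i) (nth x2 t j).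
Proof.
elim: s i => [|x s IH] [|i]//= hi hj; rewrite nth_cat size_map.
  by rewrite mul0n add0n hj (nth_map x2).
rewrite mulSn -addnA ltnNge leq_addr/= addKn; exact: IH.
Qed.

(** * The exponent of matrix multiplication *)

Section MatrixMultiplicationExponent.
Variable R : realType.
Local Notation instr := (slp_instr R).

Lemma slp_run_cat (inp : seq R) (P Q : seq instr) :
  slp_run inp (P ++ Q) = slp_run (slp_run inp P) Q.
Proof. by rewrite /slp_run foldl_cat. Qed.

Lemma slp_run_prefix (inp : seq R) (P : seq instr) :
  exists2 w, size w = size P & slp_run inp P = inp ++ w.
Proof.
elim/last_ind: P => [|P x [w sw hw]]; first by exists [::]; rewrite ?cats0.
rewrite /slp_run foldl_rcons -/(slp_run inp P) hw.
exists (rcons w (slp_value (inp ++ w) x)); first by rewrite !size_rcons sw.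
by rewrite rcons_cat.
Qed.

Lemma size_entries n (A : 'M[R]_n) : size (entries A) = (n * n)%N.
Proof. by rewrite size_allpairs size_enum_ord. Qed.

Lemma nth_entries n (A : 'M[R]_n) (i j : 'I_n) : (entries A)`_(i * n + j) = A i j.
Proof.
have := @nth_allpairs _ _ _ (fun i j => A i j) (enum 'I_n) (enum 'I_n) 0 i i i j.
by rewrite size_enum_ord !nth_ord_enum => ->.
Qed.

Section Programs.
Variable n : nat.
Let inp (A B : 'M[R]_n) := entries A ++ entries B.

(** The bound on the address makes the value survive extensions of the program; past the end of the
    list [nth] would return a default 0 that later instructions overwrite. *)
Definition computes (P : seq instr) (f : 'M[R]_n -> 'M[R]_n -> R) (a : nat) :=
  (a < 2 * (n * n) + size P)%N /\ forall A B, (slp_run (inp A B) P)`_a = f A B.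

Let size_run A B P : size (slp_run (inp A B) P) = (2 * (n * n) + size P)%N.
Proof.
have [w sw ->] := slp_run_prefix (inp A B) P.
by rewrite !size_cat !size_entries sw mul2n -addnn.
Qed.

Lemma computes_cat P Q f a : computes P f a -> computes (P ++ Q) f a.
Proof.
move=> [ha hf]; split=> [|A B]; first by rewrite size_cat; lia.
rewrite slp_run_cat; have [w _ ->] := slp_run_prefix (slp_run (inp A B) P) Q.
by rewrite nth_cat size_run ha.
Qed.

Lemma computes_rcons P x f :
  (forall A B, slp_value (slp_run (inp A B) P) x = f A B) ->
  computes (rcons P x) f (2 * (n * n) + size P).
Proof.
move=> hx; split=> [|A B]; first by rewrite size_rcons; lia.
rewrite /slp_run foldl_rcons -/(slp_run _ _) nth_rcons size_run ltnn eqxx.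
exact: hx.
Qed.

Lemma computes_left (i j : 'I_n) : computes [::] (fun A _ => A i j) (i * n + j).
Proof.
have h : (i * n + j < n * n)%N by have := ltn_ord i; have := ltn_ord j; nia.
split=> [|A B]; first by rewrite /=; lia.
by rewrite /slp_run/= nth_cat size_entries h nth_entries.
Qed.

Lemma computes_right (i j : 'I_n) :
  computes [::] (fun _ B => B i j) (n * n + (i * n + j)).
Proof.
have h : (i * n + j < n * n)%N by have := ltn_ord i; have := ltn_ord j; nia.
split=> [|A B]; first by rewrite /=; lia.
by rewrite /slp_run/= nth_cat size_entries ltnNge leq_addr/= addKn nth_entries.
Qed.

Lemma dot_program (i j : 'I_n) (ts : seq 'I_n) P : exists (Q : seq instr) (a : nat),
  size Q = (2 * size ts).+1 /\
  computes (P ++ Q) (fun A B => \sum_(t <- ts) A i t * B t j) a.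
Proof.
elim/last_ind: ts => [|ts t [Q [a [sQ hQ]]]].
  exists [:: SConst 0], (2 * (n * n) + size P)%N; split=> //.
  rewrite cats1; apply: computes_rcons => A B; by rewrite big_nil.
have [_ hl] := computes_cat (P ++ Q) (computes_left i t).
have [_ hr] := computes_cat (P ++ Q) (computes_right t j).
pose x : instr := SMul R (i * n + t) (n * n + (t * n + j)).
pose b := (2 * (n * n) + size (P ++ Q))%N.
have hx : computes (rcons (P ++ Q) x) (fun A B => A i t * B t j) b.
  by apply: computes_rcons => A B; rewrite /= hl hr.
have ha : computes (rcons (P ++ Q) x) (fun A B => \sum_(t <- ts) A i t * B t j) a.
  by rewrite -cats1; apply: computes_cat.
exists (rcons (rcons Q x) (SAdd R a b)).
exists (2 * (n * n) + size (rcons (P ++ Q) x))%N; split.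
  by rewrite !size_rcons sQ; lia.
rewrite -!rcons_cat; apply: computes_rcons => A B.
by rewrite big_rcons/= addrC /= (proj2 ha) (proj2 hx) addrC.
Qed.

Lemma mulmx_program (s : seq ('I_n * 'I_n)) : exists (P : seq instr),
  size P = (size s * (2 * n).+1)%N /\
  forall ij, ij \in s -> exists a, computes P (fun A B => (A *m B) ij.1 ij.2) a.
Proof.
elim: s => [|ij s [P [sP hP]]]; first by exists [::].
have [Q [a [sQ hQ]]] := dot_program ij.1 ij.2 (index_enum 'I_n) P.
exists (P ++ Q); split.
  rewrite size_cat sP sQ /= -[index_enum _]enumT size_enum_ord; lia.
move=> kl; rewrite inE => /predU1P[->|/hP[b hb]]; last by exists b; apply: computes_cat.
exists a; split; first by case: hQ.
by move=> A B; rewrite (proj2 hQ) mxE.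
Qed.

End Programs.

(** Shows that the set of exponents in [omega] is nonempty, without which a lower bound on its
    members would say nothing about the infimum. *)
Lemma slp_mulmx_naive (n : nat) : exists2 P, @slp_mulmx R n P &
  size P = (n * n * (2 * n).+1)%N.
Proof.
have [P [sP hP]] := mulmx_program (index_enum ('I_n * 'I_n)%type).
exists P; last by rewrite sP -[index_enum _]enumT -cardE card_prod card_ord.
have ch (ij : 'I_n * 'I_n) := hP ij (mem_index_enum _).
have /choice[out hout] := ch.
by exists (fun i j => out (i, j)) => A B i j; exact: (proj2 (hout (i, j))).
Qed.

(* The n ^ 2 entries of the product are pairwise distinct functions, none of which is an
   input; hence each takes an instruction of its own. *)
Lemma slp_mulmx_size (n : nat) P : @slp_mulmx R n P -> (n * n <= size P)%N.
Proof.
move=> [out hout].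
have rng i j : (2 * (n * n) <= out i j < 2 * (n * n) + size P)%N.
  (* With all entries 2 every entry of the product is 4 n, which is neither an input nor the default
     0 of an address out of range. *)
  pose A : 'M[R]_n := const_mx 2.
  have n0 : (0 < n)%N by apply: leq_ltn_trans (ltn_ord i).
  have AA : (A *m A) i j = 4 * n%:R.
    rewrite mxE (eq_bigr (fun=> 4)) => [|t _]; last by rewrite !mxE; ring.
    by rewrite sumr_const card_ord mulr_natr.
  have n1 : 1 <= n%:R :> R by rewrite ler1n.
  have := hout A A i j; rewrite AA.
  have [w sw ->] := slp_run_prefix (entries A ++ entries A) P.
  have sz : size (entries A ++ entries A) = (2 * (n * n))%N.
    by rewrite size_cat !size_entries mul2n addnn.
  rewrite nth_cat sz; case: ltnP => h1.
    have : (entries A ++ entries A)`_(out i j) \in entries A ++ entries A.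
      by rewrite mem_nth// sz.
    rewrite mem_cat orbb => /allpairsP[[a b] [_ _ ->]]; rewrite mxE/=; lra.
  case: (ltnP (out i j) (2 * (n * n) + size P)) => h2 //.
  rewrite nth_default ?sw//; [lra|lia].
have inj : injective (fun ij : 'I_n * 'I_n => out ij.1 ij.2).
  move=> [i j] [i' j']/= oE.
  (* The product of these two matrix units is 1 at (i, j) and 0 elsewhere, which separates the
     output (i, j) from all others. *)
  have := hout (delta_mx i i) (delta_mx i j) i j.
  rewrite oE hout mul_delta_mx !mxE !eqxx/=.
  case: (i' =P i) => [->|_]; last by move/eqP; rewrite eq_sym oner_eq0.
  by case: (j' =P j) => [->//|_] /eqP; rewrite eq_sym oner_eq0.
have bnd ij : (out ij.1 ij.2 - 2 * (n * n) < size P)%N.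
  by have := rng ij.1 ij.2; lia.
have injf : injective (fun ij : 'I_n * 'I_n => Ordinal (bnd ij)).
  move=> x y /(congr1 val)/= h; apply: inj => /=.
  by have := rng x.1 x.2; have := rng y.1 y.2; lia.
by have := leq_card _ injf; rewrite card_prod !card_ord.
Qed.

Lemma omega_ge2 : 2 <= omega R.
Proof.
apply: lb_le_inf.
  exists 3, 3 => n n0; have [P hP sP] := slp_mulmx_naive n; exists P => //.
  rewrite sP -[X in _ `^ X]/(3%:R) powR_mulrn// -natrX -natrM ler_nat.
  by rewrite !expnS expn0; nia.
move=> tau [c hc]; rewrite leNgt; apply/negP => t2.
pose s := 2 - tau; have s0 : 0 < s by rewrite subr_gt0.
have H (n : nat) : (0 < n)%N -> n%:R `^ s <= c.
  move=> n0; have [P /slp_mulmx_size hP hs] := hc n n0.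
  have N0 : 0 < n%:R :> R by rewrite ltr0n.
  rewrite -(ler_pM2r (powR_gt0 tau N0)) -powRD; last by apply/implyP => _; rewrite gt_eqF.
  rewrite subrK -[X in _ `^ X]/(2%:R) powR_mulrn//; apply: le_trans hs.
  by rewrite -natrX ler_nat.
have c0 : 0 < c by have := H 1%N isT; rewrite powR1; apply: lt_le_trans.
pose n := (Num.truncn (c `^ s^-1)).+1.
have := H n isT; rewrite leNgt => /negP; apply.
have -> : c = (c `^ s^-1) `^ s by rewrite -powRrM mulVf ?gt_eqF// powRr1// ltW.
by rewrite gt0_ltr_powR// ?nnegrE ?powR_ge0// truncnS_gt.
Qed.

Lemma sampling_time_le (CT : R) (T : nat -> nat -> nat) (m : nat) : 0 < CT ->
  sampling_time CT T -> (0 < m)%N ->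
  (T m m.+1)%:R <= CT * (2 `^ (1 + omega R) + 4) * m%:R `^ (1 + omega R).
Proof.
move=> CT0 hT m0; apply: le_trans (st_le hT m0 (ltn0Sn m)) _.
have M1 : 1 <= m%:R :> R by rewrite ler1n.
have w2 := omega_ge2; have w0 : 0 <= 1 + omega R by lra.
rewrite -mulrA ler_pM2l// mulrDl; apply: lerD.
  rewrite -powRM// ge0_ler_powR ?nnegrE ?mulr_ge0//.
  by rewrite -natr1; lra.
(* The second term of [st_le] is cubic in m; [omega_ge2] places it below the first. *)
apply: (@le_trans _ _ (4 * m%:R `^ 3)).
  by rewrite powR_mulrn// -natr1; nra.
by rewrite ler_pM2l// ler_powR//; lra.
Qed.

End MatrixMultiplicationExponent.

(** * One draw of the sampler *)

Section Tails.
Context d (S : measurableType d) (R : realType) (P : probability S R).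

(** Markov's inequality in the form consumed by [good]: a measurable set of answers together with
    its probability. *)
Lemma markov_set (F : S -> R) (a b : R) : (forall x, 0 <= F x) ->
  measurable_fun setT F -> 0 < a -> (\int[P]_x (F x)%:E <= b%:E)%E ->
  exists G, [/\ measurable G, ((1 - b / a)%:E <= P G)%E & forall x, G x -> F x <= a].
Proof.
move=> F0 mF a0 Fb.
have mE : measurable_fun setT (EFin \o F) by exact/measurable_EFinP.
set H := [set x | (a%:E <= `|(EFin \o F) x|)%E].
have mH : measurable H.
  rewrite -[H]setTI; apply: emeasurable_fun_c_infty => //.
  exact: measurableT_comp.
exists (~` H); split; first exact: measurableC.
- have := @le_integral_comp_abse _ _ _ P _ measurableT (EFin \o F) a id
     (@measurable_id _ _ setT) (fun r r0 => r0) (fun x y _ _ xy => xy) mE a0.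
  rewrite setTI -/H => h.
  have h2 : (a%:E * P H <= b%:E)%E.
    apply: le_trans h _; apply: le_trans Fb; rewrite le_eqVlt; apply/orP; left.
    by apply/eqP; apply: eq_integral => x _ /=; rewrite ger0_norm.
  have PH : P H \is a fin_num by exact: fin_num_measure.
  rewrite probability_setC//.
  move: h2; rewrite -(fineK PH) -EFinM lee_fin -EFinB lee_fin => h2.
  by rewrite lerD2l lerN2 ler_pdivlMr// mulrC.
- by move=> x; rewrite /H/= lee_fin ger0_norm// => /negP; rewrite -ltNge => /ltW.
Qed.

Lemma ae_good (Q : S -> Prop) : {ae P, forall x, Q x} ->
  exists G, [/\ measurable G, P G = 1%E & forall x, G x -> Q x].
Proof.
move=> [N [mN PN QN]]; exists (~` N); split; first exact: measurableC.
  by rewrite probability_setC// PN sube0.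
by move=> x nx; apply: contrapT => nq; apply: nx; apply: QN.
Qed.

Lemma probability_setI_full (G H : set S) : measurable G -> measurable H ->
  P G = 1%E -> P (H `&` G) = P H.
Proof.
move=> mG mH PG.
have h : P (H `\` G) = 0%E.
  apply/eqP; rewrite eq_le measure_ge0 andbT.
  have <- : P (~` G) = 0%E by rewrite probability_setC// PG subee.
  apply: le_measure; rewrite ?inE; [exact: measurableD|exact: measurableC|].
  by move=> x [].
have mI : measurable (H `&` G) := measurableI _ _ mH mG.
have mD : measurable (H `\` G) := measurableD mH mG.
have dis : (H `&` G) `&` (H `\` G) = set0 by rewrite setDE setIACA setICr setI0.
have := measureU P mI mD dis; rewrite (setUIDK H G) => ->.
by rewrite -[LHS]adde0 -[in LHS]h.
Qed.

(** A strict bound avoids the question whether the infimum is attained; it costs the factor 2 in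
    front of [C3] in [moment_draw]. *)
Lemma psi2_witness (Y : S -> R) (s : R) : 0 < s -> (psi2 P Y < s%:E)%E ->
  exists s', [/\ 0 < s', s' <= s & ('E_P[fun w => expR (Y w ^+ 2 / s' ^+ 2)] <= 2%:E)%E].
Proof.
move=> s0; rewrite /psi2 => /ereal_inf_lt[_ [s' [s'0 h] <-]]; rewrite lte_fin => /ltW ss.
by exists s'.
Qed.

End Tails.

Lemma powR_abs_le_expR (R : realType) (y s q : R) : 0 < q -> 0 < s ->
  `|y| `^ q <= s `^ q * Num.sqrt q `^ q * expR (y ^+ 2 / s ^+ 2).
Proof.
move=> q0 s0; set z := y ^+ 2 / s ^+ 2.
have z0 : 0 <= z by rewrite divr_ge0 ?sqr_ge0.
have yE : `|y| = s * Num.sqrt z.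
  rewrite /z -expr_div_n sqrtr_sqr normrM normfV (ger0_norm (ltW s0)).
  by rewrite mulrC divfK// gt_eqF.
rewrite yE powRM ?sqrtr_ge0 ?(ltW s0)// -mulrA ler_wpM2l ?powR_ge0//.
rewrite -!powR12_sqrt ?(ltW q0)// -!powRrM.
have q20 : 0 < 2^-1 * q by rewrite mulr_gt0.
apply: le_trans (powR_le_expR z0 q20) _; rewrite ler_wpM2r ?expR_ge0//.
by rewrite ge0_ler_powR ?nnegrE ?(ltW q20) ?(ltW q0)//; lra.
Qed.

Section Draw.
Variable R : realType.

Lemma measurable_dot a (theta x0 : 'rV[R]_a) :
  measurable_fun setT (fun x : a.-tuple R => (theta *m (row_of x - x0)^T) 0 0).
Proof.
rewrite (_ : (fun x : a.-tuple R => _) =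
    (fun x : a.-tuple R => \sum_j theta 0 j * (tnth x j - x0 0 j))); last first.
  by apply/funext => x; rewrite !mxE; apply: eq_bigr => j _; rewrite !mxE.
apply: measurable_sum => j; apply: measurable_funM => //.
by apply: measurable_funB => //; exact: measurable_tnth.
Qed.

(** The r-th power of the norm is dominated by the sum [F] of the exponentials that the psi2 norms
    control. Markov's inequality at level (t B)^r fails with probability 2 / t^r, hence at most 2 /
    t^2 uniformly in r >= 2. *)
Lemma moment_draw (m a : nat) (W : 'M[R]_(m, a)) (x0 : 'rV[R]_a) (r C3 t : R)
    (P : probability (a.-tuple R) R) :
  2 <= r -> 0 < C3 -> 1 <= t -> (0 < a)%N ->
  (forall s, lpnorm r%:E (col s W)^T <= 2) ->
  (forall theta : 'rV[R]_a,
     (psi2 P (fun x => (theta *m (row_of x - x0)^T) 0 0)%R <= (C3 * norm2 theta)%:E)%E) ->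
  exists G, [/\ measurable G, ((1 - 2 / t ^+ 2)%:E <= P G)%E &
    forall x, G x -> lpnorm r%:E (W *m (row_of x - x0)^T)^T <=
      4 * C3 * t * Num.sqrt (r * a%:R)].
Proof.
move=> r2 C30 t1 a0 colW sub; have r0 : 0 < r by rewrite (lt_le_trans _ r2).
have p2 : (2%:E <= r%:E)%E by rewrite lee_fin.
have A0 : 0 < a%:R :> R by rewrite ltr0n.
pose Y i (x : a.-tuple R) := (row i W *m (row_of x - x0)^T) 0 0.
have /choice[s hs] : forall i, exists s : R, [/\ 0 <= s, s <= 2 * C3 * norm2 (row i W),
    (forall x, `|Y i x| `^ r <= s `^ r * Num.sqrt r `^ r * expR (Y i x ^+ 2 / s ^+ 2)) &
    (\int[P]_x (expR (Y i x ^+ 2 / s ^+ 2))%:E <= 2%:E)%E].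
  (* A zero row admits no positive s below the bound; s = 0 serves, because division by 0 yields 0
     and the exponential is constantly 1. *)
  move=> i; have [N0|Nn] := eqVneq (norm2 (row i W)) 0.
    exists 0; rewrite N0 mulr0; split=> // [x|].
      rewrite /Y (norm2_eq0 N0) mul0mx mxE normr0 powR0 ?gt_eqF// !mul0r.
    under eq_integral do rewrite expr0n/= invr0 mulr0 expR0.
    rewrite integral_cst// mul1e; apply: le_trans (probability_le1 P measurableT) _.
    by rewrite lee_fin ler1n.
  have Np : 0 < norm2 (row i W) by rewrite lt_neqAle eq_sym Nn norm2_ge0.
  have sp : 0 < 2 * C3 * norm2 (row i W) by rewrite !mulr_gt0.
  have [|s' [s'0 s'le h]] := @psi2_witness _ _ _ P (Y i) _ sp.
    apply: le_lt_trans (sub _) _; rewrite lte_fin ltr_pM2r//; lra.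
  exists s'; split=> //; first exact: ltW.
    by move=> x; exact: powR_abs_le_expR.
  by move: h; rewrite unlock.
pose F x := \sum_i s i `^ r * Num.sqrt r `^ r * expR (Y i x ^+ 2 / s i ^+ 2).
have mexp i : measurable_fun setT (fun x => expR (Y i x ^+ 2 / s i ^+ 2)).
  apply: measurableT_comp => //; apply: measurable_funM => //.
  by apply: measurable_funX; exact: measurable_dot.
have F0 x : 0 <= F x.
  by apply: sumr_ge0 => i _; rewrite !mulr_ge0 ?powR_ge0 ?expR_ge0.
have mF : measurable_fun setT F.
  by apply: measurable_sum => i; apply: measurable_funM.
pose B := 4 * C3 * Num.sqrt (r * a%:R).
have B0 : 0 < B by rewrite !mulr_gt0// sqrtr_gt0 mulr_gt0.
have FB : (\int[P]_x (F x)%:E <= (2 * B `^ r)%:E)%E.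
  under eq_integral do rewrite /F -sumEFin.
  rewrite ge0_integral_sum//; last 2 first.
  - by move=> i; apply/measurable_EFinP; apply: measurable_funM.
  - by move=> i x _; rewrite lee_fin !mulr_ge0 ?powR_ge0 ?expR_ge0.
  apply: (@le_trans _ _ (\sum_(i < m) (s i `^ r * Num.sqrt r `^ r * 2)%:E)%E).
    apply: lee_sum => i _; under eq_integral do rewrite EFinM.
    have mE : measurable_fun setT (fun x => (expR (Y i x ^+ 2 / s i ^+ 2))%:E).
      exact/measurable_EFinP.
    have c0 : (0 <= (s i `^ r * Num.sqrt r `^ r)%:E)%E by rewrite lee_fin mulr_ge0 ?powR_ge0.
    rewrite (ge0_integralZl _ measurableT mE _ c0)//.
    by rewrite [leRHS]EFinM; apply: lee_wpmul2l => //; have [_ _ _] := hs i.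
  rewrite sumEFin lee_fin -mulr_suml mulrC ler_pM2l// -mulr_suml.
  apply: (@le_trans _ _ (\sum_(i < m) (2 * C3) `^ r * norm2 (row i W) `^ r * Num.sqrt r `^ r)).
    rewrite mulr_suml; apply: ler_sum => i _; rewrite ler_wpM2r ?powR_ge0//.
    rewrite -powRM ?norm2_ge0 ?mulr_ge0 ?(ltW C30)//.
    have [s0 sle _ _] := hs i.
    by rewrite ge0_ler_powR ?nnegrE ?(ltW r0) ?mulr_ge0 ?norm2_ge0 ?(ltW C30).
  rewrite -mulr_suml -big_distrr/=.
  have c2 : 0 <= 2 * Num.sqrt a%:R :> R by rewrite mulr_ge0 ?sqrtr_ge0.
  have c3 : 0 <= 2 * C3 by rewrite mulr_ge0 ?(ltW C30).
  have -> : B = 2 * C3 * (2 * Num.sqrt a%:R) * Num.sqrt r.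
    by rewrite /B sqrtrM ?(ltW r0)//; ring.
  rewrite (powRM _ (mulr_ge0 c3 c2) (sqrtr_ge0 _)) (powRM _ c3 c2).
  rewrite ler_wpM2r ?powR_ge0// ler_wpM2l ?powR_ge0//.
  have /(lpnorm_leE _ p2 c2) := lpnorm_row_norms p2 (ler0n _ 2) colW.
  apply: le_trans; apply: ler_sum => i _.
  by rewrite mxE ger0_norm ?norm2_ge0.
have t0 : 0 < t by rewrite (lt_le_trans _ t1).
have tB0 : 0 < t * B by rewrite mulr_gt0.
have [G [mG PG hG]] := markov_set F0 mF (powR_gt0 r tB0) FB.
exists G; split=> //.
- apply: le_trans PG; rewrite lee_fin lerD2l lerN2.
  rewrite (powRM _ (ltW t0) (ltW B0)) invfM mulrA mulrAC -[2 * _ / _]mulrA.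
  rewrite divff ?gt_eqF ?powR_gt0// mulr1 ler_pM2l// lef_pV2 ?posrE ?powR_gt0 ?exprn_gt0//.
  by rewrite -powR_mulrn ?(ltW t0)// ler_powR.
- move=> x Gx; have -> : 4 * C3 * t * Num.sqrt (r * a%:R) = t * B by rewrite /B; ring.
  apply/(lpnorm_leE _ p2 (ltW tB0)); apply: le_trans (hG x Gx).
  apply: ler_sum => i _; have [_ _ hx _] := hs i.
  rewrite mxE (_ : (W *m _) i 0 = Y i x); first exact: hx.
  by rewrite /Y !mxE; apply: eq_bigr => j _; rewrite !mxE.
Qed.

(** The first summand serves the logarithm, with [Delta]^2 = c log(2m / a) and c the inner product
    with C1^-1; the second is the constant of [moment_draw]. *)
Definition draw_cst (C1 C2 C3 : R) : R :=
  2 * Num.sqrt (4 * (C1^-1 * (1 + 2 * ln (1 + C2^-1)))) + 4 * C3.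

Lemma draw_cst_ge0 C1 C2 C3 : 0 < C3 -> 0 <= draw_cst C1 C2 C3.
Proof. by move=> h; rewrite addr_ge0 ?mulr_ge0 ?sqrtr_ge0 ?(ltW h). Qed.

(* For min = log(2m/k), rows normalised in the Euclidean norm admit a common [Delta]; for
   min = p, Markov's inequality for the p-th moments of the subgaussian coordinates. *)
Lemma good_draw (C1 C2 C3 : R) (D : sampler R) : 0 < C1 -> 0 < C2 -> 0 < C3 ->
  lovett_meka C1 C2 C3 D ->
  forall (m k a : nat) (p : \bar R) (W A : 'M[R]_(m, a)) (x0 : 'rV[R]_a) (t : R),
  (0 < m)%N -> (0 < k)%N -> (2%:E <= p)%E -> (a <= m)%N -> 1 <= t ->
  (forall s, lpnorm p (col s W)^T <= 2) ->
  (forall i s, A i s = W i s / norm2 (row i W)) -> in_cube x0 ->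
  exists G, [/\ measurable G, ((1 - 2 / t ^+ 2)%:E <= D m a A x0 G)%E &
    forall x, G x -> [/\ in_cube (row_of x),
      (a <= 2 * #|[pred j : 'I_a | `|tnth x j|%R == 1%R]|)%N &
      lpnorm p (W *m (row_of x - x0)^T)^T <=
        draw_cst C1 C2 C3 * t * Num.sqrt (k%:R * minpl m k p * gain (a%:R / k%:R))]].
Proof.
move=> C10 C20 C30 LM m k a p W A x0 t m0 k0 p2 am t1 colW AW x01.
have t0 : 0 < t by rewrite (lt_le_trans _ t1).
have K0 : 0 < k%:R :> R by rewrite ltr0n.
have [G1 [mG1 PG1 hG1]] := ae_good (lm_cube LM A x01).
have [G2 [mG2 PG2 hG2]] := ae_good (lm_frozen LM A x01).
have combine (G : set (a.-tuple R)) : measurable G ->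
    ((1 - 2 / t ^+ 2)%:E <= D m a A x0 G)%E ->
    (forall x, G x -> lpnorm p (W *m (row_of x - x0)^T)^T <=
        draw_cst C1 C2 C3 * t * Num.sqrt (k%:R * minpl m k p * gain (a%:R / k%:R))) ->
    exists G, [/\ measurable G, ((1 - 2 / t ^+ 2)%:E <= D m a A x0 G)%E &
    forall x, G x -> [/\ in_cube (row_of x),
      (a <= 2 * #|[pred j : 'I_a | `|tnth x j|%R == 1%R]|)%N &
      lpnorm p (W *m (row_of x - x0)^T)^T <=
        draw_cst C1 C2 C3 * t * Num.sqrt (k%:R * minpl m k p * gain (a%:R / k%:R))]].
  move=> mG PG hG; have mGG1 := measurableI _ _ mG mG1.
  exists (G `&` G1 `&` G2); split.
  - exact: measurableI.
  - by rewrite (probability_setI_full mG2 mGG1 PG2) (probability_setI_full mG1 mG PG1).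
  - by move=> x [[Gx G1x] G2x]; split; [exact: hG1|exact: hG2|exact: hG].
have full (G : set (a.-tuple R)) : D m a A x0 G = 1%E -> ((1 - 2 / t ^+ 2)%:E <= D m a A x0 G)%E.
  by move=> ->; rewrite lee_fin gerBl divr_ge0 ?exprn_ge0 ?(ltW t0).
have u0 : 0 <= a%:R / k%:R :> R by rewrite divr_ge0.
have M0 : 0 <= minpl m k p by apply: le_trans (minpl_ge m0 k0 p2); lra.
have kM0 : 0 <= k%:R * minpl m k p by rewrite mulr_ge0.
have g0 : 0 <= k%:R * minpl m k p * gain (a%:R / k%:R) by rewrite mulr_ge0 ?gain_ge0.
(* Empty draws do occur: the number of rounds is fixed, and all pairs may be coloured early. *)
have [aE|a0] := posnP a.
  apply: (combine setT) => // [|x _]; first by apply: full; exact: probability_setT.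
  have -> : (W *m (row_of x - x0)^T)^T = 0.
    apply/rowP => i; rewrite !mxE big1// => j _.
    by have := ltn_ord j; rewrite {2}aE ltn0.
  by rewrite lpnorm0// !mulr_ge0 ?draw_cst_ge0 ?(ltW t0) ?sqrtr_ge0.
have A0 : 0 < a%:R :> R by rewrite ltr0n.
have [[r [pE ME]]|ME] := minpl_cases m k p2.
  rewrite pE in colW p2; rewrite lee_fin in p2.
  have [G [mG PG hG]] := moment_draw p2 C30 t1 a0 colW (lm_subgaussian LM A x01).
  apply: (combine G) => // x Gx; rewrite pE; apply: le_trans (hG x Gx) _.
  rewrite -pE ME; rewrite ME in kM0 g0.
  apply: ler_pM; rewrite ?sqrtr_ge0 ?mulr_ge0 ?(ltW C30) ?(ltW t0)//.
    by rewrite ler_pM2r// lerDr mulr_ge0 ?sqrtr_ge0.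
  have r0 : 0 <= r by rewrite (le_trans _ p2).
  apply: ler_wsqrtr; rewrite [k%:R * r]mulrC -mulrA ler_wpM2l// /gain mulrDr.
  by rewrite [k%:R * (_ / _)]mulrC divfK ?gt_eqF// lerDl mulr_ge0 ?sqrtr_ge0.
pose L := ln (2 * m%:R / a%:R) : R.
have M00 : 0 < m%:R :> R by rewrite ltr0n.
have aM : a%:R <= m%:R :> R by rewrite ler_nat.
have l2 : 2^-1 <= L.
  apply: le_trans (ln2_ge R) _; rewrite ler_ln ?posrE ?divr_gt0 ?mulr_gt0//.
  by rewrite ler_pdivlMr// ler_pM2l.
(* With L = log(2m / a) the summands are exp(-L) exp(-2 L ln(1 + 1/C2)). The first factor is a /
   (2m) and cancels the number m of rows; since 2 L >= 1, the second is at most 1 / (1 + 1/C2) <=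
   C2. *)
set c := C1^-1 * (1 + 2 * ln (1 + C2^-1)).
have lC2 : 0 < ln (1 + C2^-1) by rewrite ln_gt0// ltrDl invr_gt0.
have c0 : 0 < c by rewrite mulr_gt0 ?invr_gt0// addr_gt0// mulr_gt0.
pose Delta := Num.sqrt (c * L).
have D0 : 0 <= Delta by exact: sqrtr_ge0.
have D2 : Delta ^+ 2 = c * L by rewrite sqr_sqrtr// mulr_ge0 ?(ltW c0)//; lra.
have adm : admissible C1 C2 A Delta.
  split=> //.
  have expo i : row i A != 0 -> - C1 * Delta ^+ 2 / norm2 (row i A) ^+ 2 = - (C1 * c * L).
    move=> Ai; suff -> : norm2 (row i A) ^+ 2 = 1 by rewrite D2 divr1; ring.
    have -> : row i A = (norm2 (row i W))^-1 *: row i W.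
      by apply/rowP => s; rewrite !mxE AW mulrC.
    rewrite norm2Z ger0_norm ?invr_ge0 ?norm2_ge0// mulVf ?expr1n//.
    apply: contra Ai => /eqP N0; apply/eqP/rowP => s.
    by rewrite !mxE AW N0 invr0 mulr0.
  rewrite (eq_bigr (fun=> expR (- (C1 * c * L)))) => [|i Ai]; last by rewrite expo.
  apply: (@le_trans _ _ (\sum_(i < m) expR (- (C1 * c * L)))).
    rewrite [leRHS](bigID (fun i => row i A != 0))/= lerDl.
    by apply: sumr_ge0 => i _; exact: expR_ge0.
  rewrite sumr_const card_ord -[leLHS]mulr_natl.
  have cE : C1 * c * L = L + 2 * L * ln (1 + C2^-1).
    by rewrite /c mulrA divff ?gt_eqF// mul1r; ring.
  rewrite cE opprD expRD expRN lnK ?posrE ?divr_gt0 ?mulr_gt0// mulrA.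
  have e1 : expR (- (2 * L * ln (1 + C2^-1))) <= C2.
    apply: (@le_trans _ _ (expR (- ln (1 + C2^-1)))).
      rewrite ler_expR lerN2; have : 1 <= 2 * L by lra.
      by move=> h; rewrite ler_peMl// ltW.
    rewrite expRN lnK ?posrE ?addr_gt0 ?invr_gt0//.
    by rewrite -[leRHS]invrK lef_pV2 ?posrE ?addr_gt0 ?invr_gt0// lerDr.
  have -> : m%:R * (2 * m%:R / a%:R)^-1 = a%:R / 2 :> R by field; rewrite !gt_eqF.
  rewrite mulrC; apply: ler_pM; rewrite ?expR_ge0 ?divr_ge0//.
  rewrite ler_pdivrMr//; lra.
have [G [mG PG hG]] := ae_good (lm_disc LM x01 adm).
apply: (combine G) => // [|x Gx]; first exact: full.
apply: (@le_trans _ _ (Delta * (2 * Num.sqrt a%:R))).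
  apply: (le_trans _ (ler_wpM2l D0 (lpnorm_row_norms p2 (ler0n _ 2) colW))).
  rewrite -(ger0_norm D0) -lpnormZ//; apply: ler_lpnorm => // i.
  rewrite !mxE; have N0 := norm2_ge0 (row i W).
  rewrite [leRHS]ger0_norm ?mulr_ge0//.
  have := hG x Gx i; rewrite mxE => h.
  have -> : \sum_j W i j * (row_of x - x0)^T j 0 =
      norm2 (row i W) * \sum_j A i j * (row_of x - x0)^T j 0.
    rewrite big_distrr/=; apply: eq_bigr => j _; rewrite AW.
    have [N00|Nn] := eqVneq (norm2 (row i W)) 0; last by field.
    have : W i j = row i W 0 j by rewrite mxE.
    by rewrite (norm2_eq0 N00) [in RHS]mxE => ->; rewrite !mul0r mulr0.
  by rewrite normrM (ger0_norm N0) mulrC ler_wpM2r.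
have step : Delta * (2 * Num.sqrt a%:R) <= 2 * Num.sqrt (4 * c) *
    Num.sqrt (k%:R * minpl m k p * gain (a%:R / k%:R)).
  have cL0 : 0 <= c * L by rewrite mulr_ge0 ?(ltW c0)//; lra.
  have c40 : 0 <= 4 * c by rewrite mulr_ge0 ?(ltW c0).
  rewrite mulrCA -mulrA ler_pM2l// /Delta -(sqrtrM _ cL0) -(sqrtrM _ c40).
  apply: ler_wsqrtr.
  have := mul_log_ratio_le R m0 k0 a0; rewrite (maxn_idPl am) -/L ME => h.
  have := ler_wpM2l (ltW c0) h; lra.
apply: le_trans step _; rewrite ler_wpM2r ?sqrtr_ge0//.
apply: (@le_trans _ _ (draw_cst C1 C2 C3 * 1)).
  by rewrite mulr1 lerDl mulr_ge0 ?(ltW C30).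
by rewrite ler_wpM2l ?draw_cst_ge0.
Qed.

End Draw.

(** * Executions *)

Section RunLogic.
Variable R : realType.
Implicit Types (r : run R) (s : state R) (D : sampler R).

Import HBNNSimple.

(** [f] may fail to be measurable: the integral is a supremum over the simple functions below [f],
    and q times the indicator of [G] is one of them. *)
Lemma le_integral_set d (S : measurableType d) (P : probability S R)
    (f : S -> \bar R) (G : set S) (q : R) :
  measurable G -> (forall x, 0 <= f x)%E -> 0 <= q ->
  (forall x, G x -> q%:E <= f x)%E -> (q%:E * P G <= \int[P]_x f x)%E.
Proof.
move=> mG f0 q0 hq; rewrite ge0_integralTE//.
pose h := scale_nnsfun (indic_nnsfun R mG) q0.
have hE : h = (cst q \* \1_G)%R :> (S -> R) by apply/funext.
apply: ereal_sup_ubound; exists h.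
  move=> x; rewrite hE /= indicE.
  case: (asboolP (G x)) => Gx; first by rewrite (mem_set Gx) mulr1 hq.
  by rewrite (memNset Gx) mulr0.
rewrite hE -(sintegral_indic P).
exact: (sintegralrM P q (indic_nnsfun R mG)).
Qed.

Definition halts (Q : state R -> Prop) r : Prop :=
  if r is Halt s then Q s else False.

(* Success up to failure probability [e]: every draw may leave a measurable set of good
   answers, at the expense of its probability. Unlike [prob], this composes. *)
Fixpoint good D (Q : state R -> Prop) (e : R) r : Prop :=
  match r with
  | Halt s => Q s
  | Draw m n A x0 K => exists (e1 e2 : R) (G : set (n.-tuple R)),
      [/\ measurable G, ((1 - e1)%:E <= D m n A x0 G)%E, 0 <= e1, 0 <= e2 & e1 + e2 <= e] /\
      forall x, G x -> good D Q e2 (K x)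
  end.

Lemma prob_ge0 D Q r : (0 <= prob D Q r)%E.
Proof.
elim: r => [s|m n A x0 K IH] /=; first by rewrite lee_fin.
exact: integral_ge0.
Qed.

Lemma good_prob D Q e r : 0 <= e -> good D Q e r -> ((1 - e)%:E <= prob D Q r)%E.
Proof.
elim: r e => [s|m n A x0 K IH] e e0 /=.
  by move=> Qs; rewrite asboolT// lee_fin gerBl.
move=> [e1 [e2 [G [[mG PG e10 e20 he] hG]]]].
(* For e2 >= 1 the claim is trivial, while the factor 1 - e2 would have the wrong sign. *)
have [e2b|e2b] := leP 1 e2.
  apply: (@le_trans _ _ 0%E); first by rewrite lee_fin; lra.
  by apply: integral_ge0 => x _; exact: prob_ge0.
have q0 : 0 <= 1 - e2 by lra.
have := @le_integral_set _ _ (D m n A x0) (fun x => prob D Q (K x)) G _ mG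
  (fun x => prob_ge0 D Q (K x)) q0 (fun x Gx => IH x e2 e20 (hG x Gx)).
apply: le_trans; apply: (@le_trans _ _ ((1 - e2)%:E * (1 - e1)%:E)%E); last first.
  by apply: lee_wpmul2l => //; rewrite lee_fin.
by rewrite -EFinM lee_fin; nra.
Qed.

Lemma good_weaken D (Q Q' : state R -> Prop) e e' r : 0 <= e -> e <= e' ->
  (forall s, Q s -> Q' s) -> good D Q e r -> good D Q' e' r.
Proof.
move=> e0 ee QQ; elim: r e e' e0 ee => [s|m n A x0 K IH] e e' e0 ee /=; first exact: QQ.
move=> [e1 [e2 [G [[mG PG e10 e20 he] hG]]]].
exists e1, e2, G; split; first by split=> //; exact: le_trans ee.
by move=> x Gx; apply: (IH x e2) => //; exact: hG.
Qed.

Lemma good_bind D (Q Q' : state R -> Prop) e e' r f : 0 <= e -> 0 <= e' ->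
  good D Q e r -> (forall s, Q s -> good D Q' e' (f s)) ->
  good D Q' (e + e') (bind r f).
Proof.
move=> e0 e'0 hr hf; elim: r e e0 hr => [s|m n A x0 K IH] e e0 /=.
  by move=> Qs; apply: (@good_weaken D Q' Q' e') (hf s Qs) => //; rewrite lerDr.
move=> [e1 [e2 [G [[mG PG e10 e20 he] hG]]]].
exists e1, (e2 + e'), G; split; first by split=> //; [exact: addr_ge0|lra].
by move=> x Gx; apply: IH => //; exact: hG.
Qed.

Lemma always_bind (Q Q' : state R -> Prop) r f :
  always Q r -> (forall s, Q s -> always Q' (f s)) -> always Q' (bind r f).
Proof.
move=> hr hf; elim: r hr => [s|m n A x0 K IH] /=; first exact: hf.
by move=> h x hx; apply: IH; exact: h.
Qed.

Lemma always_weaken (Q Q' : state R -> Prop) r : (forall s, Q s -> Q' s) ->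
  always Q r -> always Q' r.
Proof.
move=> QQ; elim: r => [s|m n A x0 K IH] /=; first exact: QQ.
by move=> h x hx; apply: IH; exact: h.
Qed.

Lemma halts_weaken (Q Q' : state R -> Prop) r : (forall s, Q s -> Q' s) ->
  halts Q r -> halts Q' r.
Proof. by move=> QQ; case: r => //= s; exact: QQ. Qed.

Lemma halts_always (Q : state R -> Prop) r : halts Q r -> always Q r.
Proof. by case: r. Qed.

Lemma halts_good D (Q : state R -> Prop) r : halts Q r -> good D Q 0 r.
Proof. by case: r. Qed.

Lemma halts_bind (Q Q' : state R -> Prop) r f :
  halts Q r -> (forall s, Q s -> halts Q' (f s)) -> halts Q' (bind r f).
Proof. by case: r => //= s Qs h; exact: h. Qed.

Section Iteration.
Variables (f : state R -> run R) (N : nat) (I : nat -> state R -> Prop) (s0 : state R).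
Hypothesis I0 : I 0 s0.

Lemma halts_iter : (forall i s, (i < N)%N -> I i s -> halts (I i.+1) (f s)) ->
  halts (I N) (iter N (fun r => bind r f) (Halt s0)).
Proof.
move=> h; have H i : (i <= N)%N -> halts (I i) (iter i (fun r => bind r f) (Halt s0)).
  elim: i => [_ //|i IH iN] /=; apply: halts_bind (IH (ltnW iN)) _ => s; exact: h.
exact: H.
Qed.

Lemma always_iter : (forall i s, (i < N)%N -> I i s -> always (I i.+1) (f s)) ->
  always (I N) (iter N (fun r => bind r f) (Halt s0)).
Proof.
move=> h; have H i : (i <= N)%N -> always (I i) (iter i (fun r => bind r f) (Halt s0)).
  elim: i => [_ //|i IH iN] /=; apply: always_bind (IH (ltnW iN)) _ => s; exact: h.
exact: H.
Qed.

Lemma good_iter D (e : nat -> R) : (forall i, 0 <= e i) ->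
  (forall i s, (i < N)%N -> I i s -> good D (I i.+1) (e i) (f s)) ->
  good D (I N) (\sum_(i < N) e i) (iter N (fun r => bind r f) (Halt s0)).
Proof.
move=> e0 h; have H i : (i <= N)%N ->
    good D (I i) (\sum_(j < i) e j) (iter i (fun r => bind r f) (Halt s0)).
  elim: i => [_ //|i IH iN] /=; rewrite big_ord_recr/=.
  apply: good_bind (IH (ltnW iN)) _ => //; first exact: sumr_ge0.
  by move=> s; exact: h.
exact: H.
Qed.

End Iteration.

Lemma updE (V : Type) (f : nat -> V) a v b : upd f a v b = if b == a then v else f b.
Proof. by []. Qed.

Lemma upd_eq (V : Type) (f : nat -> V) a v : upd f a v a = v.
Proof. by rewrite updE eqxx. Qed.

Lemma upd_ne (V : Type) (f : nat -> V) a v b : b <> a -> upd f a v b = f b.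
Proof. by move=> /eqP/negbTE h; rewrite updE h. Qed.

Lemma write_tupleP n (x : n.-tuple R) s a :
  [/\ nmem (write_tuple s a x) = nmem s, clock (write_tuple s a x) = clock s,
      forall j : 'I_n, rmem (write_tuple s a x) (a + j)%N = tnth x j &
      forall b, ((b < a) || (a + n <= b))%N -> rmem (write_tuple s a x) b = rmem s b].
Proof.
rewrite /write_tuple.
have H (l : seq 'I_n) s' : uniq l ->
    let s1 := foldl (fun s' (j : 'I_n) => rset s' (a + j)%N (tnth x j)) s' l in
    [/\ nmem s1 = nmem s', clock s1 = clock s',
      forall j : 'I_n, j \in l -> rmem s1 (a + j)%N = tnth x j &
      forall b, (forall j, j \in l -> b <> (a + j)%N) -> rmem s1 b = rmem s' b].
  elim: l s' => [|j l IH] s' //= /andP[jl ul].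
  have [h1 h2 h3 h4] := IH (rset s' (a + j)%N (tnth x j)) ul.
  split=> //.
    move=> i; rewrite inE => /predU1P[->|il]; last exact: h3.
    rewrite h4 /= ?upd_eq// => j' j'l /addnI/val_inj E.
    by move: jl; rewrite E j'l.
  move=> b hb; rewrite h4 /= ?upd_ne//; first by apply: hb; rewrite inE eqxx.
  by move=> i il; apply: hb; rewrite inE il orbT.
have [h1 h2 h3 h4] := H (enum 'I_n) s (enum_uniq _).
split=> // [j|b hb]; first by apply: h3; rewrite mem_enum.
by apply: h4 => j _ bE; move: hb; rewrite bE; have := ltn_ord j; lia.
Qed.

End RunLogic.

(** * The algorithm *)

Section Program.
Local Open Scope nat_scope.

Local Notation "# c" := (NConst c) (at level 2, format "# c").
Local Notation "$ c" := (NGet (NConst c)) (at level 2, format "$ c").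

(* Memory layout. Naturals: 4 holds 2 ^ l > m and 5 holds l; 6 and 7 are loop counters,
   8 the number a of active pairs, 9 to 11 scratch cells. The multiplicities c_i are at
   20 + i, the two members I_t and J_t of the pair t at 20 + n + t and 20 + 2 n + t.
   Reals: after the input come the colours x_t, an accumulator and the matrix. *)
Definition locC (e : nexp) := NAdd #20 e.
Definition locI (e : nexp) := NAdd (NAdd #20 $1) e.
Definition locJ (e : nexp) := NAdd (NAdd #20 (NAdd $1 $1)) e.
Definition locX (e : nexp) := NAdd (NAdd (NMul $1 $0) (NAdd $1 #1)) e.
Definition locAcc := NAdd (NMul $1 $0) (NAdd (NAdd $1 $1) #1).
Definition locA (e : nexp) := NAdd (NAdd locAcc #1) e.
Definition entry (i j : nexp) := RGet (NAdd (NMul i $0) j).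
Definition incr (c : nat) := CNSet #c (NAdd $c #1).
Definition bump_at (e : nexp) := CNSet e (NAdd (NGet e) #1).

(** A guarded doubling in a bounded loop: it stalls at the least l with m < 2^l, which m iterations
    reach because m < 2^m. *)
Definition pow_loop :=
  CSeq (CNSet #4 #1) (CSeq (CNSet #5 #0) (CRepeat $0
    (CNIfLe $4 $0 (CSeq (CNSet #4 (NAdd $4 $4)) (incr 5)) CSkip))).

Definition trunc_loop :=
  CSeq (CNSet #6 #0) (CRepeat $1
    (CSeq (CFloor (locC $6)
             (RMul (RMul (RNat $2) (RGet (NAdd (NMul $1 $0) $6))) (RNat $4)))
          (incr 6))).

(** The half of c_i is obtained as a floor of reals, and c_i is even iff it does not exceed twice
    this half. Cell 9 says whether an odd index is waiting for its partner. *)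
Definition setup_body :=
  CSeq (CFloor #10 (RDiv (RNat (NGet (locC $6))) (RNat #2)))
  (CSeq (CNIfLe (NGet (locC $6)) (NAdd $10 $10) CSkip
          (CNIfLe $9 #0
            (CSeq (CNSet (locI $8) $6) (CNSet #9 #1))
            (CSeq (CNSet (locJ $8) $6) (CSeq (CRSet (locX $8) (RNat #0))
              (CSeq (incr 8) (CNSet #9 #0))))))
  (CSeq (CNSet (locC $6) $10) (incr 6))).

Definition setup :=
  CSeq (CNSet #8 #0) (CSeq (CNSet #9 #0) (CSeq (CNSet #6 #0) (CRepeat $1 setup_body))).

Definition difference :=
  RSub (entry (NGet (locI $7)) $6) (entry (NGet (locJ $7)) $6).

Definition norm_loop := CRepeat $8
  (CSeq (CRSet locAcc (RAdd (RGet locAcc) (RMul difference difference))) (incr 7)).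

Definition fill_loop := CRepeat $8
  (CSeq (CRSet (locA (NAdd (NMul $6 $8) $7)) (RDiv difference (RSqrt (RGet locAcc))))
        (incr 7)).

Definition row_body :=
  CSeq (CRSet locAcc (RNat #0)) (CSeq (CNSet #7 #0) (CSeq norm_loop
    (CSeq (CNSet #7 #0) (CSeq fill_loop (incr 6))))).

Definition build := CSeq (CNSet #6 #0) (CRepeat $0 row_body).

Definition sample := CSample $0 $8 (locA #0) (locX #0) (locX #0).

(** Works in place: the write index in cell 9 never overtakes the read index in cell 7. Inside the
    cube the two inequalities detect exactly the colours 1 and -1. *)
Definition compaction_body :=
  CSeq (CRIfLe (RNat #1) (RGet (locX $7)) (bump_at (locC (NGet (locI $7))))
         (CRIfLe (RGet (locX $7)) (RSub (RNat #0) (RNat #1))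
           (bump_at (locC (NGet (locJ $7))))
           (CSeq (CNSet (locI $9) (NGet (locI $7)))
             (CSeq (CNSet (locJ $9) (NGet (locJ $7)))
               (CSeq (CRSet (locX $9) (RGet (locX $7))) (incr 9))))))
       (incr 7).

Definition compaction :=
  CSeq (CNSet #9 #0) (CSeq (CNSet #7 #0) (CSeq (CRepeat $8 compaction_body) (CNSet #8 $9))).

Definition round := CSeq build (CSeq sample compaction).
Definition level := CSeq setup (CRepeat $5 round).

Definition final :=
  CSeq (CNSet #11 #0) (CSeq (CNSet #6 #0)
    (CSeq (CRepeat $1 (CSeq (CNSet #11 (NAdd $11 (NGet (locC $6)))) (incr 6)))
      (CSeq (CNSet (locC #0) (NAdd (NGet (locC #0)) (NSub $2 $11)))
        (CNSet #0 #20)))).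

Definition algorithm :=
  CSeq pow_loop (CSeq trunc_loop (CSeq (CRepeat $5 level) final)).

End Program.

(* Only for speed: [lia] spends most of its time on irrelevant hypotheses. *)
Ltac drop_nonarith := repeat match goal with
  | H : forall _, _ |- _ => clear H
  | H : _ /\ _ |- _ => clear H
  | H : @eq ?U _ _ |- _ => lazymatch U with nat => fail | bool => fail | _ => clear H end
  | H : is_true (@Order.le _ _ _ _) |- _ => clear H
  | H : is_true (@Order.lt _ _ _ _) |- _ => clear H
  end.

Ltac upd_simpl :=
  repeat (rewrite upd_eq || (rewrite upd_ne; [|by drop_nonarith; lia])).

(** * Hoare rules and correctness of the pieces of the program *)

Section ExecutionRules.
Variables (R : realType) (T : nat -> nat -> nat).
Implicit Types s : state R.

(** A draw makes [halts] false, so this is a weakest precondition for the code between draws. *)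
Definition wp (Q : state R -> Prop) c s := halts Q (exec T c s).

Lemma exec_seq c1 c2 s (Q : state R -> Prop) :
  wp (wp Q c2) c1 s -> wp Q (CSeq c1 c2) s.
Proof. by move=> h; exact: halts_bind h _. Qed.

Lemma exec_skip s (Q : state R -> Prop) : Q (tick 1 s) -> wp Q CSkip s.
Proof. by []. Qed.

Lemma exec_nset a e s (Q : state R -> Prop) :
  Q (tick (ncost a + ncost e).+1 (nset s (neval s a) (neval s e))) ->
  wp Q (CNSet a e) s.
Proof. by []. Qed.

Lemma exec_rset a e s (Q : state R -> Prop) :
  Q (tick (ncost a + rcost e).+1 (rset s (neval s a) (reval s e))) ->
  wp Q (CRSet a e) s.
Proof. by []. Qed.

Lemma exec_floor a e s (Q : state R -> Prop) :
  Q (tick (ncost a + rcost e).+1 (nset s (neval s a) (Num.truncn (reval s e)))) ->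
  wp Q (CFloor a e) s.
Proof. by []. Qed.

Lemma exec_nif a b c1 c2 s (Q : state R -> Prop) :
  ((neval s a <= neval s b)%N ->
     wp Q c1 (tick (ncost a + ncost b).+1 s)) ->
  ((neval s b < neval s a)%N ->
     wp Q c2 (tick (ncost a + ncost b).+1 s)) ->
  wp Q (CNIfLe a b c1 c2) s.
Proof. by move=> h1 h2; rewrite /wp /=; case: leqP. Qed.

Lemma exec_rif a b c1 c2 s (Q : state R -> Prop) :
  (reval s a <= reval s b -> wp Q c1 (tick (rcost a + rcost b).+1 s)) ->
  (reval s b < reval s a -> wp Q c2 (tick (rcost a + rcost b).+1 s)) ->
  wp Q (CRIfLe a b c1 c2) s.
Proof. by move=> h1 h2; rewrite /wp /=; case: leP. Qed.

Lemma exec_repeat e c s (Q : state R -> Prop) (I : nat -> state R -> Prop) :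
  I 0%N (tick (ncost e).+1 s) ->
  (forall i s', (i < neval s e)%N -> I i s' -> wp (I i.+1) c (tick 1 s')) ->
  (forall s', I (neval s e) s' -> Q s') -> wp Q (CRepeat e c) s.
Proof.
move=> h0 h hQ; apply: halts_weaken hQ _; rewrite /=.
exact: (halts_iter h0 h).
Qed.

End ExecutionRules.

Arguments wp : simpl never.

Section Execution.
Variables (R : realType) (T : nat -> nat -> nat) (m n k : nat) (inp : nat -> R).
Implicit Types s : state R.

Record header l s : Prop := Header {
  hd_m : nmem s 0 = m; hd_n : nmem s 1 = n; hd_k : nmem s 2 = k;
  hd_P : nmem s 4 = (2 ^ l)%N; hd_l : nmem s 5 = l;
  hd_inp : forall j, (j < n * m + n)%N -> rmem s j = inp j
}.

Lemma pow_loopP s : (0 < m)%N -> nmem s 0 = m -> wp T (fun s' => exists l,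
   [/\ nmem s' 4 = (2 ^ l)%N, nmem s' 5 = l, (m < 2 ^ l)%N, (2 ^ l <= 2 * m)%N &
    [/\ forall b, b <> 4%N -> b <> 5%N -> nmem s' b = nmem s b, rmem s' = rmem s &
       (clock s' <= clock s + 20 * m + 20)%N]]) pow_loop s.
Proof.
move=> m0 s0; do 2 (apply: exec_seq; apply: exec_nset => /=).
apply: (exec_repeat (I := fun i s' => exists l,
   [/\ nmem s' 4 = (2 ^ l)%N, nmem s' 5 = l, (m < 2 ^ l)%N \/ l = i, (2 ^ l <= 2 * m)%N &
    [/\ forall b, b <> 4%N -> b <> 5%N -> nmem s' b = nmem s b, rmem s' = rmem s &
       (clock s' <= clock s + 20 * i + 20)%N]])).
- exists 0%N; split=> //=; first by right.
    by rewrite expn0; lia.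
  split=> //=; last by lia.
  by move=> b b4 b5; upd_simpl.
- move=> i [N M c] /= _ [l [h4 h5 hl hm [hN hM hc]]].
  have N0 : N 0%N = m by rewrite hN.
  apply: exec_nif => /=; rewrite h4 N0 => hle; last first.
    apply: exec_skip => /=; exists l; split=> //; first by left.
    by split=> //=; lia.
  apply: exec_seq; do 2 apply: exec_nset => /=.
  exists l.+1; split=> /=; upd_simpl; rewrite ?h4 ?h5 ?addn1//.
  + by rewrite expnS mul2n addnn.
  + by right; case: hl => [|->//]; lia.
  + by rewrite expnS; lia.
  + split=> //; last by lia.
    by move=> b b4 b5; upd_simpl; exact: hN.
- move=> s'; rewrite /= !upd_ne//= s0 => -[l [h4 h5 hl hm h]].
  exists l; split=> //; case: hl => // ->; exact: ltn_expl.
Qed.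

Lemma trunc_loopP l s : header l s -> wp T (fun s' => [/\ header l s',
   forall i, (i < n)%N -> nmem s' (20 + i) =
     Num.truncn (k%:R * inp (n * m + i) * 2 ^+ l) &
   (clock s' <= clock s + 40 * n + 40)%N]) trunc_loop s.
Proof.
move=> hs; apply: exec_seq; apply: exec_nset => /=.
apply: (exec_repeat (I := fun i s' => [/\ header l s', nmem s' 6 = i,
   forall j, (j < i)%N -> nmem s' (20 + j) =
     Num.truncn (k%:R * inp (n * m + j) * 2 ^+ l) &
   (clock s' <= clock s + 40 * i + 10)%N])).
- case: hs => h0 h1 h2 h4 h5 hi; split=> //=; lia.
- move=> i [N M c] /=; rewrite upd_ne//= (hd_n hs) => iN.
  move=> [[/= h0 h1 h2 h4 h5 hi] h6 hC hc].
  apply: exec_seq; apply: exec_floor; apply: exec_nset => /=.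
  rewrite h6 h1 h0 h2 h4 hi; last by lia.
  split=> /=.
  + by split=> //=; upd_simpl.
  + by upd_simpl; rewrite h6 addn1.
  + move=> j; rewrite ltnS leq_eqVlt => /predU1P[->|ji]; upd_simpl; last exact: hC.
    by rewrite natrX.
  + lia.
- move=> s'; rewrite /= upd_ne//= (hd_n hs) => -[h1 h2 h3 h4]; split=> //; lia.
Qed.

End Execution.

Section Setup.
Variables (R : realType) (T : nat -> nat -> nat) (m n k : nat) (inp : nat -> R).
Implicit Types s : state R.

(** A pair of colour x carries one unit, (1 + x) / 2 on its first and (1 - x) / 2 on its second
    member, so that the colours 1 and -1 round up one member and drop the other. *)
Definition pair_val (N : nat -> nat) (M : nat -> R) (f : nat -> R) (t : nat) : R :=
  (1 + M (n * m + (n + 1) + t)%N) / 2 * f (N (20 + n + t)%N) +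
  (1 - M (n * m + (n + 1) + t)%N) / 2 * f (N (20 + (n + n) + t)%N).

(* The current fractional point: the finished coordinates plus the active pairs,
   tested against an arbitrary f. *)
Definition position (N : nat -> nat) (M : nat -> R) (a : nat) (f : nat -> R) : R :=
  \sum_(0 <= i < n) (N (20 + i)%N)%:R * f i + \sum_(0 <= t < a) pair_val N M f t.

Lemma eq_pair_val N M N' M' f t :
  N' (20 + n + t)%N = N (20 + n + t)%N -> N' (20 + (n + n) + t)%N = N (20 + (n + n) + t)%N ->
  M' (n * m + (n + 1) + t)%N = M (n * m + (n + 1) + t)%N ->
  pair_val N' M' f t = pair_val N M f t.
Proof. by rewrite /pair_val => -> -> ->. Qed.

Lemma truncn_half (c : nat) : Num.truncn (c%:R / 2 : R) = c./2.
Proof.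
apply/eqP; rewrite truncn_eq ?divr_ge0// ler_pdivlMr// ltr_pdivrMr//.
rewrite -!natrM ler_nat ltr_nat; apply/andP; split; lia.
Qed.

(** At colour 0 a pair puts 1/2 on either member, hence twice the new position restores the old
    coefficients, except for the unpaired index [o] if [b] holds. *)
Lemma setupP l s : header m n k inp l s -> wp T (fun s' =>
  [/\ header m n k inp l s', (2 * nmem s' 8 <= n)%N,
      forall t, (t < nmem s' 8)%N -> [/\ (nmem s' (20 + n + t) < n)%N,
        (nmem s' (20 + (n + n) + t) < n)%N & rmem s' (n * m + (n + 1) + t)%N = 0],
      exists (b : bool) (o : nat), (b -> (o < n)%N) /\ forall f : nat -> R,
        \sum_(0 <= i < n) (nmem s (20 + i)%N)%:R * f i =
        2 * position (nmem s') (rmem s') (nmem s' 8) f + b%:R * f o &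
      (clock s' <= clock s + 100 * n + 100)%N]) setup s.
Proof.
move=> hs; do 3 (apply: exec_seq; apply: exec_nset => /=).
apply: (exec_repeat (I := fun i s' =>
  [/\ header m n k inp l s', [/\ nmem s' 6 = i, (nmem s' 9 <= 1)%N & (2 * nmem s' 8 + nmem s' 9 <= i)%N],
      (forall j, (i <= j < n)%N -> nmem s' (20 + j) = nmem s (20 + j)) /\
      (nmem s' 9 = 1 -> nmem s' (20 + n + nmem s' 8) < n)%N,
      forall t, (t < nmem s' 8)%N -> [/\ (nmem s' (20 + n + t) < n)%N,
        (nmem s' (20 + (n + n) + t) < n)%N & rmem s' (n * m + (n + 1) + t)%N = 0] &
      (forall f : nat -> R,
        \sum_(0 <= j < i) (nmem s (20 + j)%N)%:R * f j =
        2 * (\sum_(0 <= j < i) (nmem s' (20 + j)%N)%:R * f j +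
        \sum_(0 <= t < nmem s' 8) pair_val (nmem s') (rmem s') f t) +
        (nmem s' 9)%:R * f (nmem s' (20 + n + nmem s' 8)%N)) /\
      (clock s' <= clock s + 100 * i + 100)%N])).
- case: hs => h0 h1 h2 h4 h5 hi; split=> //=.
  by split=> [f|]; [rewrite !big_geq// mul0r !addr0 mulr0|lia].
- move=> i [N M c] /=; rewrite !upd_ne//= (hd_n hs) => iN.
  move=> [[/= h0 h1 h2 h4 h5 hi] [h6 h9 hai] [hC hI] hw [hf hc]].
  have NC : N (20 + i)%N = nmem s (20 + i)%N by apply: hC; rewrite leqnn.
  have in_range b : (b < n * m + n)%N -> b <> (n * m + (n + 1) + N 8%N)%N by lia.
  apply: exec_seq; apply: exec_floor => /=.
  rewrite h6 truncn_half; set c0 := N (20 + i)%N.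
  have sumC N' f : (forall j, (j < i)%N -> N' (20 + j)%N = N (20 + j)%N) ->
      N' (20 + i)%N = c0./2 ->
      \sum_(0 <= j < i.+1) (N' (20 + j)%N)%:R * f j =
      \sum_(0 <= j < i) (N (20 + j)%N)%:R * f j + (c0./2)%:R * f i :> R.
    move=> e1 e2; rewrite big_nat_recr//= e2; congr (_ + _).
    by apply: eq_big_nat => j /andP[_ ji]; rewrite e1.
  have c0E : c0%:R = 2 * (c0./2)%:R + (odd c0)%:R :> R.
    by rewrite -{1}(odd_double_half c0) -mul2n natrD natrM addrC.
  apply: exec_seq; apply: exec_nif => /=; upd_simpl; rewrite ?h6 -/c0 => par.
    have ev : odd c0 = false by lia.
    apply: exec_skip; apply: exec_seq; do 2 apply: exec_nset => /=.
    upd_simpl; rewrite h6; split=> /=; upd_simpl => //.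
    + by split; rewrite ?addn1//; lia.
    + by split=> [j jr|h]; upd_simpl; [apply: hC; lia|exact: hI].
    + move=> t ta; upd_simpl; exact: hw.
    + split; last by lia.
      move=> f; rewrite big_nat_recr//= hf -NC -/c0 sumC; last 2 first.
      - by move=> j ji; upd_simpl.
      - by upd_simpl.
      rewrite [X in _ = 2 * (_ + X) + _](eq_big_nat _ _ (F2 := pair_val N M f)); last first.
        by move=> t /andP[_ ta]; apply: eq_pair_val; upd_simpl.
      rewrite c0E ev mulr0n; ring.
  have ov : odd c0 = true by lia.
  apply: exec_nif => /=; upd_simpl => pend.
    have p0 : N 9%N = 0%N by lia.
    apply: exec_seq; do 2 apply: exec_nset => /=.
    apply: exec_seq; do 2 apply: exec_nset => /=.
    upd_simpl; rewrite ?h1 ?h6; split=> /=; upd_simpl => //.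
    + by split; rewrite ?addn1//; lia.
    + by split=> [j jr|h]; upd_simpl; [apply: hC; lia|].
    + move=> t ta; upd_simpl; exact: hw.
    + split; last by lia.
      move=> f; rewrite big_nat_recr//= hf -NC -/c0 sumC; last 2 first.
      - by move=> j ji; upd_simpl.
      - by upd_simpl.
      rewrite [X in _ = 2 * (_ + X) + _](eq_big_nat _ _ (F2 := pair_val N M f)); last first.
        by move=> t /andP[_ ta]; apply: eq_pair_val; upd_simpl.
      rewrite c0E ov p0 mulr0n mulr1n; ring.
  have p1 : N 9%N = 1%N by lia.
  apply: exec_seq; apply: exec_nset => /=; apply: exec_seq; apply: exec_rset => /=.
  apply: exec_seq; do 2 apply: exec_nset => /=.
  apply: exec_seq; do 2 apply: exec_nset => /=.
  upd_simpl; rewrite ?h0 ?h1 ?h6; split=> /=; upd_simpl => //.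
  + split=> /=; upd_simpl => // j jr; upd_simpl; exact: hi.
  + by split; rewrite ?addn1//; lia.
  + by split=> [j jr|h]; upd_simpl; [apply: hC; lia|].
  + move=> t; rewrite addn1 ltnS leq_eqVlt => /predU1P[->|ta]; upd_simpl.
      by split=> //; exact: hI.
    exact: hw.
  + split; last by lia.
    move=> f; rewrite big_nat_recr//= hf -NC -/c0 sumC; last 2 first.
    - by move=> j ji; upd_simpl.
    - by upd_simpl.
    rewrite addn1 [X in _ = 2 * (_ + X) + _]big_nat_recr//=.
    rewrite [X in _ = 2 * (_ + (X + _)) + _](eq_big_nat _ _ (F2 := pair_val N M f)); last first.
      by move=> t /andP[_ ta]; apply: eq_pair_val; upd_simpl.
    by rewrite [pair_val (upd _ _ _) _ _ _]/pair_val; upd_simpl; rewrite p1 c0E ov mulr1n; field.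
- move=> s'; rewrite /= !upd_ne//= (hd_n hs) => -[hd [h6 h9 ha] [_ hI] hw [hf hc]].
  split=> //; first by lia.
  exists (nmem s' 9 == 1)%N, (nmem s' (20 + n + nmem s' 8)); split=> [/eqP/hI //|f].
  rewrite hf /position; congr (_ + _ * _).
  by case: (nmem s' 9) h9 => [|[|]].
Qed.

End Setup.

Section Build.
Variables (R : realType) (T : nat -> nat -> nat) (m n k : nat) (inp : nat -> R).
Implicit Types s : state R.

Definition pair_entry (N : nat -> nat) (i t : nat) : R :=
  inp (N (20 + n + t)%N * m + i)%N - inp (N (20 + (n + n) + t)%N * m + i)%N.

Definition pair_norm (N : nat -> nat) (a i : nat) : R :=
  Num.sqrt (\sum_(0 <= t < a) pair_entry N i t * pair_entry N i t).

Local Notation acc := (n * m + (n + n + 1))%N.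

Lemma buildP l s : header m n k inp l s ->
  (forall t, (t < nmem s 8)%N -> (nmem s (20 + n + t) < n)%N /\
     (nmem s (20 + (n + n) + t) < n)%N) ->
  wp T (fun s' =>
  [/\ forall b, b <> 6%N -> b <> 7%N -> nmem s' b = nmem s b,
      forall b, (b < acc)%N -> rmem s' b = rmem s b,
      forall i t, (i < m)%N -> (t < nmem s 8)%N ->
        rmem s' (acc + 1 + (i * nmem s 8 + t))%N =
        pair_entry (nmem s) i t / pair_norm (nmem s) (nmem s 8) i &
      (clock s' <= clock s + m * (300 * nmem s 8 + 400) + 100)%N]) build s.
Proof.
move=> hs wf; set a := nmem s 8 in wf *.
pose frame (s' : state R) := [/\ forall b, b <> 6%N -> b <> 7%N -> nmem s' b = nmem s b &
   forall b, (b < acc)%N -> rmem s' b = rmem s b].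
apply: exec_seq; apply: exec_nset => /=.
apply: (exec_repeat (I := fun i s' => [/\ frame s', nmem s' 6 = i,
   forall i' t, (i' < i)%N -> (t < a)%N -> rmem s' (acc + 1 + (i' * a + t))%N =
        pair_entry (nmem s) i' t / pair_norm (nmem s) a i' &
   (clock s' <= clock s + i * (300 * a + 400) + 100)%N])).
- split=> //=; last by lia.
  by split=> //= b b6 b7; upd_simpl.
- move=> i s1 /=; rewrite upd_ne//= (hd_m hs) => im [f1 h6 hA hc].
  apply: exec_seq; apply: exec_rset => /=; apply: exec_seq; apply: exec_nset => /=.
  have diffE s' t : frame s' -> nmem s' 6 = i -> nmem s' 7 = t -> (t < a)%N ->
      reval s' difference = pair_entry (nmem s) i t.
    move=> [fN fM] e6 e7 ta; rewrite /= e6 e7 !fN ?(hd_m hs) ?(hd_n hs)//; try lia.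
    have [wI wJ] := wf t ta.
    by rewrite !fM ?(hd_inp hs)//; nia.
  have locAccE s' : frame s' -> neval s' locAcc = acc.
    by move=> [fN fM] /=; rewrite !fN ?(hd_m hs) ?(hd_n hs).
  have a8 s' : frame s' -> nmem s' 8 = a by move=> [fN _]; rewrite fN.
  apply: exec_seq.
  apply: (exec_repeat (I := fun t s' => [/\ frame s', nmem s' 6 = i /\ nmem s' 7 = t,
     rmem s' acc = \sum_(0 <= t' < t) pair_entry (nmem s) i t' * pair_entry (nmem s) i t',
     forall i' t, (i' < i)%N -> (t < a)%N -> rmem s' (acc + 1 + (i' * a + t))%N =
        pair_entry (nmem s) i' t / pair_norm (nmem s) a i' &
     (clock s' <= clock s + i * (300 * a + 400) + 250 + 120 * t)%N])).
  + have accE := locAccE s1 f1; rewrite /= in accE.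
    have [f1N f1M] := f1.
    split=> /=; rewrite ?accE.
    * split=> [b b6 b7|b bA] /=; upd_simpl; [exact: f1N|exact: f1M].
    * by upd_simpl.
    * by upd_simpl; rewrite big_geq.
    * by move=> i' t ii' ta; upd_simpl; exact: hA.
    * lia.
  + move=> t s2 /=; rewrite upd_ne//= (a8 _ f1) => ta [f2 [h26 h27] hacc h2A h2c].
    have [f2N f2M] := f2.
    have f2' : frame (tick 1 s2) by split.
    apply: exec_seq; apply: exec_rset; apply: exec_nset.
    rewrite (locAccE _ f2').
    have -> : reval (tick 1 s2) (RAdd (RGet locAcc) (RMul difference difference)) =
        \sum_(0 <= t' < t.+1) pair_entry (nmem s) i t' * pair_entry (nmem s) i t'.
      rewrite big_nat_recr//= -hacc.
      have := locAccE _ f2' => /= ->.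
      by have := diffE _ t f2' h26 h27 ta => /= ->.
    split=> /=; rewrite ?h27.
    * split=> [b b6 b7|b bA] /=; upd_simpl; [exact: f2N|exact: f2M].
    * by upd_simpl; rewrite addn1.
    * by upd_simpl.
    * by move=> i' t' ii' ta'; upd_simpl; exact: h2A.
    * lia.
  move=> s2; rewrite /= upd_ne//= (a8 _ f1) => -[f2 [h26 h27] hacc h2A h2c].
  have [f2N f2M] := f2.
  apply: exec_seq; apply: exec_nset => /=; apply: exec_seq.
  apply: (exec_repeat (I := fun t s' => [/\ frame s', nmem s' 6 = i /\ nmem s' 7 = t,
     rmem s' acc = \sum_(0 <= t' < a) pair_entry (nmem s) i t' * pair_entry (nmem s) i t',
     (forall i' t, (i' < i)%N -> (t < a)%N -> rmem s' (acc + 1 + (i' * a + t))%N =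
        pair_entry (nmem s) i' t / pair_norm (nmem s) a i') /\
     (forall t', (t' < t)%N -> rmem s' (acc + 1 + (i * a + t'))%N =
        pair_entry (nmem s) i t' / pair_norm (nmem s) a i) &
     (clock s' <= clock s + i * (300 * a + 400) + 120 * a + 300 + 120 * t)%N])).
  + split=> /=.
    * by split=> [b b6 b7|//] /=; upd_simpl; exact: f2N.
    * by upd_simpl.
    * by [].
    * by [].
    * lia.
  + move=> t s3 /=; rewrite upd_ne//= (a8 _ f2) => ta [f3 [h36 h37] h3acc [h3A h3t] h3c].
    have [f3N f3M] := f3.
    have f3' : frame (tick 1 s3) by split.
    apply: exec_seq; apply: exec_rset; apply: exec_nset.
    have -> : neval (tick 1 s3) (locA (NAdd (NMul (NGet (NConst 6)) (NGet (NConst 8))) (NGet (NConst 7)))) =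
        (acc + 1 + (i * a + t))%N.
      by have := locAccE _ f3' => /= ->; rewrite h36 h37 (a8 _ f3).
    have -> : reval (tick 1 s3) (RDiv difference (RSqrt (RGet locAcc))) =
        pair_entry (nmem s) i t / pair_norm (nmem s) a i.
      have := diffE _ t f3' h36 h37 ta => /= ->.
      by have := locAccE _ f3' => /= ->; rewrite h3acc.
    split=> /=; rewrite ?h37.
    * split=> [b b6 b7|b bA] /=; upd_simpl; [exact: f3N|exact: f3M].
    * by upd_simpl; rewrite addn1.
    * by upd_simpl.
    * split=> [i' t' ii' ta'|t'].
        (* Earlier rows end before row [i] begins, so the write leaves them intact. *)
        have : (i' * a + a <= i * a)%N by nia.
        by move=> h; upd_simpl; exact: h3A.
      rewrite ltnS leq_eqVlt => /predU1P[->|tt]; upd_simpl => //.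
      exact: h3t.
    * lia.
  move=> s3; rewrite /= upd_ne//= (a8 _ f2) => -[[f3N f3M] [h36 h37] _ [h3A h3t] h3c].
  apply: exec_nset => /=; split=> /=.
  + by split=> [b b6 b7|//] /=; upd_simpl; exact: f3N.
  + by upd_simpl; rewrite h36 addn1.
  + move=> i' t; rewrite ltnS leq_eqVlt => /predU1P[->|ii'] ta; first exact: h3t.
    exact: h3A.
  + lia.
- by move=> s'; rewrite /= upd_ne//= (hd_m hs) => -[[fN fM] h6 hA hc].
Qed.

End Build.

Section Compaction.
Variables (R : realType) (T : nat -> nat -> nat) (m n k : nat) (inp : nat -> R).
Implicit Types s : state R.

Local Notation pos := (position m n).
Local Notation pv := (pair_val m n).
Local Notation locx t := (n * m + (n + 1) + t)%N.

Definition active_wf (N : nat -> nat) (M : nat -> R) (a : nat) : Prop :=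
  forall t, (t < a)%N -> [/\ (N (20 + n + t)%N < n)%N, (N (20 + (n + n) + t)%N < n)%N &
    `|M (locx t)| <= 1].

Lemma sum_bump (N : nat -> nat) (p : nat) (f : nat -> R) : (p < n)%N ->
  \sum_(0 <= i < n) (upd N (20 + p) (N (20 + p)%N + 1)%N (20 + i)%N)%:R * f i =
  \sum_(0 <= i < n) (N (20 + i)%N)%:R * f i + f p.
Proof.
move=> pn; rewrite !big_mkord (bigD1 (Ordinal pn))//= [in RHS](bigD1 (Ordinal pn))//=.
rewrite upd_eq natrD mulrDl mul1r -!addrA; congr (_ + _); rewrite addrC; congr (_ + _).
apply: eq_bigr => i /eqP ip; rewrite upd_ne// => /addnI h; apply: ip.
exact/val_inj.
Qed.

(** The position does not move: a pair of colour 1 or -1 already has its whole unit on one member,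
    and incrementing that multiplicity only changes where the unit is recorded. *)
Lemma compactionP l s : header m n k inp l s -> (nmem s 8 <= n)%N ->
  active_wf (nmem s) (rmem s) (nmem s 8) ->
  wp T (fun s' =>
  [/\ header m n k inp l s',
      nmem s' 8 = (\sum_(0 <= t < nmem s 8) (`|rmem s (locx t)|%R != 1%R))%N,
      active_wf (nmem s') (rmem s') (nmem s' 8),
      forall f, pos (nmem s') (rmem s') (nmem s' 8) f =
        pos (nmem s) (rmem s) (nmem s 8) f &
      (clock s' <= clock s + 150 * n + 100)%N]) compaction s.
Proof.
move=> hs; set a := nmem s 8 => an wf.
do 2 (apply: exec_seq; apply: exec_nset => /=); apply: exec_seq.
apply: (exec_repeat (I := fun t0 s' =>
  [/\ header m n k inp l s',
      [/\ nmem s' 7 = t0, nmem s' 8 = a, (nmem s' 9 <= t0)%N &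
        nmem s' 9 = (\sum_(0 <= t < t0) (`|rmem s (locx t)|%R != 1%R))%N],
      active_wf (nmem s') (rmem s') (nmem s' 9),
      (forall t, (t0 <= t < a)%N -> [/\ nmem s' (20 + n + t) = nmem s (20 + n + t),
         nmem s' (20 + (n + n) + t) = nmem s (20 + (n + n) + t) &
         rmem s' (locx t) = rmem s (locx t)]) /\
      (forall f, \sum_(0 <= i < n) (nmem s' (20 + i)%N)%:R * f i +
          \sum_(0 <= t < nmem s' 9) pv (nmem s') (rmem s') f t +
          \sum_(t0 <= t < a) pv (nmem s) (rmem s) f t =
        pos (nmem s) (rmem s) a f) &
      (clock s' <= clock s + 150 * t0 + 50)%N])).
- case: hs => h0 h1 h2 h4 h5 hi; split=> //=.
  + by rewrite big_geq.
  + by split=> // f; rewrite [X in _ + X + _]big_geq// addr0.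
  + lia.
- move=> t0 [N M c] /=; rewrite !upd_ne//= -/a => ta.
  move=> [[/= h0 h1 h2 h4 h5 hi] [h7 h8 h9 h9s] wf' [hrest hpos] hc].
  have [rI rJ rX] := hrest t0 (introT andP (conj (leqnn _) ta)).
  have [wI wJ wX] := wf t0 ta.
  have cnt (b : bool) : (`|rmem s (locx t0)| != 1) = b ->
      (\sum_(0 <= t < t0.+1) (`|rmem s (locx t)|%R != 1%R) = N 9 + b)%N.
    by move=> <-; rewrite big_nat_recr//= -h9s.
  have pos_rest f : \sum_(t0 <= t < a) pv (nmem s) (rmem s) f t =
      pv (nmem s) (rmem s) f t0 + \sum_(t0.+1 <= t < a) pv (nmem s) (rmem s) f t.
    by rewrite big_ltn.
  set X := rmem s (locx t0) in rX wX cnt pos_rest.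
  have Xi : M (n * m + (n + 1) + N 7%N)%N = X by rewrite h7.
  have /andP[X1 X2] : -1 <= X <= 1 by rewrite -ler_norml.
  apply: exec_seq; apply: exec_rif => /=; rewrite h0 h1 Xi => hX.
    have XE : X = 1 by apply/eqP; rewrite eq_le X2 hX.
    have {}cnt := cnt false (ltac:(by rewrite XE normr1 eqxx)).
    do 2 apply: exec_nset => /=; rewrite h1 h7 rI; upd_simpl; rewrite h7.
    set p := nmem s (20 + n + t0) in wI *.
    split=> /=; upd_simpl => //.
    + by split=> //; [rewrite addn1|lia|rewrite cnt addn0].
    + move=> t tt; have [q1 q2 q3] := wf' t tt.
      by split=> //; upd_simpl.
    + split=> [t tr|f].
        by have [q1 q2 q3] := hrest t (ltac:(lia)); split=> //; upd_simpl.
      rewrite -(hpos f) pos_rest.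
      rewrite (eq_big_nat _ _ (F2 := fun i =>
         (upd N (20 + p) (N (20 + p)%N + 1)%N (20 + i)%N)%:R * f i)); last first.
        by move=> i /andP[_ iN]; rewrite upd_ne//; lia.
      rewrite sum_bump//.
      rewrite (eq_big_nat _ _ (F2 := pv N M f)); last first.
        by move=> t /andP[_ tt]; apply: eq_pair_val; upd_simpl.
      by rewrite [pv (nmem s) _ _ _]/pair_val -/X -/p XE; field.
    + lia.
  apply: exec_rif => /=; rewrite h0 h1 Xi => hX'.
    have XE : X = -1 by apply/eqP; rewrite eq_le X1 andbT -[-1]add0r.
    have {}cnt := cnt false (ltac:(by rewrite XE normrN1 eqxx)).
    do 2 apply: exec_nset => /=; rewrite h1 h7 rJ; upd_simpl; rewrite h7.
    set p := nmem s (20 + (n + n) + t0) in wJ *.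
    split=> /=; upd_simpl => //.
    + by split=> //; [rewrite addn1|lia|rewrite cnt addn0].
    + move=> t tt; have [q1 q2 q3] := wf' t tt.
      by split=> //; upd_simpl.
    + split=> [t tr|f].
        by have [q1 q2 q3] := hrest t (ltac:(lia)); split=> //; upd_simpl.
      rewrite -(hpos f) pos_rest.
      rewrite (eq_big_nat _ _ (F2 := fun i =>
         (upd N (20 + p) (N (20 + p)%N + 1)%N (20 + i)%N)%:R * f i)); last first.
        by move=> i /andP[_ iN]; rewrite upd_ne//; lia.
      rewrite sum_bump//.
      rewrite (eq_big_nat _ _ (F2 := pv N M f)); last first.
        by move=> t /andP[_ tt]; apply: eq_pair_val; upd_simpl.
      by rewrite [pv (nmem s) _ _ _]/pair_val -/X -/p XE; field.
    + lia.
  have Xn : (`|X| != 1) = true.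
    apply/negP => /eqP/eqP; rewrite eqr_norml ler01 andbT => /orP[] /eqP XE.
    - by move: hX; rewrite XE ltxx.
    - by move: hX'; rewrite XE sub0r ltxx.
  have {}cnt := cnt true Xn.
  do 2 (apply: exec_seq; apply: exec_nset => /=).
  apply: exec_seq; apply: exec_rset; do 2 apply: exec_nset => /=.
  upd_simpl; rewrite h0 h1 h7; upd_simpl; rewrite rI rJ rX; upd_simpl.
  split=> /=; upd_simpl => //.
  + by split=> /=; upd_simpl => // j jr; upd_simpl; exact: hi.
  + by split=> //; [rewrite addn1|lia].
  + move=> t; rewrite addn1 ltnS leq_eqVlt => /predU1P[->|tt].
      by split; upd_simpl.
    have [q1 q2 q3] := wf' t tt.
    by split; upd_simpl.
  + split=> [t tr|f].
      by have [q1 q2 q3] := hrest t (ltac:(lia)); split; upd_simpl.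
    rewrite -(hpos f) pos_rest.
    rewrite (eq_big_nat _ _ (F2 := fun i => (N (20 + i)%N)%:R * f i)); last first.
      by move=> i /andP[_ iN]; upd_simpl.
    rewrite addn1 [X in _ + X + _]big_nat_recr//=.
    rewrite [X in _ + (X + _) + _](eq_big_nat _ _ (F2 := pv N M f)); last first.
      by move=> t /andP[_ tt]; apply: eq_pair_val; upd_simpl.
    rewrite [pv (upd _ _ _) _ _ _]/pair_val; upd_simpl.
    rewrite [pv (nmem s) _ _ t0]/pair_val -/X; ring.
  + lia.
- move=> s'; rewrite /= !upd_ne//= -/a => -[[h0 h1 h2 h4 h5 hi] [h7 h8 h9 h9s] wf' [hrest hpos] hc].
  apply: exec_nset; split=> //=.
  + move=> f; rewrite -hpos [X in _ + X]big_geq// addr0.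
    rewrite /position; congr (_ + _).
  + lia.
Qed.

End Compaction.

Section Round.
Variables (R : realType) (T : nat -> nat -> nat) (m n k : nat) (inp : nat -> R).
Implicit Types s : state R.
Local Notation locx t := (n * m + (n + 1) + t)%N.
Local Notation acc := (n * m + (n + n + 1))%N.

Definition pair_mx (N : nat -> nat) (a : nat) : 'M[R]_(m, a) :=
  \matrix_(i < m, t < a) pair_entry m n inp N i t.

Lemma pair_normE (N : nat -> nat) (a : nat) (i : 'I_m) :
  pair_norm m n inp N a i = norm2 (row i (pair_mx N a)).
Proof.
rewrite /pair_norm /norm2 big_mkord; congr Num.sqrt; apply: eq_bigr => t _.
by rewrite !mxE expr2.
Qed.

(** Exhibits a round as a single draw followed by code that halts on every answer in the cube; the
    success probability and the worst-case time are both read off this form. *)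
Lemma roundP l a s : header m n k inp l s -> nmem s 8 = a -> (a <= n)%N ->
  active_wf m n (nmem s) (rmem s) a ->
  exists (A : 'M[R]_(m, a)) (x0 : 'rV[R]_a) (K : a.-tuple R -> run R),
  [/\ exec T round s = Draw A x0 K,
      forall i t, A i t = pair_mx (nmem s) a i t / norm2 (row i (pair_mx (nmem s) a)),
      forall t : 'I_a, x0 0 t = rmem s (locx t) &
      forall x : a.-tuple R, in_cube (row_of x) -> halts (fun s' =>
        [/\ header m n k inp l s',
            (nmem s' 8 + #|[pred t : 'I_a | `|tnth x t|%R == 1%R]| = a)%N,
            active_wf m n (nmem s') (rmem s') (nmem s' 8),
            forall f, position m n (nmem s') (rmem s') (nmem s' 8) f =
              position m n (nmem s) (rmem s) a f +
              \sum_(t < a) (tnth x t - rmem s (locx t)) / 2 *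
                (f (nmem s (20 + n + t)%N) - f (nmem s (20 + (n + n) + t)%N)) &
            (clock s' <= clock s + m * (300 * a + 400) + 150 * n + 300 + T m a)%N]) (K x)].
Proof.
move=> hs ha an wf.
have := @buildP R T m n k inp l s hs; rewrite ha => /(_ _)/wrap[].
  by move=> t ta; have [] := wf t ta.
rewrite /wp /round; set rb := exec T build s => hb.
have [s1 rbE [hN hM hA hc]] : exists2 s1, rb = Halt s1 & [/\
      forall b, b <> 6%N -> b <> 7%N -> nmem s1 b = nmem s b,
      forall b, (b < acc)%N -> rmem s1 b = rmem s b,
      forall i t, (i < m)%N -> (t < a)%N ->
        rmem s1 (acc + 1 + (i * a + t))%N =
        pair_entry m n inp (nmem s) i t / pair_norm m n inp (nmem s) a i &
      (clock s1 <= clock s + m * (300 * a + 400) + 100)%N].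
  by case: rb hb => // s1 h; exists s1.
have e0 : nmem s1 0 = m by rewrite hN// (hd_m hs).
have e1 : nmem s1 1 = n by rewrite hN// (hd_n hs).
have e8 : nmem s1 8 = a by rewrite hN.
have Es : exec T sample s1 =
    (* 46 is the cost of the five operand expressions of [sample] plus that of the instruction
       itself. *)
    Draw (read_mx s1 m a (acc + 1)%N) (read_row s1 a (locx 0))
      (fun x => Halt (tick (46 + T m a)%N (write_tuple s1 (locx 0) x))).
  by rewrite /= e0 e1 e8 !addn0.
have E : exec T (CSeq build (CSeq sample compaction)) s =
    Draw (read_mx s1 m a (acc + 1)%N) (read_row s1 a (locx 0))
      (fun x => exec T compaction (tick (46 + T m a)%N (write_tuple s1 (locx 0) x))).
  change (bind rb (exec T (CSeq sample compaction)) =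
    bind (Draw (read_mx s1 m a (acc + 1)%N) (read_row s1 a (locx 0))
      (fun x => Halt (tick (46 + T m a)%N (write_tuple s1 (locx 0) x)))) (exec T compaction)).
  by rewrite rbE -Es.
exists (read_mx s1 m a (acc + 1)%N), (read_row s1 a (locx 0)).
pose s2f (x : a.-tuple R) := tick (46 + T m a)%N (write_tuple s1 (locx 0) x).
exists (fun x => exec T compaction (s2f x)); split; first exact: E.
- move=> i t; rewrite -pair_normE !mxE -addnA hA//.
- by move=> t; rewrite mxE addn0 hM//; have := ltn_ord t; lia.
move=> x x1; move s2E : (s2f x) => s2; rewrite /s2f in s2E.
have [w1 w2 w3 w4] := write_tupleP x s1 (locx 0).
have N2 b : b <> 6%N -> b <> 7%N -> nmem s2 b = nmem s b by rewrite -s2E /= w1; exact: hN.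
have X2 (t : 'I_a) : rmem s2 (locx t) = tnth x t.
  by rewrite -s2E /= -w3; congr (rmem _ _); lia.
have hs2 : header m n k inp l s2.
  case: (hs) => h0 h1 h2 h4 h5 hi; split; rewrite ?N2// => j jr.
  by rewrite -s2E /= w4; [rewrite hM ?hi//; lia|lia].
have a2 : nmem s2 8 = a by rewrite N2.
have wf2 : active_wf m n (nmem s2) (rmem s2) (nmem s2 8).
  rewrite a2 => t ta; have [q1 q2 q3] := wf t ta.
  rewrite !N2; try lia; split=> //.
  by have := x1 (Ordinal ta); rewrite mxE -X2.
have an2 : (nmem s2 8 <= n)%N by rewrite a2.
apply: halts_weaken (compactionP T hs2 an2 wf2) => s' [q1 q2 q3 q4 q5].
split=> //.
- rewrite q2 a2 big_mkord; have -> : #|[pred t : 'I_a | `|tnth x t|%R == 1%R]| =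
      (\sum_(t < a) (`|tnth x t|%R == 1%R))%N by rewrite -sum1_card big_mkcond.
  rewrite -big_split/= (eq_bigr (fun=> 1%N)) ?sum1_card ?card_ord// => t _.
  by rewrite X2; case: eqP.
- move=> f; rewrite q4 a2 /position.
  rewrite (eq_big_nat _ _ (F2 := fun i => (nmem s (20 + i)%N)%:R * f i)); last first.
    by move=> i _; rewrite N2//; lia.
  rewrite -addrA; congr (_ + _); rewrite !big_mkord -big_split/=.
  apply: eq_bigr => t _; rewrite /pair_val X2 !N2; try lia.
  by field.
- apply: leq_trans q5 _; rewrite -s2E /= w2; move: hc; lia.
Qed.

Lemma finalP l s : header m n k inp l s -> wp T (fun s' =>
  [/\ nmem s' 0 = 20%N,
      forall i, (i < n)%N -> nmem s' (20 + i) =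
        (nmem s (20 + i) + (i == 0) * (k - \sum_(0 <= j < n) nmem s (20 + j)))%N &
      (clock s' <= clock s + 50 * n + 100)%N]) final s.
Proof.
move=> hs; do 2 (apply: exec_seq; apply: exec_nset => /=); apply: exec_seq.
apply: (exec_repeat (I := fun i s' =>
  [/\ nmem s' 2 = k, nmem s' 6 = i, nmem s' 11 = (\sum_(0 <= j < i) nmem s (20 + j))%N,
      forall j, nmem s' (20 + j) = nmem s (20 + j) &
      (clock s' <= clock s + 50 * i + 50)%N])).
- split=> //=.
  + exact: (hd_k hs).
  + by rewrite big_geq.
  + lia.
- move=> i [N M c] /= _ [h2 h6 h11 hC hc].
  apply: exec_seq; do 2 apply: exec_nset => /=.
  rewrite h6 h11 hC; split=> /=; upd_simpl => //.
  + by rewrite h6 addn1.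
  + by rewrite big_nat_recr.
  + lia.
- move=> s'; rewrite /= !upd_ne//= (hd_n hs) => -[h2 h6 h11 hC hc].
  apply: exec_seq; do 2 apply: exec_nset => /=; rewrite h2 h11 hC.
  split=> /=; upd_simpl => //; last by lia.
  move=> i _; upd_simpl; have [->|i0] := eqVneq i 0%N.
    by upd_simpl; rewrite mul1n.
  by upd_simpl; rewrite hC mul0n addn0.
Qed.

End Round.

(** * Success probability *)

Section ProbabilisticRules.
Variables (R : realType) (T : nat -> nat -> nat) (D : sampler R).
Implicit Types s : state R.

Lemma good_seq (Q Q' : state R -> Prop) e e' c1 c2 s : 0 <= e -> 0 <= e' ->
  good D Q e (exec T c1 s) -> (forall s', Q s' -> good D Q' e' (exec T c2 s')) ->
  good D Q' (e + e') (exec T (CSeq c1 c2) s).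
Proof. by move=> e0 e'0 h h'; exact: good_bind e0 e'0 h h'. Qed.

Lemma good_repeat (I : nat -> state R -> Prop) (e : nat -> R) ex c s :
  (forall i, 0 <= e i) -> I 0%N (tick (ncost ex).+1 s) ->
  (forall i s', (i < neval s ex)%N -> I i s' ->
     good D (I i.+1) (e i) (exec T c (tick 1 s'))) ->
  good D (I (neval s ex)) (\sum_(i < neval s ex) e i) (exec T (CRepeat ex c) s).
Proof. by move=> e0 h0 h; exact: good_iter h0 _ _ e0 h. Qed.

Lemma wp_good (Q : state R -> Prop) c s : wp T Q c s -> good D Q 0 (exec T c s).
Proof. exact: halts_good. Qed.

Lemma wp_always (Q : state R -> Prop) c s : wp T Q c s -> always Q (exec T c s).
Proof. exact: halts_always. Qed.

Lemma always_seq (Q Q' : state R -> Prop) c1 c2 s :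
  always Q (exec T c1 s) -> (forall s', Q s' -> always Q' (exec T c2 s')) ->
  always Q' (exec T (CSeq c1 c2) s).
Proof. by move=> h h'; exact: always_bind h h'. Qed.

Lemma always_repeat (I : nat -> state R -> Prop) ex c s :
  I 0%N (tick (ncost ex).+1 s) ->
  (forall i s', (i < neval s ex)%N -> I i s' -> always (I i.+1) (exec T c (tick 1 s'))) ->
  always (I (neval s ex)) (exec T (CRepeat ex c) s).
Proof. by move=> h0 h; exact: (always_iter h0 h). Qed.

End ProbabilisticRules.

Section Rounds.
Variables (R : realType) (T : nat -> nat -> nat) (D : sampler R) (C1 C2 C3 : R).
Hypotheses (C10 : 0 < C1) (C20 : 0 < C2) (C30 : 0 < C3) (LM : lovett_meka C1 C2 C3 D).
Variables (m n k : nat) (p : \bar R) (inp : nat -> R).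
Hypotheses (m0 : (0 < m)%N) (k0 : (0 < k)%N) (p2 : (2%:E <= p)%E) (nm : (n <= m.+1)%N).

Definition body_vec (i : nat) : 'rV[R]_m := \row_j inp (i * m + j)%N.
Hypothesis body1 : forall i, (i < n)%N -> lpnorm p (body_vec i) <= 1.

Implicit Types s : state R.
Local Notation locx t := (n * m + (n + 1) + t)%N.
Local Notation pos s := (position m n (nmem s) (rmem s) (nmem s 8)).

Definition pos_vec s : 'rV[R]_m := \row_j pos s (fun i => inp (i * m + j)%N).

(* The bound of the round r of the level j is relaxed by the factor [threshold j r]. The
   resulting error decreases at the rate [rho], the product of [slack] and [decay], and the
   failure probabilities sum to at most 1/2 over all j and r. *)
Definition slack : R := 20 / 19.
Definition rho : R := 18 / 19.
Definition threshold (j r : nat) : R := 21 * slack ^+ (j + r).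
Definition failure (j r : nat) : R := 2 / threshold j r ^+ 2.
Definition scale : R := 21 * draw_cst C1 C2 C3 * Num.sqrt (k%:R * minpl m k p).

Lemma slack_ge1 : 1 <= slack. Proof. by rewrite /slack; lra. Qed.

Lemma threshold_ge1 j r : 1 <= threshold j r.
Proof.
have := exprn_ege1 (j + r) slack_ge1; rewrite /threshold; lra.
Qed.

Lemma failure_ge0 j r : 0 <= failure j r.
Proof. by rewrite divr_ge0// sqr_ge0. Qed.

Lemma scale_ge0 : 0 <= scale.
Proof. by rewrite !mulr_ge0 ?sqrtr_ge0 ?draw_cst_ge0. Qed.

(** The hypothesis on [r] records that the pairs have been halved r times and is the premise of
    [gain_decay]. Relaxation by [slack] and decay by [decay] multiply to [rho]. *)
Lemma round_good l j r s : header m n k inp l s -> (nmem s 8 <= n)%N -> (nmem s 8 <= m)%N ->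
  active_wf m n (nmem s) (rmem s) (nmem s 8) ->
  (nmem s 8 * 2 ^ r <= k * 2 ^ j)%N ->
  good D (fun s' => [/\ header m n k inp l s', (2 * nmem s' 8 <= nmem s 8)%N,
      active_wf m n (nmem s') (rmem s') (nmem s' 8),
      pos s' (fun=> 1) = pos s (fun=> 1) &
      lpnorm p (pos_vec s' - pos_vec s) <= scale * 2 ^+ j * rho ^+ (j + r)])
    (failure j r) (exec T round s).
Proof.
move=> hs; move aE : (nmem s 8) => a an am wf ak.
have [A [x0 [K [-> AW x0E hK]]]] := roundP T hs aE an wf.
set W := pair_mx m n inp (nmem s) a in AW.
have colW t : lpnorm p (col t W)^T <= 2.
  have [wI wJ _] := wf t (ltn_ord t).
  have -> : (col t W)^T = body_vec (nmem s (20 + n + t)) - body_vec (nmem s (20 + (n + n) + t)).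
    by apply/rowP => i; rewrite !mxE.
  apply: le_trans (ler_lpnormB _ _ p2) _; rewrite -[leRHS]/(1 + 1).
  by apply: lerD; exact: body1.
have x01 : in_cube x0 by move=> t; rewrite x0E; have [] := wf t (ltn_ord t).
have [G [mG PG hG]] := good_draw C10 C20 C30 LM m0 k0 p2 am (threshold_ge1 j r) colW AW x01.
exists (failure j r), 0, G; split.
  by split; rewrite ?addr0 ?failure_ge0.
move=> x Gx; have [x1 fr hx] := hG x Gx.
apply: halts_good; apply: halts_weaken (hK x x1) => s' [q1 q2 q3 q4 q5].
(* Changing a colour by d moves the weight d / 2 from one member of the pair to the other; this 1/2
   cancels the 2 of [gain_decay]. *)
have pE : pos_vec s' - pos_vec s = 2^-1 *: (W *m (row_of x - x0)^T)^T.
  apply/rowP => i; rewrite !mxE q4 aE addrC addKr big_distrr/=; apply: eq_bigr => t _.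
  rewrite !mxE x0E /pair_entry; ring.
split=> //.
- move: fr q2; move: #|_| (nmem s' 8) => z y; rewrite mul2n -addnn => z2 yz.
  by move: z2; rewrite -{1}yz leq_add2r => z2; rewrite mul2n -addnn -yz leq_add2l.
- by rewrite q4 big1 ?addr0// => t _; rewrite subrr mulr0.
rewrite pE lpnormZ// ger0_norm// mulrC ler_pdivrMr//.
apply: le_trans hx _.
have M0 : 0 <= minpl m k p by apply: le_trans (minpl_ge m0 k0 p2); lra.
have K0 : 0 < k%:R :> R by rewrite ltr0n.
rewrite sqrtrM ?mulr_ge0 ?(ltW K0)// /scale /threshold.
have u0 : 0 <= a%:R / k%:R :> R by rewrite divr_ge0.
have hu : a%:R / k%:R <= 2 ^+ j / 2 ^+ r :> R.
  rewrite ler_pdivrMr// mulrAC ler_pdivlMr ?exprn_gt0//.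
  by rewrite -!natrX -!natrM ler_nat [(2 ^ j * _)%N]mulnC.
have := gain_decay u0 hu; set g := Num.sqrt (gain _) => hg.
have rE : rho ^+ (j + r) = slack ^+ (j + r) * decay R ^+ (j + r).
  by rewrite -exprMn; congr (_ ^+ _); rewrite /rho /slack /decay; field.
rewrite rE; set c := draw_cst C1 C2 C3; set q := Num.sqrt (k%:R * _).
have cq0 : 0 <= c * (21 * slack ^+ (j + r)) * q.
  by rewrite !mulr_ge0 ?draw_cst_ge0 ?sqrtr_ge0 ?exprn_ge0// (le_trans _ slack_ge1).
rewrite [c * _ * (q * g)]mulrA; apply: le_trans (ler_wpM2l cq0 hg) _.
rewrite le_eqVlt; apply/orP; left; apply/eqP; ring.
Qed.

Lemma level_good l j s : header m n k inp l s -> (m < 2 ^ l)%N ->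
  (\sum_(0 <= i < n) nmem s (20 + i) <= k * 2 ^ j.+1)%N ->
  good D (fun s' => [/\ header m n k inp l s',
      (2 * \sum_(0 <= i < n) nmem s' (20 + i) <= \sum_(0 <= i < n) nmem s (20 + i))%N,
      (\sum_(0 <= i < n) nmem s (20 + i) <= 2 * \sum_(0 <= i < n) nmem s' (20 + i) + 1)%N &
      lpnorm p (\sum_(0 <= i < n) (nmem s (20 + i))%:R *: body_vec i -
                2 *: \sum_(0 <= i < n) (nmem s' (20 + i))%:R *: body_vec i) <=
        1 + 38 * scale * 2 ^+ j * rho ^+ j])
    (\sum_(r < l) failure j r) (exec T level s).
Proof.
move=> hs ml Sk.
rewrite -[\sum_(r < l) _]add0r; apply: good_seq => //.
- by apply: sumr_ge0 => i _; exact: failure_ge0.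
- exact: wp_good (setupP T hs).
move=> s1 [h1 an wf1 [b [rest [bo sumE]]] _].
have nE (f : nat -> nat) : (\sum_(0 <= i < n) f i)%:R = \sum_(0 <= i < n) (f i)%:R * 1 :> R.
  by rewrite natr_sum; apply: eq_bigr => i _; rewrite mulr1.
have pos1 s' : pos s' (fun=> 1) = (\sum_(0 <= i < n) nmem s' (20 + i) + nmem s' 8)%:R.
  rewrite natrD nE; congr (_ + _); rewrite big_mkord (eq_bigr (fun=> 1)).
    by rewrite sumr_const card_ord.
  by move=> t _; rewrite /pair_val; field.
have sum1 : (\sum_(0 <= i < n) nmem s (20 + i) =
    2 * (\sum_(0 <= i < n) nmem s1 (20 + i) + nmem s1 8) + b)%N.
  by apply/eqP; rewrite -(eqr_nat R) nE sumE pos1 mulr1 -natrM -natrD.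
have ak : (nmem s1 8 <= k * 2 ^ j)%N by move: Sk; rewrite sum1 expnS; lia.
(* From 2 a <= n <= m + 1 and m > 0; [good_draw] requires at most m columns. *)
have am : (nmem s1 8 <= m)%N by move: nm m0 an; lia.
have rho0 : 0 <= rho by rewrite /rho; lra.
pose I r s' := [/\ header m n k inp l s', (nmem s' 8 * 2 ^ r <= nmem s1 8)%N,
      active_wf m n (nmem s') (rmem s') (nmem s' 8),
      pos s' (fun=> 1) = pos s1 (fun=> 1) &
      lpnorm p (pos_vec s' - pos_vec s1) <= \sum_(r' < r) scale * 2 ^+ j * rho ^+ (j + r')].
have nl : neval s1 (NGet (NConst 5)) = l by rewrite /= (hd_l h1).
have hrep := @good_repeat R T D I (failure j) (NGet (NConst 5)) round s1 (failure_ge0 j).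
rewrite nl in hrep; apply: good_weaken (hrep _ _) => //.
- by apply: sumr_ge0 => i _; exact: failure_ge0.
- move=> s2 [h2 a2 wf2 p2' hpos2].
  (* Fewer than 2^l pairs are exhausted by l halvings, so the position is now integral: tested
     against 1 it is the total, against coordinates the vector. *)
  have a20 : nmem s2 8 = 0%N by move: a2 am ml; nia.
  have pos2 f : pos s2 f = \sum_(0 <= i < n) (nmem s2 (20 + i))%:R * f i.
    by rewrite /position a20 [X in _ + X]big_geq// addr0.
  have sum2 : (\sum_(0 <= i < n) nmem s2 (20 + i) =
      \sum_(0 <= i < n) nmem s1 (20 + i) + nmem s1 8)%N.
    by apply/eqP; rewrite -(eqr_nat R) -pos1 -p2' pos1 a20 addn0.
  split=> //; rewrite ?sum1 ?sum2; [lia|by case: (b); lia|].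
  have -> : \sum_(0 <= i < n) (nmem s (20 + i))%:R *: body_vec i -
      2 *: \sum_(0 <= i < n) (nmem s2 (20 + i))%:R *: body_vec i =
      b%:R *: body_vec rest - 2 *: (pos_vec s2 - pos_vec s1).
    have vecE (c : nat -> nat) : \sum_(0 <= i < n) (c i)%:R *: body_vec i =
        \row_jj \sum_(0 <= i < n) (c i)%:R * inp (i * m + jj)%N :> 'rV[R]_m.
      by apply/rowP => jj; rewrite summxE mxE; apply: eq_bigr => i _; rewrite !mxE.
    by rewrite !vecE; apply/rowP => jj; rewrite !mxE sumE -pos2; ring.
  apply: le_trans (ler_lpnormB _ _ p2) _; apply: lerD.
    case: (b) bo => [/(_ isT) on|_]; first by rewrite scale1r body1.
    by rewrite scale0r lpnorm0.
  rewrite lpnormZ// ger0_norm//.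
  (* The rounds of a level sum to the factor 1 / (1 - rho) = 19; doubling the position makes it
     38. *)
  have := geo_sum_le l rho0 (_ : rho < 1); rewrite /= => /(_ _)/wrap[]; first by rewrite /rho; lra.
  have -> : (1 - rho)^-1 = 19 by rewrite /rho; field.
  move=> hgeo; have : \sum_(r' < l) scale * 2 ^+ j * rho ^+ (j + r') <= scale * 2 ^+ j * rho ^+ j * 19.
    rewrite (eq_bigr (fun r' : 'I_l => scale * 2 ^+ j * rho ^+ j * rho ^+ r')); last first.
      by move=> r' _; rewrite exprD !mulrA.
    have s0 : 0 <= scale * 2 ^+ j * rho ^+ j.
      by apply: mulr_ge0; [apply: mulr_ge0; [exact: scale_ge0|exact: exprn_ge0]|exact: exprn_ge0].
    by rewrite -big_distrr/=; apply: ler_wpM2l.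
  move: hpos2; set x := lpnorm _ _; set y := \sum_(r' < l) _; lra.
- split=> //=.
  + by case: h1.
  + by rewrite expn0 muln1.
  + by move=> t ta; have [w1 w2 ->] := wf1 t ta; rewrite normr0.
  + by rewrite big_ord0 (_ : pos_vec _ = pos_vec s1)// subrr lpnorm0.
- move=> r s2 rl [h2 a2 wf2 p2' hpos2].
  have a2s : (nmem s2 8 <= nmem s1 8)%N.
    by apply: leq_trans a2; rewrite leq_pmulr// expn_gt0.
  have h2t : header m n k inp l (tick 1 s2) by case: h2.
  apply: good_weaken (@round_good l j r (tick 1 s2) h2t _ _ _ _) => //=.
  + exact: failure_ge0.
  + move=> s3 [h3 a3 wf3 p3 hpos3]; split=> //.
    * by rewrite expnS; move: a2 a3; nia.
    * by rewrite p3.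
    * have -> : pos_vec s3 - pos_vec s1 = (pos_vec s2 - pos_vec s1) + (pos_vec s3 - pos_vec (tick 1 s2)).
        by rewrite [pos_vec (tick 1 s2)](_ : _ = pos_vec s2)// [RHS]addrC [RHS]addrA subrK.
      by rewrite big_ord_recr/=; apply: le_trans (ler_lpnormD _ _ p2) _; apply: lerD.
  + by move: a2s an; lia.
  + by apply: leq_trans a2s am.
  + by apply: leq_trans a2 ak.
Qed.

End Rounds.

Section Algorithm.
Variables (R : realType) (T : nat -> nat -> nat) (D : sampler R) (C1 C2 C3 : R).
Hypotheses (C10 : 0 < C1) (C20 : 0 < C2) (C30 : 0 < C3) (LM : lovett_meka C1 C2 C3 D).
Variables (m n k : nat) (p : \bar R).
Hypotheses (m0 : (0 < m)%N) (k0 : (0 < k)%N) (p2 : (2%:E <= p)%E) (nm : (n <= m.+1)%N).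
Variables (V : 'I_n -> 'rV[R]_m) (lam : 'I_n -> R).
Implicit Types s : state R.

Let s0 := input k p V lam.
Let inp := rmem s0.
Local Notation scale := (scale C1 C2 C3 m k p).

Lemma input_body (i : 'I_n) (j : 'I_m) : inp (i * m + j)%N = V i 0 j.
Proof.
rewrite /inp /s0 /= nth_cat size_allpairs !size_enum_ord.
have -> : (i * m + j < n * m)%N by have := ltn_ord i; have := ltn_ord j; nia.
have := @nth_allpairs _ _ _ (fun i j => V i 0 j) (enum 'I_n) (enum 'I_m) 0 i j i j.
by rewrite !size_enum_ord !nth_ord_enum => ->.
Qed.

Lemma input_lam (i : 'I_n) : inp (n * m + i)%N = lam i.
Proof.
rewrite /inp /s0 /= nth_cat size_allpairs !size_enum_ord ltnNge leq_addr/= addKn.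
rewrite nth_cat size_map size_enum_ord ltn_ord (nth_map i) ?size_enum_ord//.
by rewrite nth_ord_enum.
Qed.

Lemma body_vecE (i : 'I_n) : body_vec m inp i = V i.
Proof. by apply/rowP => j; rewrite mxE input_body. Qed.

Lemma comboE (c : nat -> nat) :
  \sum_(0 <= i < n) (c i)%:R *: body_vec m inp i = combo V (fun i => c i).
Proof. by rewrite big_mkord; apply: eq_bigr => i _; rewrite body_vecE. Qed.

Lemma start_header l s : nmem s 4 = (2 ^ l)%N -> nmem s 5 = l ->
  (forall b, b <> 4%N -> b <> 5%N -> nmem s b = nmem s0 b) -> rmem s = rmem s0 ->
  header m n k inp l s.
Proof.
move=> h4 h5 hN hM; split=> //; try by rewrite hN.
by move=> j _; rewrite hM.
Qed.

Section Correctness.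
Hypotheses (V1 : forall i, lpnorm p (V i) <= 1) (lam0 : forall i, 0 <= lam i)
  (lam1 : \sum_i lam i = 1).

Lemma failure_sum l : \sum_(i < l) \sum_(r < l) failure R (l - i.+1) r <= 2^-1.
Proof.
(* [q] is slack^-2, so the double sum is at most 2 / 21^2 times (400 / 39)^2. The 21 in [threshold]
   is the least integer that makes this at most 1/2. *)
pose q : R := (19 / 20) ^+ 2.
have q0 : 0 <= q by exact: sqr_ge0.
have q1 : q < 1 by rewrite /q; lra.
have fE j r : failure R j r = 2 / 441 * q ^+ j * q ^+ r.
  have qE : q = (slack R ^+ 2)^-1 by rewrite /q /slack; field.
  rewrite /failure /threshold -mulrA -exprD qE exprMn exprAC exprVn.
  have S0 : slack R ^+ 2 ^+ (j + r) != 0 by rewrite !expf_neq0// /slack; lra.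
  by move: (slack R ^+ 2 ^+ (j + r)) S0 => S S0; field.
have := reindex_inj rev_ord_inj (P := xpredT) (F := fun i : 'I_l => \sum_(r < l) failure R i r).
rewrite /= => <-.
have hS := geo_sum_le l q0 q1.
have S0 : 0 <= \sum_(i < l) q ^+ i by apply: sumr_ge0 => i _; exact: exprn_ge0.
have -> : \sum_(i < l) \sum_(r < l) failure R i r =
    2 / 441 * ((\sum_(i < l) q ^+ i) * (\sum_(i < l) q ^+ i)).
  rewrite mulrA big_distrr/=; apply: eq_bigr => i _.
  rewrite mulrAC big_distrr/=; apply: eq_bigr => r _.
  by rewrite fE.
have qE : (1 - q)^-1 = 400 / 39 by rewrite /q; field.
rewrite qE in hS; set S := \sum_(i < l) _ in hS S0 *.
have : S * S <= 400 / 39 * (400 / 39) by apply: ler_pM.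
lra.
Qed.

Lemma algorithm_good : good D (fun s => size (output n s) = k /\
    lpnorm p (\sum_i lam i *: V i - k%:R^-1 *: \sum_(i <- output n s) V i) <=
      (6 + 361 * (21 * draw_cst C1 C2 C3)) * rate m k p)
  2^-1 (exec T algorithm s0).
Proof.
have n0 : (0 < n)%N.
  rewrite lt0n; apply/eqP => nE; move: lam1; rewrite big1 => [/esym/eqP|i _].
    by rewrite oner_eq0.
  by exfalso; have := leq_ltn_trans (leq0n i) (ltn_ord i); rewrite nE.
have half0 : 0 <= 2^-1 :> R by [].
have body1 i : (i < n)%N -> lpnorm p (body_vec m inp i) <= 1.
  by move=> iN; rewrite (body_vecE (Ordinal iN)).
rewrite -[2^-1]add0r; apply: (good_seq _ _ (wp_good D (@pow_loopP R T m s0 m0 erefl))) => //.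
move=> s1 [l [h4 h5 ml l2 [hN hM _]]].
have h1 := start_header h4 h5 hN hM.
rewrite -[2^-1]add0r; apply: (good_seq _ _ (wp_good D (trunc_loopP T h1))) => //.
move=> s2 [h2 hC _].
(* The strict m < 2^l makes room for the (m + 1)-st vector. *)
have nl : (n <= 2 ^ l)%N by apply: leq_trans nm _.
have [t1 t2 t3] := truncation k p2 V1 lam0 lam1 nl.
pose cV s := combo V (fun i : 'I_n => nmem s (20 + i)).
pose S s := (\sum_(0 <= i < n) nmem s (20 + i))%N.
have SE s : S s = (\sum_(i < n) nmem s (20 + i))%N by rewrite /S big_mkord.
have cE : (fun i : 'I_n => nmem s2 (20 + i)) = (fun i => Num.truncn (k%:R * lam i * 2 ^+ l)).
  by apply/funext => i; rewrite hC// input_lam.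
have {}t3 : lpnorm p (k%:R *: \sum_i lam i *: V i - (2 ^+ l)^-1 *: cV s2) <= 1.
  by rewrite /cV cE.
have t1' : (S s2 <= k * 2 ^ l)%N by rewrite SE (eq_bigr _ (fun i _ => congr1 (@^~ i) cE)).
have t2' : (k * 2 ^ l < S s2 + n)%N by rewrite SE (eq_bigr _ (fun i _ => congr1 (@^~ i) cE)).
(* The error bound of [level_good] at level j, divided by 2^(j+1). Iteration i treats the level j =
   l - i - 1, so the denominator is 2^(l - i) before it. *)
pose e j := 2^-1 ^+ j / 2 + 19 * scale * rho R ^+ j.
pose I i s := [/\ header m n k inp l s, (S s <= k * 2 ^ (l - i))%N,
  (S s2 < 2 ^ i * (S s).+1)%N &
  lpnorm p ((2 ^+ l)^-1 *: cV s2 - (2 ^+ (l - i))^-1 *: cV s) <=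
    \sum_(i' < i) e (l - i'.+1)%N].
have lE : neval s2 (NGet (NConst 5)) = l by rewrite /= (hd_l h2).
rewrite -[2^-1]addr0; apply: (@good_seq _ _ _ (I l)) => //.
  have f0 i : 0 <= \sum_(r < l) failure R (l - i.+1) r.
    by apply: sumr_ge0 => r _; exact: failure_ge0.
  have := @good_repeat R T D I (fun i => \sum_(r < l) failure R (l - i.+1) r)
    (NGet (NConst 5)) level s2 f0; rewrite lE => hrep.
  apply: good_weaken (hrep _ _); rewrite ?failure_sum//; first exact: sumr_ge0.
    split=> //.
    - by case: h2.
    - by rewrite subn0.
    - by rewrite expn0 mul1n.
    - by rewrite subn0 subrr lpnorm0// big_ord0.
  move=> i s3 il [h3 S3 S23 hV3].
  have h3' : header m n k inp l (tick 1 s3) by case: h3.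
  have liE : (l - i)%N = (l - i.+1).+1 by lia.
  rewrite liE in S3 hV3; set j := (l - i.+1)%N in S3 hV3 *.
  apply: good_weaken (level_good T C10 C20 C30 LM m0 k0 p2 nm body1 h3' ml S3) => //.
    by apply: sumr_ge0 => r _; exact: failure_ge0.
  move=> s4 [h4' a1 a2 a3].
  rewrite -/(S s4) -/(S s3) in a1 a2.
  split=> //.
  - by rewrite -/j; move: S3; rewrite expnS; lia.
  - by rewrite expnS; move: S23 a2; nia.
  rewrite -/j big_ord_recr/= -/j.
  rewrite !comboE -/(cV s4) -[combo V _]/(cV s3) in a3.
  have P0 : 0 < 2 ^+ j :> R by rewrite exprn_gt0.
  have -> : (2 ^+ l)^-1 *: cV s2 - (2 ^+ j)^-1 *: cV s4 =
     ((2 ^+ l)^-1 *: cV s2 - (2 ^+ j.+1)^-1 *: cV s3) +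
     (2 ^+ j.+1)^-1 *: (cV s3 - 2 *: cV s4).
    rewrite scalerBr scalerA.
    have -> : (2 ^+ j.+1)^-1 * 2 = (2 ^+ j)^-1 :> R by rewrite exprS; field; rewrite gt_eqF.
    by rewrite addrA subrK.
  apply: le_trans (ler_lpnormD _ _ p2) _; apply: lerD => //.
  have Pl0 : 0 <= (2 ^+ j.+1)^-1 :> R by rewrite invr_ge0 exprn_ge0.
  rewrite lpnormZ// ger0_norm//; apply: le_trans (ler_wpM2l Pl0 a3) _.
  rewrite le_eqVlt; apply/orP; left; apply/eqP.
  by rewrite /e exprS exprVn; field; rewrite gt_eqF.
move=> s3 [h3 S3 S23 hV3]; rewrite subnn expn0 muln1 expr0 invr1 scale1r in S3 hV3.
apply: halts_good; apply: halts_weaken (finalP T h3) => s4 [hb hC4 _].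
have outE : output n s4 = occurrences (fun i : 'I_n =>
    (nmem s3 (20 + i) + (i == Ordinal n0) * (k - \sum_(i < n) nmem s3 (20 + i)))%N).
  rewrite /output /occurrences hb; congr flatten; apply: eq_map => i.
  by rewrite hC4// big_mkord.
have S3k : (\sum_(i < n) nmem s3 (20 + i) <= k)%N by rewrite -SE.
have kS3 : (k <= (\sum_(i < n) nmem s3 (20 + i)).+1)%N.
  rewrite -SE -ltnS; have P0 : (0 < 2 ^ l)%N by rewrite expn_gt0.
  rewrite -(ltn_pmul2l P0) mulnC; apply: leq_trans t2' _.
  move: nl S23; nia.
(* 361 = 19^2: one factor 19 from the rounds within a level, one from the levels. *)
have sum_e : \sum_(i < l) e (l - i.+1)%N <= 1 + 361 * scale.
  have := reindex_inj rev_ord_inj (P := xpredT) (F := fun i : 'I_l => e i).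
  rewrite /= => <-.
  rewrite big_split/= -mulr_suml -big_distrr/=.
  have g1 := @geo_sum_le R 2^-1 l (ltac:(lra)) (ltac:(lra)).
  rewrite (_ : (1 - 2^-1)^-1 = 2) in g1; last by field.
  have g2 := @geo_sum_le R (rho R) l (ltac:(by rewrite /rho; lra)) (ltac:(by rewrite /rho; lra)).
  rewrite (_ : (1 - rho R)^-1 = 19) in g2; last by rewrite /rho; field.
  have sc0 := scale_ge0 C1 C2 C30 m k p.
  have := ler_wpM2l sc0 g2.
  move: g1; set x := \sum_(i < l) _; set y := \sum_(i < l) _; lra.
have hE := le_trans hV3 sum_e.
have := ler_lpnormD (k%:R *: (\sum_i lam i *: V i) - (2 ^+ l)^-1 *: cV s2)
  ((2 ^+ l)^-1 *: cV s2 - cV s3) p2.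
rewrite addrA subrK => /le_trans/(_ (lerD t3 hE)) hE2.
have [sk hk] := finish k0 p2 V1 (Ordinal n0) S3k kS3 hE2.
rewrite outE size_occurrences sum_occurrences; split; first exact: sk.
apply: le_trans hk _.
have -> : 1 + (1 + 361 * scale) + 1 =
  3 + (361 * (21 * draw_cst C1 C2 C3)) * Num.sqrt (k%:R * minpl m k p).
  by rewrite /scale; ring.
apply: le_trans (minpl_rate _ m0 k0 p2 _) _ => //.
by have -> : 2 * 3 = 6 :> R by ring.
Qed.

End Correctness.
End Algorithm.

(** * Running time *)

Section Cost.
Variables (R : realType) (CT : R) (T : nat -> nat -> nat) (m n k : nat).
Hypotheses (hT : sampling_time CT T) (m0 : (0 < m)%N) (nm : (n <= m.+1)%N).
Implicit Types s : state R.

Let Tm := T m m.+1.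

(** All work outside the sampler is charged to it: building the matrix takes O(m (m + 1)) steps and
    everything else in a round O(m + 1), both O(Tm). *)
Let Tm_ge : (m * m.+1 <= Tm)%N. Proof. exact: st_ge hT _ _. Qed.

Let Tm_ge2 : (m.+1 <= Tm)%N.
Proof. by apply: leq_trans Tm_ge; rewrite leq_pmull. Qed.

Let Ta a : (a <= n)%N -> (T m a <= Tm)%N.
Proof. by move=> an; apply: st_homo hT _ _ _ _ _ _ => //; exact: leq_trans nm. Qed.

Lemma round_always inp l s : header m n k inp l s -> (nmem s 8 <= n)%N ->
  active_wf m n (nmem s) (rmem s) (nmem s 8) ->
  always (fun s' => [/\ header m n k inp l s', (nmem s' 8 <= n)%N,
      active_wf m n (nmem s') (rmem s') (nmem s' 8) &
      (clock s' <= clock s + m * (300 * nmem s 8 + 400) + 150 * n + 300 + T m (nmem s 8))%N])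
    (exec T round s).
Proof.
move=> hs; move aE : (nmem s 8) => a an wf.
have [A [x0 [K [-> AW x0E hK]]]] := roundP T hs aE an wf.
move=> x x1; apply: halts_always; apply: halts_weaken (hK x x1) => s' [q1 q2 q3 q4 q5].
by split=> //; move: q2 an; lia.
Qed.

Lemma level_always inp l s : header m n k inp l s ->
  always (fun s' => header m n k inp l s' /\
    (clock s' <= clock s + 300 * Tm + l * (1400 * Tm))%N) (exec T level s).
Proof.
move=> hs; apply: always_seq (wp_always (setupP T hs)) _.
move=> s1 [h1 an wf1 _ hc].
pose I r s' := [/\ header m n k inp l s', (nmem s' 8 <= n)%N,
  active_wf m n (nmem s') (rmem s') (nmem s' 8) &
  (clock s' <= clock s1 + 3 + r * (1400 * Tm))%N].
have nl : neval s1 (NGet (NConst 5)) = l by rewrite /= (hd_l h1).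
have := @always_repeat R T I (NGet (NConst 5)) round s1; rewrite nl => hrep.
apply: always_weaken (hrep _ _).
- move=> s' [q1 _ _ q4]; split=> //.
  move: q4 hc nm Tm_ge2; set t := (l * _)%N; lia.
- split=> //=; [by case: h1|lia| |lia].
  by move=> t ta; have [w1 w2 ->] := wf1 t ta; rewrite normr0.
- move=> r s2 rl [h2 a2 wf2 c2].
  have h2t : header m n k inp l (tick 1 s2) by case: h2.
  apply: always_weaken (round_always h2t a2 wf2) => s3 [q1 q2 q3 q4]; split=> //.
  apply: leq_trans q4 _ => /=.
  have := Ta a2; have am : (nmem s2 8 <= m.+1)%N by apply: leq_trans nm.
  have : (m * (300 * nmem s2 8 + 400) <= 300 * (m * m.+1) + 400 * m)%N by nia.
  move: c2 nm Tm_ge Tm_ge2; rewrite mulSn; set t := (r * _)%N; lia.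
Qed.

Lemma algorithm_always p (V : 'I_n -> 'rV[R]_m) (lam : 'I_n -> R) :
  always (fun s => exists2 l : nat, (2 ^ l <= 2 * m)%N &
      (clock s <= (l * l + 1) * (1400 * Tm) + l * (400 * Tm))%N)
    (exec T algorithm (input k p V lam)).
Proof.
set s0 := input k p V lam.
apply: always_seq (wp_always (@pow_loopP R T m s0 m0 erefl)) _.
move=> s1 [l [h4 h5 ml l2 [hN hM hc1]]].
have h1 := start_header h4 h5 hN hM.
apply: always_seq (wp_always (trunc_loopP T h1)) _.
move=> s2 [h2 hC hc2].
pose I i s' := header m n k (rmem s0) l s' /\
  (clock s' <= clock s2 + 3 + i * (l * (1400 * Tm) + 400 * Tm))%N.
have nl : neval s2 (NGet (NConst 5)) = l by rewrite /= (hd_l h2).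
have := @always_repeat R T I (NGet (NConst 5)) level s2; rewrite nl => hrep.
have loop : always (I l) (exec T (CRepeat (NGet (NConst 5)) level) s2).
  apply: hrep; first by split=> //=; [by case: h2|lia].
  move=> i s3 il [h3 c3].
  have h3t : header m n k (rmem s0) l (tick 1 s3) by case: h3.
  apply: always_weaken (level_always h3t) => s4 [q1 q2]; split=> //.
  apply: leq_trans q2 _ => /=.
  move: c3 Tm_ge2; rewrite mulSn; set t := (i * _)%N; set u := (l * _)%N; lia.
apply: always_seq loop _ => s3 [h3 c3].
apply: always_weaken (wp_always (finalP T h3)) => s4 [_ _ c4].
exists l => //; apply: leq_trans c4 _.
have e : (l * (l * (1400 * Tm) + 400 * Tm) = l * l * (1400 * Tm) + l * (400 * Tm))%N by nia.
rewrite e in c3; rewrite mulnDl mul1n.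
move: c3 hc2 hc1 nm Tm_ge2; rewrite [clock s0]/=.
set t := (l * l * _)%N; set u := (l * (400 * Tm))%N; lia.
Qed.

End Cost.

(** * Assembling the theorem *)

Lemma log2_le_logm (R : realType) (m l : nat) : (0 < m)%N -> (2 ^ l <= 2 * m)%N ->
  l%:R <= 4 * logm R m.
Proof.
move=> m0 lm; have l2 := ln2_ge R.
have M0 : 0 < m%:R :> R by rewrite ltr0n.
have X0 : 0 < (maxn m 2)%:R :> R by rewrite ltr0n leq_max orbT.
have h2 : ln 2 <= logm R m by rewrite /logm ler_ln ?posrE// ler_nat leq_maxr.
have hm : ln m%:R <= logm R m by rewrite /logm ler_ln ?posrE// ler_nat leq_maxl.
have : ln (2 ^+ l) <= ln (2 * m%:R) :> R.
  by rewrite ler_ln ?posrE ?exprn_gt0 ?mulr_gt0// -natrX -natrM ler_nat.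
rewrite lnXn// lnM ?posrE// -[_ *+ l]mulr_natr => h.
have l0 : 0 <= l%:R :> R by [].
(* l ln 2 <= ln 2 + ln m <= 2 * [logm], and ln 2 >= 1/2 gives the factor 4. *)
nra.
Qed.

Theorem corollary5 (R : realType) :
  (exists C : R, 0 < C /\
     forall (m k : nat) (p : \bar R),
       (0 < m)%N -> (0 < k)%N -> (2%:E <= p)%E ->
       (ac k (lpball m p) (lpball m p) <= (C * rate m k p)%:E)%E)
  /\
  (forall C1 C2 C3 CT : R, 0 < C1 -> 0 < C2 -> 0 < C3 -> 0 < CT ->
   exists (C C' C'' : R) (alg : cmd), [/\ 0 < C, 0 < C', 0 < C'' &
     forall (D : sampler R) (T : nat -> nat -> nat),
       lovett_meka C1 C2 C3 D -> sampling_time CT T ->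
       forall (m k : nat) (p : \bar R),
         (0 < m)%N -> (0 < k)%N -> (2%:E <= p)%E ->
         (forall (X : set 'rV[R]_m) (z : 'rV[R]_m)
                 (n : nat) (lam : 'I_n -> R) (V : 'I_n -> 'rV[R]_m),
            X `<=` lpball m p -> (n <= m.+1)%N ->
            (forall i, X (V i)) -> (forall i, 0 <= lam i) ->
            \sum_i lam i = 1 -> z = \sum_i lam i *: V i ->
            let r := exec T alg (input k p V lam) in
            always (fun s => (clock s)%:R
                      <= C' * logm R m ^+ 2 * (T m m.+1)%:R) r /\
            ((2^-1)%:E <= prob D (fun s =>
               size (output n s) = k /\
               (lpnorm p (z - k%:R^-1 *: \sum_(i <- output n s) V i)
                 <= C * rate m k p)%R) r)%E) /\
         C' * logm R m ^+ 2 * (T m m.+1)%:R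
           <= C'' * m%:R `^ (1 + omega R) * logm R m ^+ 2]).
Proof.
split.
  exists (ac_cst R); split.
    by rewrite /ac_cst; have := colour_cst_ge0 R; lra.
  by move=> m k p; exact: ac_le.
move=> C1 C2 C3 CT C10 C20 C30 CT0.
pose C := 6 + 361 * (21 * draw_cst C1 C2 C3).
pose A : R := (1400 * 24)%N%:R.
have [A0 AE] : 0 < A /\ A = (1400 * 24)%N%:R by split=> //; rewrite ltr0n.
pose B := CT * (2 `^ (1 + omega R) + 4).
have B0 : 0 < B.
  by rewrite mulr_gt0// addr_gt0// powR_gt0.
have Cp : 0 < C.
  rewrite /C ltr_pwDl// mulr_ge0 ?mulr_ge0 ?draw_cst_ge0//.
exists C, A, (A * B), algorithm; split=> //; first exact: mulr_gt0.
move=> D T LM hT m k p m0 k0 p2; split; last first.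
  have hs := sampling_time_le CT0 hT m0.
  have -> : A * B * m%:R `^ (1 + omega R) * logm R m ^+ 2 =
      A * logm R m ^+ 2 * (B * m%:R `^ (1 + omega R)) by ring.
  by apply: ler_wpM2l => //; apply: mulr_ge0; [exact: ltW|exact: sqr_ge0].
move=> X z n lam V XP nm XV lam0 lam1 ->.
have V1 i : lpnorm p (V i) <= 1 by exact: XP (XV i).
split; last first.
  have -> : 2^-1 = 1 - 2^-1 :> R by field.
  by apply: good_prob => //; exact: algorithm_good.
apply: always_weaken (algorithm_always k hT m0 nm p V lam) => s [l lm hc].
have hl := log2_le_logm R m0 lm.
have l2 := ln2_ge R.
have hL : 2^-1 <= logm R m.
  by apply: le_trans l2 _; rewrite /logm ler_ln ?posrE ?ltr0n ?leq_max ?orbT// ler_nat leq_maxr.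
have {}hc : (clock s)%:R <= ((l * l + 1) * (1400 * T m m.+1) + l * (400 * T m m.+1))%N%:R :> R.
  by rewrite ler_nat.
apply: le_trans hc _.
have l0 : 0 <= l%:R :> R by [].
(* With L = [logm] >= 1/2: l^2 <= 16 L^2, 1 <= 4 L^2 and 400 l <= 1600 L <= 3200 L^2, in total at
   most 31200 L^2, below 1400 * 24 L^2. *)
have coef : (l * l + 1)%N%:R * 1400%N%:R + l%:R * 400%N%:R <= A * logm R m ^+ 2.
  rewrite AE natrD !natrM; nra.
have -> : ((l * l + 1) * (1400 * T m m.+1) + l * (400 * T m m.+1))%N%:R =
    ((l * l + 1)%N%:R * 1400%N%:R + l%:R * 400%N%:R) * (T m m.+1)%:R :> R.
  by rewrite -!natrM -natrD -natrM [in RHS]mulnDl !mulnA.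
by apply: ler_wpM2r.
Qed.
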